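(* Consider the finite-horizon stochastic optimal control problem with the $\phi$-divergence distributionally robust risk $\mathcal R^\pi$, where $\phi$ has superlinear growth, and the empirical risks described in the context. (i) Let $\pi$ be a randomized Markovian policy of the augmented problem with $\|\pi_t(\cdot|s,x)-\pi_t(\cdot|s',x')\|_1\le L_\pi\|(s,x)-(s',x')\|$ for all $0\le t\le T$, $s,s'\in\mathcal S_t$, $x,x'\in\mathcal X_t$, for some $L_\pi>0$. For any $\epsilon>0$ and $\delta\in(0,1)$, take $$n=\mathcal O\left(\frac{T^3\,g_\phi^{-1}(16T\tau/\epsilon)^2\,d_{\mathcal S}}{\epsilon^2}\log\left(\frac{T\,L_\pi\,L\,\tau\,g_\phi^{-1}(16T\tau/\epsilon)}{\delta\epsilon}\right)\right).$$ Then with probability at least $1-\delta$, $|\hat{\mathcal R}^\pi_n(s)-\mathcal R^\pi(s)|\le\epsilon$ for all $s\in\mathcal S_0$. (ii) In addition, for any $\epsilon>0$ and $\delta\in(0,1)$, take $$n=\mathcal O\left(\frac{T^4\,g_\phi^{-1}(16T\tau/\epsilon)^2\,(d_{\mathcal S}+d_{\mathcal A})}{\epsilon^2}\log\left(\frac{T\,L\,\tau\,g_\phi^{-1}(16T\tau/\epsilon)}{\delta\epsilon}\right)\right).$$ Then with probability at least $1-\delta$, $|\hat{\mathcal R}^*_n(s)-\mathcal R^*(s)|\le\epsilon$ for all $s\in\mathcal S_0$.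
   Context: Stochastic optimal control (SOC) problem: $T$ is a positive integer; for $0\le t\le T$, $\mathcal S_t\subseteq\mathbb R^{d_{\mathcal S}}$ is a state space, $\mathcal A_t\subseteq\mathbb R^{d_{\mathcal A}}$ a control space, $c_t:\mathcal S_t\times\mathcal A_t\to[0,1]$ a continuous cost; for $0\le t\le T-1$, $F_t:\mathcal S_t\times\mathcal A_t\times\Xi_t\to\mathcal S_{t+1}$ is a continuous transition function and the noise $\xi_t\in\Xi_t$ has distribution $P_t$, not depending on state or action; $\xi_0,\dots,\xi_{T-1}$ are independent. $S_{t+1}=F_t(S_t,A_t,\xi_t)$. $\Pi(\mathcal M)$ is the set of randomized history-dependent policies: $A_t\sim\pi(\cdot|H_t)$, $H_t=\xi_{[t-1]}=(\xi_0,\dots,\xi_{t-1})$. Assumptions on the SOC: each $\mathcal S_t$ and each $\mathcal A_t$ is compact with radius $R$; there is a constant $L>0$ with $|c_t(s,a)-c_t(s',a')|\le L\|(s,a)-(s',a')\|$ and $\|F_t(s,a,\xi)-F_t(s',a',\xi)\|\le L\|(s,a)-(s',a')\|$ for all $s,s'\in\mathcal S_t$, $a,a'\in\mathcal A_t$, $\xi\in\Xi_t$ and all $t$. Norms are Euclidean. Augmented state: $\mathcal X_t=[0,t]$, $X_0=0$, $X_{t+1}=X_t+c_t(S_t,A_t)$; a randomized Markovian policy of the augmented problem takes $A_t\sim\pi_t(\cdot|S_t,X_t)$. $\|\cdot\|_1$ between probability measures is the total mass of the absolute difference. Divergence function: $\phi:\mathbb R\to\mathbb R_+\cup\{+\infty\}$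 is convex and lower semicontinuous, $\phi(1)=0$, $\phi(x)=+\infty$ for $x<0$, and $\lim_{x\to\infty}\phi(x)/x=\infty$. Its growth function is $g_\phi(x)=\inf_{x'\ge x}\phi(x')/x'$ for $x\ge1$, with inverse $g_\phi^{-1}(y)=\inf\{x:\ x\ge1,\ g_\phi(x)\ge y\}$. $\tau>0$ is the ambiguity radius. Risk: with $Z=\sum_{t=0}^Tc_t(S_t,A_t)$, $$\mathcal R^\pi(s)=\min_{\lambda\ge0,\ \mu\in\mathbb R}\Big\{\lambda\tau+\mu+\mathbb E^\pi_{P}\big[(\lambda\phi)^*(Z-\mu)\mid S_0=s\big]\Big\},$$ where $(\lambda\phi)^*(y)=\sup_x\{xy-\lambda\phi(x)\}$ is the convex conjugate of $\lambda\phi$ (with $0\cdot(+\infty)=+\infty$). $\mathcal R^*(s)=\min_{\pi\in\Pi(\mathcal M)}\mathcal R^\pi(s)$. Sampling: for every $0\le t\le T-1$ one draws $n$ i.i.d. samples from $P_t$ (independently over $t$), with empirical distribution $\hat P_{t,n}$. $\hat{\mathcal R}^\pi_n$ is $\mathcal R^\pi$ with $P_t$ replaced by $\hat P_{t,n}$; $\hat{\mathcal R}^*_n(s)=\min_{\pi\in\Pi(\mathcal M)}\hat{\mathcal R}^\pi_n(s)$. In (i), $\pi$ is a given policy, not depending on the samples.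
   Formalization: The constant in O(.) may depend on the radius R and on a positive lower bound of L, L_pi and tau (in (ii): of L and tau), and log is read as max(1, log); with an absolute constant and the literal log the claim fails, e.g. for a constant policy with L_pi = 1/L and L large. *)

(* Defs.v *)
From HB Require Import structures.
From mathcomp Require Import all_boot all_order all_algebra.
From mathcomp Require Import all_classical all_reals all_analysis.

Set Implicit Arguments.
Unset Strict Implicit.
Unset Printing Implicit Defensive.

Import Order.TTheory GRing.Theory Num.Theory.
Import numFieldNormedType.Exports.

Local Open Scope classical_set_scope.
Local Open Scope ring_scope.

(* The library norm on row vectors is the sup norm.  The Euclidean norm of a
   pair (u, v) is written [enorm (row_mx u v)]. *)
Definition enorm (R : realType) (d : nat) (u : 'rV[R]_d) : R :=
  Num.sqrt (\sum_i u ord0 i ^+ 2).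

Definition borel (X : ptopologicalType) : measurableType (@open X).-sigma :=
  g_sigma_algebraType (@open X).

(* ||mu - nu||_1, the total mass of the variation |mu - nu|. *)
Definition l1dist (d : measure_display) (X : measurableType d) (R : realType)
    (mu nu : {finite_measure set X -> \bar R}) : \bar R :=
  let rho : {charge set X -> \bar R} :=
    cadd (charge_of_finite_measure mu) (copp (charge_of_finite_measure nu)) in
  let: exist _ PN := cid (Hahn_decomposition rho) in
  let: exist _ rhoPN := cid PN in
  charge_variation rhoPN [set: X].

(* k x as a finite measure: the library declares k x as a measure only. *)
Section KernelLaw.
Context {d d' : measure_display} {X : measurableType d} {Y : measurableType d'}
  {R : realType}.
Variables (k : R.-pker X ~> Y) (x : X).

Definition kernel_law : set Y -> \bar R := k x.

HB.instance Definition _ := Measure.on kernel_law.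

Let kernel_law_fin : fin_num_fun kernel_law.
Proof. exact: finite_kernel_measure. Qed.

HB.instance Definition _ :=
  @Measure_isFinite.Build _ _ _ kernel_law kernel_law_fin.

End KernelLaw.

Section Divergence.
Context {R : realType}.
Implicit Types phi : R -> \bar R.

(* In the convexity inequality the weights are in the open interval ]0, 1[, so
   that no product 0 * +oo occurs. *)
Record divergence_function phi : Prop := DivergenceFunction {
  divergence_ge0 : forall x, (0 <= phi x)%E;
  divergence_convex : forall x y p : R, 0 < p -> p < 1 ->
    (phi (p * x + (1 - p) * y)%R <= p%:E * phi x + (1 - p)%:E * phi y)%E;
  divergence_lsc : lower_semicontinuous phi;
  divergence1 : phi 1 = 0%E;
  divergence_neg : forall x : R, x < 0 -> phi x = +oo%E;
  divergence_superlinear : (phi x * (x^-1)%:E)%E @[x --> +oo] --> +oo%E }.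

Definition growth phi (x : R) : \bar R :=
  ereal_inf [set (phi x' * (x'^-1)%:E)%E | x' in [set x' | x <= x']].

Definition growth_inv phi (y : R) : R :=
  inf [set x | 1 <= x /\ (y%:E <= growth phi x)%E].

(* lambda phi with the convention 0 * (+oo) = +oo; the library product
   satisfies 0 * (+oo) = 0. *)
Definition scaled (lambda : R) phi (x : R) : \bar R :=
  if phi x == +oo%E then +oo%E else (lambda%:E * phi x)%E.

Definition conjugate (f : R -> \bar R) (y : R) : \bar R :=
  ereal_sup [set ((x * y)%:E - f x)%E | x in [set: R]].

End Divergence.

(* The data are indexed by all of nat; with horizon T only the indices t <= T
   (t < T for noise and trans) are used.  cost t and trans t are meaningful on
   state t and control t only. *)
Record soc (R : realType) (dS dA : nat) := Soc {
  state : nat -> set 'rV[R]_dS;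
  control : nat -> set 'rV[R]_dA;
  noise : nat -> ptopologicalType;
  cost : nat -> 'rV[R]_dS -> 'rV[R]_dA -> R;
  trans : forall t, 'rV[R]_dS -> 'rV[R]_dA -> noise t -> 'rV[R]_dS }.

Section Soc.
Context {R : realType} {dS dA : nat}.
Variable M : soc R dS dA.

Record soc_wf (T : nat) : Prop := SocWf {
  control_neq0 : forall t, (t <= T)%N -> control M t !=set0;
  cost_itv : forall t s a, (t <= T)%N -> state M t s -> control M t a ->
    0 <= cost M t s a <= 1;
  cost_continuous : forall t, (t <= T)%N ->
    {within state M t `*` control M t,
      continuous (fun p : 'rV[R]_dS * 'rV[R]_dA => cost M t p.1 p.2)};
  trans_state : forall t s a (xi : noise M t), (t < T)%N ->
    state M t s -> control M t a -> state M t.+1 (trans s a xi);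
  trans_continuous : forall t, (t < T)%N ->
    {within (state M t `*` control M t) `*` [set: noise M t],
      continuous (fun p : ('rV[R]_dS * 'rV[R]_dA) * noise M t =>
        trans p.1.1 p.1.2 p.2)} }.

Record soc_regular (T : nat) (rad L : R) : Prop := SocRegular {
  state_compact : forall t, (t <= T)%N -> compact (state M t);
  state_radius : forall t, (t <= T)%N ->
    exists z, forall s, state M t s -> enorm (s - z) <= rad;
  control_compact : forall t, (t <= T)%N -> compact (control M t);
  control_radius : forall t, (t <= T)%N ->
    exists z, forall a, control M t a -> enorm (a - z) <= rad;
  cost_lipschitz : forall t s s' a a', (t <= T)%N ->
    state M t s -> state M t s' -> control M t a -> control M t a' ->
    `|cost M t s a - cost M t s' a'| <= L * enorm (row_mx (s - s') (a - a'));
  trans_lipschitz : forall t s s' a a' (xi : noise M t), (t < T)%N ->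
    state M t s -> state M t s' -> control M t a -> control M t a' ->
    enorm (trans s a xi - trans s' a' xi)
      <= L * enorm (row_mx (s - s') (a - a')) }.

(* H_t = (xi_0, ..., xi_(t-1)) *)
Fixpoint history_display (t : nat) : measure_display :=
  if t is t'.+1
  then measure_prod_display (history_display t', sigma_display (@open (noise M t')))
  else default_measure_display.

Fixpoint history (t : nat) : measurableType (history_display t) :=
  match t return measurableType (history_display t) with
  | 0 => unit
  | t'.+1 => (history t' * borel (noise M t'))%type
  end.

(* (a_0, xi_0, ..., a_(t-1), xi_(t-1)) *)
Fixpoint traj (t : nat) : Type :=
  if t is t'.+1 then (traj t' * ('rV[R]_dA * noise M t'))%type else unit.

Fixpoint traj_history (t : nat) : traj t -> history t :=
  match t return traj t -> history t with
  | 0 => fun=> tt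
  | t'.+1 => fun w => (traj_history w.1, w.2.2)
  end.

(* S_t, when S_0 = s *)
Fixpoint traj_state (s : 'rV[R]_dS) (t : nat) : traj t -> 'rV[R]_dS :=
  match t return traj t -> 'rV[R]_dS with
  | 0 => fun=> s
  | t'.+1 => fun w => trans (traj_state s w.1) w.2.1 w.2.2
  end.

(* X_t = c_0(S_0, A_0) + ... + c_(t-1)(S_(t-1), A_(t-1)), when S_0 = s *)
Fixpoint traj_cost (s : 'rV[R]_dS) (t : nat) : traj t -> R :=
  match t return traj t -> R with
  | 0 => fun=> 0
  | t'.+1 => fun w =>
      traj_cost s w.1 + cost M t' (traj_state s w.1) w.2.1
  end.

(* The law of A_t given the past trajectory. *)
Definition rule :=
  forall t, traj t -> {measure set (borel 'rV[R]_dA) -> \bar R}.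

(* Integral of the functional g t over A_t, xi_t, ..., A_(t+k), starting from
   the trajectory w, where A_u follows kappa u and xi_u follows P u
   independently of the past.  In [soc_expectation] it is the integral with respect
   to the (Ionescu-Tulcea) law of (A_0, xi_0, ..., xi_(T-1), A_T). *)
Fixpoint iterated_integral
    (P : forall t, {measure set (borel (noise M t)) -> \bar R}) (kappa : rule)
    (g : forall t, traj t -> 'rV[R]_dA -> \bar R) (k t : nat) (w : traj t)
    : \bar R :=
  match k with
  | 0 => \int[kappa t w]_(a in control M t) g t w a
  | k'.+1 => \int[kappa t w]_(a in control M t) \int[P t]_xi
      @iterated_integral P kappa g k' t.+1 (w, (a, xi))
  end%E.

(* E[f(Z) | S_0 = s] with Z = X_T + c_T(S_T, A_T) *)
Definition soc_expectation (T : nat)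
    (P : forall t, {measure set (borel (noise M t)) -> \bar R}) (kappa : rule)
    (s : 'rV[R]_dS) (f : R -> \bar R) : \bar R :=
  @iterated_integral P kappa
    (fun t w a => f (traj_cost s w + cost M t (traj_state s w) a)) T 0%N tt.

Definition risk (T : nat) (phi : R -> \bar R) (tau : R)
    (P : forall t, {measure set (borel (noise M t)) -> \bar R}) (kappa : rule)
    (s : 'rV[R]_dS) : \bar R :=
  ereal_inf [set r | exists lambda mu : R, 0 <= lambda /\
    r = ((lambda * tau + mu)%:E + soc_expectation T P kappa s
          (fun z => conjugate (scaled lambda phi) (z - mu)%R))%E].

(* Randomized Markovian policies of the augmented problem.  The values of
   pi t outside state t x [0, t] are irrelevant. *)
Definition markov_policy :=
  nat -> R.-pker (borel 'rV[R]_dS * R)%type ~> borel 'rV[R]_dA.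

Definition markov_admissible (T : nat) (pi : markov_policy) : Prop :=
  forall t s (x : R), (t <= T)%N -> state M t s -> 0 <= x <= t%:R ->
    pi t (s, x) (control M t) = 1%E.

Definition markov_lipschitz (T : nat) (Lpi : R) (pi : markov_policy) : Prop :=
  forall t s s' (x x' : R), (t <= T)%N -> state M t s -> state M t s' ->
    0 <= x <= t%:R -> 0 <= x' <= t%:R ->
    (l1dist (kernel_law (pi t) (s, x)) (kernel_law (pi t) (s', x'))
       <= (Lpi * enorm (row_mx (s - s') (x - x')%:M))%:E)%E.

Definition markov_rule (pi : markov_policy) (s : 'rV[R]_dS) : rule :=
  fun t w => pi t (traj_state s w, traj_cost s w).

(* Randomized history-dependent policies. *)
Definition history_policy :=
  forall t, R.-pker (history t) ~> borel 'rV[R]_dA.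

Definition history_admissible (T : nat) (pi : history_policy) : Prop :=
  forall t h, (t <= T)%N -> pi t h (control M t) = 1%E.

Definition history_rule (pi : history_policy) : rule :=
  fun t w => pi t (traj_history w).

Definition markov_risk (T : nat) (phi : R -> \bar R) (tau : R)
    (P : forall t, {measure set (borel (noise M t)) -> \bar R})
    (pi : markov_policy) (s : 'rV[R]_dS) : \bar R :=
  risk T phi tau P (markov_rule pi s) s.

Definition optimal_risk (T : nat) (phi : R -> \bar R) (tau : R)
    (P : forall t, {measure set (borel (noise M t)) -> \bar R})
    (s : 'rV[R]_dS) : \bar R :=
  ereal_inf [set risk T phi tau P (history_rule pi) s
    | pi in [set pi | history_admissible T pi]].

(* X t i is the i-th sample of xi_t, for t < T and i < n. *)
Record iid_samples (T n : nat)
    (P : forall t, probability (borel (noise M t)) R)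
    (d : measure_display) (Omega : measurableType d)
    (Pr : probability Omega R) (X : forall t, nat -> Omega -> noise M t)
    : Prop := IidSamples {
  sample_measurable : forall t i, (t < T)%N -> (i < n)%N ->
    measurable_fun [set: Omega] (X t i : Omega -> borel (noise M t));
  sample_law : forall t i (B : set (borel (noise M t))), (t < T)%N ->
    (i < n)%N -> measurable B -> Pr (X t i @^-1` B) = P t B;
  sample_independent : forall B : forall t, nat -> set (borel (noise M t)),
    (forall t i, (t < T)%N -> (i < n)%N -> measurable (B t i)) ->
    Pr (\bigcap_(t in `I_T) \bigcap_(i in `I_n) X t i @^-1` B t i)
      = (\prod_(t < T) \prod_(i < n) Pr (X t i @^-1` B t i))%E }.

Definition empirical (n : nat) (Omega : Type)
    (X : forall t, nat -> Omega -> noise M t) (omega : Omega) (t : nat)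
    : {measure set (borel (noise M t)) -> \bar R} :=
  mscale (n%:R^-1)%:nng
    (msum (fun i => dirac (X t i omega : borel (noise M t))) n).

End Soc.

(* An event of probability at least p on which Q holds; Q itself need not be
   measurable. *)
Definition with_probability_ge (R : realType) (d : measure_display)
    (Omega : measurableType d) (Pr : probability Omega R) (p : R)
    (Q : Omega -> Prop) : Prop :=
  exists E, [/\ measurable E, (p%:E <= Pr E)%E & forall omega, E omega -> Q omega].

(* Main.v *)
(* Round the dual variables (lambda, mu) to a finite grid, and the states, the
   controls and the accumulated cost to nets of mesh eta.  The noise then acts
   only through the finitely many transitions between net points, and both the
   true and the empirical risk are, up to a small multiple of eps, the minimum
   over the grid of a cost plus the value of a finite decision process.  The
   size of the nets enters the sample size through its logarithm only.

   For a fixed policy the empirical value averages over all ways of choosing one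
   sample per stage; Hoelder's and Jensen's inequalities bound its exponential
   moment as if the samples of whole trajectories were independent, whence a
   Chernoff bound with the range of the terminal cost only, without a factor T.

   For the optimal value, the upper tail is the one of the optimal policy.  For
   the lower tail the value is compared with the entropic value, where each
   conditional mean is replaced by - ln E exp (- theta .) / theta: the empirical
   mean falls below the entropic one with exponentially small probability, a
   union bound over stages and net points gives an error T * rho, and the
   entropic value is close to the true one because exponential moments compose
   along the stages, so that its bias is theta B ^ 2 and not T theta B ^ 2. *)
Require Import Defs.
From HB Require Import structures.
From mathcomp Require Import all_boot all_order all_algebra.
From mathcomp Require Import all_classical all_reals all_analysis.
From mathcomp Require Import measurable_realfun ring lra zify.

Set Implicit Arguments.
Unset Strict Implicit.
Unset Printing Implicit Defensive.

Import Order.TTheory GRing.Theory Num.Theory.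
Import numFieldNormedType.Exports.

Local Open Scope classical_set_scope.
Local Open Scope ring_scope.

(** * Finite decision processes and their sampled values *)

(** The terminal cost ranges over an interval of length (T + 1) 2 G, with G the value of
    [growth_inv], so the Chernoff exponents contain T^2 G^2 / eps^2. Rounding errors are multiplied
    by 4 L + 3 at each stage, so the mesh is exponentially small in T and the logarithm of the net
    sizes is of order T times the dimension: this makes T^3. In (ii) the sampled minimizer depends
    on the samples, so its lower tail is not that of a fixed policy; the share eps / T of each stage
    is the origin of the fourth factor T.

    The argument 16 T tau / eps arises as follows: rounding lambda may cost eps / 8, so the step is
    lambda0 = eps / (8 tau), and lambda0 (16 T tau / eps) = 2 T >= T + 1 dominates every total cost.

    The error is spent as eps / 8 for each of the two discretizations, eps / 4 for the dual grid and
    eps / 4 for sampling.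

    Measurability of the integrands in the risks is never established: integrals are compared with
    those of finite-valued functions by monotonicity, from below for all admissible rules and from
    above for the Markovian policy or for an explicit policy that plays net points. *)

Section ExpInequalities.
Context {R : realType}.

(** From exp x <= 1 / (1 - x) and (1 + x + 2 x^2) (1 - x) = 1 + x^2 (1 - 2 x) >= 1. *)
Lemma expR_le_quadratic (x : R) : x <= 2^-1 -> expR x <= 1 + x + 2 * x ^+ 2.
Proof.
move=> hx.
have h1 : 0 < 1 - x by lra.
have h2 : expR x * (1 - x) <= 1.
  have h3 := expR_ge1Dx (- x).
  have h4 : expR x * (1 - x) <= expR x * expR (- x).
    by rewrite ler_pM2l ?expR_gt0.
  by rewrite -expRD subrr expR0 in h4.
have h5 : 1 <= (1 + x + 2 * x ^+ 2) * (1 - x).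
  have -> : (1 + x + 2 * x ^+ 2) * (1 - x) = 1 + x ^+ 2 * (1 - 2 * x) by ring.
  rewrite lerDl mulr_ge0 ?sqr_ge0//; lra.
by rewrite -(ler_pM2r h1); apply: le_trans h5.
Qed.

Lemma expR_sum (I : Type) (r : seq I) (P : pred I) (F : I -> R) :
  expR (\sum_(i <- r | P i) F i) = \prod_(i <- r | P i) expR (F i).
Proof. by rewrite (big_morph expR (@expRD R) (expR0 R)). Qed.

(** The tangent of exp at the mean [m] lies below exp. *)
Lemma expR_jensen (Z : finType) (w x : Z -> R) :
  (forall z, 0 <= w z) -> \sum_z w z = 1 ->
  expR (\sum_z w z * x z) <= \sum_z w z * expR (x z).
Proof.
move=> w0 w1; set m := \sum_z w z * x z.
have h z : w z * (expR m * (1 + (x z - m))) <= w z * expR (x z).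
  apply: ler_wpM2l => //.
  have -> : x z = m + (x z - m) by ring.
  by rewrite expRD ler_pM2l ?expR_gt0// (addrAC m) subrr add0r expR_ge1Dx.
apply: le_trans (ler_sum _ (fun z _ => h z)).
have -> : \sum_z w z * (expR m * (1 + (x z - m)))
   = expR m * ((1 - m) * \sum_z w z + \sum_z w z * x z).
  rewrite mulr_sumr -big_split/= mulr_sumr; apply: eq_bigr => z _; ring.
by rewrite w1 -/m mulr1 subrK mulr1.
Qed.

(** Hoelder's inequality with n equal exponents: once each factor is divided by its sum [a i], it is
    the inequality of arithmetic and geometric means at each z. The case where all weights vanish is
    separate because [ln (a i)] requires a positive sum. *)
Lemma expR_holder (Z : finType) (n : nat) (w : Z -> R) (y : Z -> 'I_n -> R) :
  (0 < n)%N -> (forall z, 0 <= w z) ->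
  (\sum_z w z * expR (n%:R^-1 * \sum_i y z i)) ^+ n
    <= \prod_i \sum_z w z * expR (y z i).
Proof.
move=> n0 w0.
have n0' : (n%:R : R) != 0 by rewrite pnatr_eq0 -lt0n.
have [[z hz]|wz] := pselect (exists z, w z != 0); last first.
  have wE z : w z = 0 by apply/eqP/negPn/negP => h; apply: wz; exists z.
  rewrite big1 ?expr0n ?gtn_eqF//; last by move=> z _; rewrite wE mul0r.
  by apply: prodr_ge0 => i _; apply: sumr_ge0 => z _; rewrite wE mul0r.
pose a i := \sum_z w z * expR (y z i).
have a0 i : 0 < a i.
  rewrite /a (bigD1 z)//=.
  apply: ltr_pwDl; last by apply: sumr_ge0 => u _; rewrite mulr_ge0 ?expR_ge0.
  by rewrite mulr_gt0 ?expR_gt0// lt0r hz w0.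
have aE i : expR (ln (a i)) = a i by rewrite lnK// posrE.
suff h : \sum_z w z * expR (n%:R^-1 * \sum_i y z i)
    <= expR (n%:R^-1 * \sum_i ln (a i)).
  apply: (@le_trans _ _ (expR (n%:R^-1 * \sum_i ln (a i)) ^+ n)).
    apply: lerXn2r => //; rewrite nnegrE ?expR_ge0//.
    by apply: sumr_ge0 => u _; rewrite mulr_ge0 ?expR_ge0.
  rewrite -expRM_natl mulrA divff// mul1r expR_sum.
  by rewrite (eq_bigr a).
set m := n%:R^-1 * \sum_i ln (a i).
rewrite -[leRHS]mul1r -ler_pdivrMr ?expR_gt0// -expRN mulr_suml.
apply: (@le_trans _ _ (\sum_u \sum_i n%:R^-1 * (w u * expR (y u i) / a i))).
  apply: ler_sum => u _.
  rewrite -mulrA -expRD -mulrBr -sumrB.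
  have j := @expR_jensen _ (fun=> n%:R^-1) (fun i : 'I_n => y u i - ln (a i)).
  rewrite mulr_sumr.
  apply: (@le_trans _ _ (w u * \sum_i n%:R^-1 * expR (y u i - ln (a i)))).
    apply: ler_wpM2l => //; apply: j => //.
    by rewrite sumr_const card_ord -[LHS]mulr_natl divff.
  rewrite mulr_sumr; apply: ler_sum => i _.
  by rewrite expRD expRN aE le_eqVlt; apply/orP; left; apply/eqP; ring.
rewrite exchange_big /= (eq_bigr (fun=> n%:R^-1)) => [|i _].
  rewrite le_eqVlt; apply/orP; left; apply/eqP.
  by rewrite sumr_const card_ord -[LHS]mulr_natl divff.
by rewrite -mulr_sumr -mulr_suml -/(a i) divff ?mulr1// lt0r_neq0.
Qed.

End ExpInequalities.

(** * Values of a finite decision process and a finite model of sampling *)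

Section FiniteSystem.
Context {R : realType} {St A K : finType}.
Variable step : nat -> St -> A -> K -> St.

Section Value.
Variable q : nat -> St -> A -> R.

(** The list holds one averaging functional per stage. Thus this recursion and [oval] serve the true
    means and the sample averages alike, and [oval] the entropic means as well. *)
Fixpoint pval (g : St -> R) (l : seq ((K -> R) -> R)) (t : nat) (s : St) : R :=
  if l is E :: l' then \sum_a q t s a * E (fun k => pval g l' t.+1 (step t s a k))
  else g s.

End Value.

Section OptimalValue.
Variable a0 : A.

Definition amin (v : A -> R) : A := [arg min_(a < a0) v a]%O.

Lemma amin_le (v : A -> R) a : v (amin v) <= v a.
Proof. by rewrite /amin; case: arg_minP => //= i _; apply. Qed.

Fixpoint oval (g : St -> R) (l : seq ((K -> R) -> R)) (t : nat) (s : St) : R :=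
  if l is E :: l' then
    let v a := E (fun k => oval g l' t.+1 (step t s a k)) in v (amin v)
  else g s.

End OptimalValue.

Variable p : nat -> K -> R.
Hypothesis p_ge0 : forall t k, 0 <= p t k.
Hypothesis p_sum : forall t, \sum_k p t k = 1.

Definition pmean (t : nat) (W : K -> R) : R := \sum_k p t k * W k.

Definition pmeans (m t : nat) := [seq pmean u | u <- iota t m].

Lemma pmean_le t W W' : (forall k, W k <= W' k) -> pmean t W <= pmean t W'.
Proof. by move=> h; apply: ler_sum => k _; apply: ler_wpM2l. Qed.

Lemma pmean_affine t a b W : pmean t (fun k => a * W k + b) = a * pmean t W + b.
Proof.
rewrite /pmean -[in RHS](mul1r b) -(p_sum t) mulr_sumr mulr_suml -big_split/=.
by apply: eq_bigr => k _; ring.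
Qed.

Section Samples.
Variable n : nat.
Hypothesis n_gt0 : (0 < n)%N.
Let n_neq0 : (n%:R : R) != 0. Proof. by rewrite pnatr_eq0 -lt0n. Qed.
Let layer := {ffun 'I_n -> K}.

Definition avg (S : layer) (W : K -> R) : R := n%:R^-1 * \sum_i W (S i).

Lemma avg_le S W W' : (forall k, W k <= W' k) -> avg S W <= avg S W'.
Proof.
by move=> h; rewrite ler_wpM2l// ?invr_ge0//; apply: ler_sum => k _.
Qed.

Lemma avg_affine S a b W : avg S (fun k => a * W k + b) = a * avg S W + b.
Proof.
rewrite /avg big_split/= sumr_const card_ord -mulr_sumr mulrDr.
by rewrite -[b *+ n]mulr_natl mulKf// mulrCA.
Qed.

Definition layer_weight (t : nat) (S : layer) : R := \prod_i p t (S i).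

Lemma layer_weight_ge0 t S : 0 <= layer_weight t S.
Proof. by apply: prodr_ge0. Qed.

(** Independence of the samples of a layer, in the form of distributivity. *)
Lemma layer_weight_prod t (H : K -> R) :
  \sum_S layer_weight t S * \prod_i H (S i) = (\sum_k p t k * H k) ^+ n.
Proof.
rewrite -[in RHS](card_ord n) -prodr_const.
rewrite (bigA_distr_bigA (fun (i : 'I_n) k => p t k * H k)).
by apply: eq_bigr => S _; rewrite big_split.
Qed.

Lemma layer_weight_sum t : \sum_S layer_weight t S = 1.
Proof.
transitivity (\sum_S layer_weight t S * \prod_(i < n) (1 : R)).
  by apply: eq_bigr => S _; rewrite big1_eq mulr1.
rewrite (layer_weight_prod t (fun=> 1)).
by under eq_bigr do rewrite mulr1; rewrite p_sum expr1n.
Qed.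

(** Expectation over m independent layers, as an iterated finite sum: the tail bounds are proved in
    this model and transferred to the probability space afterwards. *)
Fixpoint sample_mean (m t : nat) (F : seq layer -> R) : R :=
  if m is m'.+1 then
    \sum_S layer_weight t S * sample_mean m' t.+1 (fun l => F (S :: l))
  else F [::].

Lemma sample_mean_le m t F G :
  (forall l, size l = m -> F l <= G l) -> sample_mean m t F <= sample_mean m t G.
Proof.
elim: m t F G => [|m IH] t F G h /=; first exact: h.
apply: ler_sum => S _; rewrite ler_wpM2l ?layer_weight_ge0//.
by apply: IH => l hl; apply: h; rewrite /= hl.
Qed.

Lemma eq_sample_mean m t F G :
  (forall l, size l = m -> F l = G l) -> sample_mean m t F = sample_mean m t G.
Proof.
move=> h; apply/eqP; rewrite eq_le; apply/andP; split;
  by apply: sample_mean_le => l /h ->.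
Qed.

Lemma sample_mean_sum (I : finType) m t (c : I -> R) (F : I -> seq layer -> R) :
  \sum_i c i * sample_mean m t (F i)
    = sample_mean m t (fun l => \sum_i c i * F i l).
Proof.
elim: m t F => [|m IH] t F //=.
under [RHS]eq_bigr do rewrite -IH mulr_sumr.
rewrite exchange_big/=; apply: eq_bigr => i _.
rewrite mulr_sumr; apply: eq_bigr => S _; ring.
Qed.

Lemma sample_meanZ m t c F :
  sample_mean m t (fun l => c * F l) = c * sample_mean m t F.
Proof.
have := sample_mean_sum m t (fun _ : 'I_1 => c) (fun=> F).
rewrite big_ord1 => ->; apply: eq_sample_mean => l _; by rewrite big_ord1.
Qed.

Lemma sample_meanD m t F G :
  sample_mean m t (fun l => F l + G l) = sample_mean m t F + sample_mean m t G.
Proof.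
have := sample_mean_sum m t (fun _ : bool => 1) (fun b => if b then F else G).
rewrite big_bool/= !mul1r => ->; apply: eq_sample_mean => l _.
by rewrite big_bool/= !mul1r.
Qed.

Lemma sample_mean_cst m t c : sample_mean m t (fun=> c) = c.
Proof.
elim: m t => //= m IH t; under eq_bigr do rewrite IH.
by rewrite -mulr_suml layer_weight_sum mul1r.
Qed.

Lemma sample_mean_union (I : finType) m t (bad : I -> seq layer -> bool) (x : R) :
  (forall i, sample_mean m t (fun l => (bad i l)%:R) <= x) ->
  sample_mean m t (fun l => (~~ [forall i, ~~ bad i l])%:R) <= #|I|%:R * x.
Proof.
move=> hx; apply: (@le_trans _ _ (sample_mean m t (fun l => \sum_i 1 * (bad i l)%:R))).
  apply: sample_mean_le => l _; case: (boolP [forall i, ~~ bad i l]) => [_|].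
    by apply: sumr_ge0 => i _; rewrite mul1r ler0n.
  rewrite negb_forall => /existsP[i]; rewrite negbK => hi.
  rewrite (bigD1 i)//= hi mul1r lerDl; apply: sumr_ge0 => j _.
  by rewrite mul1r ler0n.
rewrite -sample_mean_sum.
apply: (@le_trans _ _ (\sum_(i : I) x)).
  by apply: ler_sum => i _; rewrite mul1r.
by rewrite sumr_const -[X in X <= _](mulr_natl x).
Qed.

(** * Tails for a fixed policy *)

Section Policy.
Variable q : nat -> St -> A -> R.
Hypothesis q_ge0 : forall t s a, 0 <= q t s a.
Hypothesis q_sum : forall t s, \sum_a q t s a = 1.

(* The layers are removed one at a time: Hoelder's inequality turns the n-th
   power of an exponential average over the samples of the first layer into a
   product over the samples, whose expectation factors by independence. *)
Lemma exp_pval_moment (Z : finType) (w : Z -> R) (st : Z -> St) theta g m t :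
  (forall z, 0 <= w z) ->
  sample_mean m t (fun l =>
      (\sum_z w z * expR (theta * pval q g (map avg l) t (st z))) ^+ n)
  <= (\sum_z w z * pval q (fun s => expR (theta * g s)) (pmeans m t) t (st z)) ^+ n.
Proof.
elim: m t Z w st => [//|m IH] t Z w st w0.
(* The start state ranges over a weighted family so that the induction can absorb a stage into the
   index: [Z] becomes [Z * A], then [Z * A * K]. *)
pose Z' := (Z * A)%type.
pose w' (z : Z') := w z.1 * q t (st z.1) z.2.
have w'0 z : 0 <= w' z by rewrite mulr_ge0.
pose H l (k : K) := \sum_(z : Z')
  w' z * expR (theta * pval q g (map avg l) t.+1 (step t (st z.1) z.2 k)).
have step1 S l :
  (\sum_z w z * expR (theta * pval q g (map avg (S :: l)) t (st z))) ^+ n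
  <= \prod_i H l (S i).
  have nn z : 0 <= w z * expR (theta * pval q g (map avg (S :: l)) t (st z)).
    by rewrite mulr_ge0 ?expR_ge0.
  apply: le_trans (expR_holder _ n_gt0 w'0).
  apply: lerXn2r; rewrite ?nnegrE; first exact: sumr_ge0.
    by apply: sumr_ge0 => z _; rewrite mulr_ge0 ?expR_ge0.
  rewrite -(pair_bigA _ (fun z a => w' (z, a) * expR (n%:R^-1 * \sum_i
     theta * pval q g (map avg l) t.+1 (step t (st z) a (S i)))))/=.
  apply: ler_sum => z _; rewrite /w'/=.
  under [leRHS]eq_bigr do rewrite -mulrA.
  rewrite -mulr_sumr ler_wpM2l//.
  apply: le_trans (expR_jensen _ (q_ge0 t (st z)) (q_sum t (st z))).
  rewrite ler_expR mulr_sumr; apply: ler_sum => a _.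
  by rewrite /avg -mulr_sumr mulrCA (mulrCA theta).
(* Averaging over the samples of the layer turns the product back into an n-th power, the form to
   which the induction hypothesis applies. *)
have step2 l : \sum_S layer_weight t S * \prod_i H l (S i)
    = (\sum_(z : Z' * K) w' z.1 * p t z.2 *
       expR (theta * pval q g (map avg l) t.+1 (step t (st z.1.1) z.1.2 z.2))) ^+ n.
  rewrite layer_weight_prod; congr (_ ^+ n).
  rewrite -(pair_bigA _ (fun z k => w' z * p t k *
    expR (theta * pval q g (map avg l) t.+1 (step t (st z.1) z.2 k))))/=.
  rewrite exchange_big/=; apply: eq_bigr => k _.
  rewrite mulr_sumr; apply: eq_bigr => z _; ring.
rewrite [leLHS]/=.
apply: (@le_trans _ _ (\sum_S layer_weight t S *
   sample_mean m t.+1 (fun l => \prod_i H l (S i)))).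
  apply: ler_sum => S _; rewrite ler_wpM2l ?layer_weight_ge0//.
  by apply: sample_mean_le => l _; exact: step1.
rewrite sample_mean_sum (eq_sample_mean _ (fun l _ => step2 l)).
apply: le_trans (IH t.+1 _ (fun z : Z' * K => w' z.1 * p t z.2)
  (fun z => step t (st z.1.1) z.1.2 z.2) _) _.
  by move=> z; rewrite mulr_ge0.
rewrite le_eqVlt; apply/orP; left; apply/eqP; congr (_ ^+ n).
rewrite -(pair_bigA _ (fun z k => w' z * p t k * pval q
  (fun s => expR (theta * g s)) (pmeans m t.+1) t.+1 (step t (st z.1) z.2 k)))/=.
rewrite -(pair_bigA _ (fun z a => \sum_k w' (z, a) * p t k * pval q
  (fun s => expR (theta * g s)) (pmeans m t.+1) t.+1 (step t (st z) a k)))/=.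
apply: eq_bigr => z _; rewrite mulr_sumr; apply: eq_bigr => a _.
rewrite /w'/= /pmean !mulr_sumr; apply: eq_bigr => k _.
by rewrite !mulrA.
Qed.

Lemma pval_le g g' m t s : (forall s, g s <= g' s) ->
  pval q g (pmeans m t) t s <= pval q g' (pmeans m t) t s.
Proof.
move=> h; elim: m t s => [|m IH] t s /=; first exact: h.
apply: ler_sum => a _; rewrite ler_wpM2l//; apply: pmean_le => k; exact: IH.
Qed.

Lemma pval_affine c d g m t s :
  pval q (fun s => c * g s + d) (pmeans m t) t s
    = c * pval q g (pmeans m t) t s + d.
Proof.
elim: m t s => [//|m IH] t s /=.
rewrite -[in RHS](mul1r d) -(q_sum t s) mulr_sumr mulr_suml -big_split/=.
apply: eq_bigr => a _; rewrite mulrCA -mulrDr -pmean_affine.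
by congr (_ * _); congr pmean; apply: funext => k; exact: IH.
Qed.

Lemma pval_cst d m t s : pval q (fun=> d) (pmeans m t) t s = d.
Proof.
transitivity (pval q (fun=> 0 * 0 + d) (pmeans m t) t s).
  by rewrite mul0r add0r.
by rewrite pval_affine mul0r add0r.
Qed.

Lemma pval_opp g (l : seq layer) t s :
  pval q (fun s => - g s) (map avg l) t s = - pval q g (map avg l) t s.
Proof.
elim: l t s => [//|S l IH] t s /=.
rewrite -sumrN; apply: eq_bigr => a _; rewrite -mulrN; congr (_ * _).
rewrite -[RHS]addr0 -mulN1r -avg_affine; congr avg.
by apply: funext => k; rewrite IH mulN1r addr0.
Qed.

Section Bounded.
Variables (g : St -> R) (b B : R).
Hypothesis g_itv : forall s, b <= g s <= b + B.
Hypothesis B_gt0 : 0 < B.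

Lemma pval_itv m t s : b <= pval q g (pmeans m t) t s <= b + B.
Proof.
apply/andP; split.
  rewrite -[leLHS](pval_cst b m t s); apply: pval_le => u.
  by have /andP[] := g_itv u.
rewrite -[leRHS](pval_cst (b + B) m t s); apply: pval_le => u.
by have /andP[] := g_itv u.
Qed.

(** The bound is affine in [g s], and averages commute with affine maps. *)
Lemma exp_quadratic_terminal theta c s : `|theta| * B <= 2^-1 ->
  b <= c <= b + B -> expR (theta * (g s - c))
    <= theta * (g s - c) + (1 + 2 * (theta * B) ^+ 2).
Proof.
move=> hB hc.
have h : `|theta * (g s - c)| <= `|theta| * B.
  rewrite normrM ler_wpM2l// ler_norml.
  by have := g_itv s; move: hc; lra.
apply: le_trans (expR_le_quadratic _) _.
  by apply: le_trans hB; apply: le_trans h; exact: ler_norm.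
have : (theta * (g s - c)) ^+ 2 <= (theta * B) ^+ 2.
  rewrite -[leLHS]real_normK ?num_real// -[leRHS]real_normK ?num_real//.
  by rewrite lerXn2r ?nnegrE// (normrM theta B) (gtr0_norm B_gt0).
lra.
Qed.

(** The affine majorant is centred at the value [c] of [g] itself, so its linear term averages to
    zero. What remains involves the range [B] of the terminal cost only, whatever the number of
    stages. *)
Lemma exp_pval_le theta m t s : `|theta| * B <= 2^-1 ->
  pval q (fun s => expR (theta * g s)) (pmeans m t) t s
    <= expR (theta * pval q g (pmeans m t) t s + 2 * (theta * B) ^+ 2).
Proof.
move=> hB; set c := pval q g _ _ _.
have hc : b <= c <= b + B by exact: pval_itv.
have h u : expR (theta * g u) <= (expR (theta * c) * theta) * g u
   + expR (theta * c) * (1 + 2 * (theta * B) ^+ 2 - theta * c).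
  have -> : theta * g u = theta * c + theta * (g u - c) by ring.
  rewrite expRD.
  apply: le_trans (ler_wpM2l (expR_ge0 _) (exp_quadratic_terminal u hB hc)) _.
  rewrite le_eqVlt; apply/orP; left; apply/eqP; ring.
apply: le_trans (pval_le _ _ _ h) _.
rewrite pval_affine -/c.
have -> : expR (theta * c) * theta * c +
   expR (theta * c) * (1 + 2 * (theta * B) ^+ 2 - theta * c)
   = expR (theta * c) * (1 + 2 * (theta * B) ^+ 2) by ring.
by rewrite expRD ler_wpM2l ?expR_ge0// expR_ge1Dx.
Qed.

Lemma pval_upper_tail (e : R) m t s : 0 < e -> e <= 2 * B ->
  sample_mean m t (fun l => (pval q g (pmeans m t) t s + e
      <= pval q g (map avg l) t s)%R%:R)
    <= expR (- (n%:R * (e ^+ 2 / (8 * B ^+ 2)))).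
Proof.
move=> e0 eB; set c := pval q g (pmeans m t) t s.
(* The minimizer of - theta e + 2 theta^2 B^2, whose minimum is - e^2 / (8 B^2). The hypothesis e <=
   2 B is the condition theta B <= 1/2. *)
pose theta := e / (4 * B ^+ 2).
have th0 : 0 < theta by rewrite divr_gt0// mulr_gt0// exprn_gt0.
have hth : `|theta| * B <= 2^-1.
  rewrite gtr0_norm// /theta (_ : _ * B = e / (4 * B)).
    by rewrite ler_pdivrMr ?mulr_gt0//; lra.
  by field; rewrite gt_eqF.
(* Exponential Markov inequality, with the start state written as a family indexed by one point in
   order to match [exp_pval_moment]. *)
apply: (@le_trans _ _ (sample_mean m t (fun l => expR (- (n%:R * (theta * (c + e))))
  * (\sum_(z : 'I_1) 1 * expR (theta * pval q g (map avg l) t s)) ^+ n))).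
  apply: sample_mean_le => l _.
  rewrite big_ord1 mul1r -expRM_natl -expRD.
  have [h|_] := leP (c + e); last by rewrite expR_ge0.
  rewrite -[leLHS]expR0 ler_expR addrC subr_ge0 !ler_wpM2l// ltW//.
rewrite sample_meanZ.
apply: le_trans (ler_wpM2l (expR_ge0 _) (@exp_pval_moment _ _ (fun=> s) _ _ _ _ _)) _ => //.
rewrite big_ord1 mul1r.
apply: (@le_trans _ _ (expR (- (n%:R * (theta * (c + e)))) *
   expR (theta * c + 2 * (theta * B) ^+ 2) ^+ n)).
  rewrite ler_wpM2l ?expR_ge0// lerXn2r ?nnegrE ?expR_ge0 ?exp_pval_le//.
  rewrite -(pval_cst 0 m t s); apply: pval_le => u; exact: expR_ge0.
rewrite -expRM_natl -expRD ler_expR -mulrN -mulrDr -[leRHS]mulrN ler_wpM2l//.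
rewrite le_eqVlt; apply/orP; left; apply/eqP; rewrite /theta.
by field; rewrite gt_eqF.
Qed.

End Bounded.

Lemma pval_lower_tail g (b B e : R) m t s : (forall s, b <= g s <= b + B) ->
  0 < e -> e <= 2 * B ->
  sample_mean m t (fun l => (pval q g (map avg l) t s
      <= pval q g (pmeans m t) t s - e)%R%:R)
    <= expR (- (n%:R * (e ^+ 2 / (8 * B ^+ 2)))).
Proof.
move=> hg e0 eB.
have B0 : 0 < B by lra.
have hg' u : - (b + B) <= - g u <= - (b + B) + B by have := hg u; lra.
have := @pval_upper_tail (fun s => - g s) _ _ hg' B0 e m t s e0 eB.
apply: le_trans; apply: sample_mean_le => l _.
have -> : pval q (fun s => - g s) (pmeans m t) t s = - pval q g (pmeans m t) t s.
  rewrite -[RHS]addr0 -mulN1r -pval_affine; congr pval.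
  by apply: funext => u; rewrite mulN1r addr0.
rewrite pval_opp ler_nat.
by case: (leP (pval q g (map avg l) t s)) => // h; rewrite (_ : (_ <= _) = true)//; lra.
Qed.

End Policy.

Section Deterministic.
Hypothesis step_cst : forall t s a k k', step t s a k = step t s a k'.

Let pmean_cst t (W : K -> R) k : (forall k', W k' = W k) -> pmean t W = W k.
Proof.
move=> h; rewrite -[RHS]mul1r -(p_sum t) mulr_suml.
by apply: eq_bigr => k' _; rewrite h.
Qed.

Let avg_cst S (W : K -> R) k : (forall k', W k' = W k) -> avg S W = W k.
Proof.
move=> h; rewrite /avg (eq_bigr (fun=> W k)) => [|i _]; last exact: h.
by rewrite sumr_const card_ord -[W k *+ n]mulr_natl mulKf.
Qed.

(** For a state space of dimension 0 the net is a single point and the transitions ignore the noise.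
    The sample size in (i) then reduces to n >= 1, so a tail bound would not suffice. *)
Lemma pval_deterministic q g l t s :
  pval q g (map avg l) t s = pval q g (pmeans (size l) t) t s.
Proof.
elim: l t s => [//|S l IH] t s /=; apply: eq_bigr => a _; congr (_ * _).
have k := S (Ordinal n_gt0).
rewrite (@avg_cst _ _ k) => [|k']; last by rewrite (step_cst _ _ _ k' k).
rewrite (@pmean_cst _ _ k) => [|k']; last by rewrite (step_cst _ _ _ k' k).
exact: IH.
Qed.

Lemma oval_deterministic a0 g l t s :
  oval a0 g (map avg l) t s = oval a0 g (pmeans (size l) t) t s.
Proof.
elim: l t s => [//|S l IH] t s /=.
have k := S (Ordinal n_gt0).
have h a : avg S (fun k => oval a0 g (map avg l) t.+1 (step t s a k))
    = pmean t (fun k => oval a0 g (pmeans (size l) t.+1) t.+1 (step t s a k)).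
  rewrite (@avg_cst _ _ k) => [|k']; last by rewrite (step_cst _ _ _ k' k).
  rewrite (@pmean_cst _ _ k) => [|k']; last by rewrite (step_cst _ _ _ k' k).
  exact: IH.
by rewrite h; congr pmean; rewrite (eq_fun h).
Qed.

End Deterministic.

(** * Tails of the optimal value *)

Section OptimalTails.
Variable a0 : A.
Variables (g : St -> R) (b B : R).
Hypothesis g_itv : forall s, b <= g s <= b + B.
Hypothesis B_gt0 : 0 < B.

Lemma oval_itv m t s : b <= oval a0 g (pmeans m t) t s <= b + B.
Proof.
elim: m t s => [//|m IH] t s; rewrite [oval _ _ _ _ _]/=.
have h c : pmean t (fun=> 0 * 0 + c) = c by rewrite pmean_affine mul0r add0r.
apply/andP; split.
  rewrite -[leLHS](h b); apply: pmean_le => k; rewrite mul0r add0r.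
  exact: (proj1 (andP (IH _ _))).
rewrite -[leRHS](h (b + B)); apply: pmean_le => k; rewrite mul0r add0r.
exact: (proj2 (andP (IH _ _))).
Qed.

Section UpperTail.
Variable T : nat.

(** An optimal policy for the true means. A policy sees the stage but not the number of remaining
    stages, which is recovered from the horizon as [T - t.+1]. *)
Definition greedy (t : nat) (s : St) : A := amin a0 (fun a =>
  pmean t (fun k => oval a0 g (pmeans (T - t.+1) t.+1) t.+1 (step t s a k))).

Let qg t s a : R := (a == greedy t s)%:R.

Let qg_ge0 t s a : 0 <= qg t s a. Proof. by rewrite ler0n. Qed.

Let qg_sumM t s (v : A -> R) : \sum_a qg t s a * v a = v (greedy t s).
Proof.
rewrite (bigD1 (greedy t s))//= big1 => [|a /negPf h].
  by rewrite /qg eqxx mul1r addr0.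
by rewrite /qg h mul0r.
Qed.

Let qg_sum t s : \sum_a qg t s a = 1.
Proof. by rewrite -[RHS](qg_sumM t s (fun=> 1)); under [RHS]eq_bigr do rewrite mulr1. Qed.

Lemma pval_greedy m t s : (t + m = T)%N ->
  pval qg g (pmeans m t) t s = oval a0 g (pmeans m t) t s.
Proof.
elim: m t s => [//|m IH] t s htm /=; rewrite qg_sumM /greedy.
have -> : (T - t.+1 = m)%N by rewrite -htm addnS subSS addnC addnK.
by congr pmean; apply: funext => k; rewrite IH// addSnnS.
Qed.

Lemma oval_le_pval q (l : seq layer) t s :
  (forall t s a, 0 <= q t s a) -> (forall t s, \sum_a q t s a = 1) ->
  oval a0 g (map avg l) t s <= pval q g (map avg l) t s.
Proof.
move=> q0 q1; elim: l t s => [//|S l IH] t s.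
rewrite [leLHS]/= [leRHS]/= -[leLHS]mul1r -(q1 t s) mulr_suml.
apply: ler_sum => a _; apply: ler_wpM2l => //.
apply: (le_trans (amin_le a0 (fun a => avg S (fun k =>
  oval a0 g (map avg l) t.+1 (step t s a k))) a)).
exact: avg_le.
Qed.

(** The greedy policy does not depend on the samples. Its sampled value is at least the sampled
    optimum, and its true value is the true optimum. *)
Lemma oval_upper_tail (e : R) s : 0 < e -> e <= 2 * B ->
  sample_mean T 0 (fun l => (oval a0 g (pmeans T 0) 0 s + e
      <= oval a0 g (map avg l) 0 s)%R%:R)
    <= expR (- (n%:R * (e ^+ 2 / (8 * B ^+ 2)))).
Proof.
move=> e0 eB.
apply: (le_trans _ (pval_upper_tail qg_ge0 qg_sum g_itv B_gt0 T 0 s e0 eB)).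
apply: sample_mean_le => l _; rewrite pval_greedy// ler_nat.
have := @oval_le_pval qg l 0 s qg_ge0 qg_sum.
by case: (leP (_ + e) (oval _ _ _ _ _)) => // h1 h2; rewrite (le_trans h1 h2).
Qed.

End UpperTail.

Section Entropic.
Variable theta : R.
Hypothesis theta_gt0 : 0 < theta.

Definition entropic (t : nat) (W : K -> R) : R :=
  - (theta^-1 * ln (pmean t (fun k => expR (- (theta * W k))))).

Definition entropics (m t : nat) := [seq entropic u | u <- iota t m].

Let pmean_expR_gt0 t (W : K -> R) : 0 < pmean t (fun k => expR (W k)).
Proof.
by apply: lt_le_trans (expR_jensen _ (p_ge0 t) (p_sum t)); exact: expR_gt0.
Qed.

Lemma expR_entropic t W :
  expR (- (theta * entropic t W)) = pmean t (fun k => expR (- (theta * W k))).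
Proof.
rewrite /entropic mulrN opprK mulVKf ?gt_eqF// lnK// posrE.
exact: pmean_expR_gt0.
Qed.

(** The constant [c] stays fixed along the induction. By [expR_entropic] an entropic step is an
    ordinary mean of exponentials, through which the affine majorant passes unchanged, and the
    entropic minimizer is merely suboptimal for the true value, which has the right sign. Centring
    anew at each stage would pay the quadratic term once per stage. *)
Lemma expR_entropic_value c m t s : theta * B <= 2^-1 -> b <= c <= b + B ->
  expR (- (theta * (oval a0 g (entropics m t) t s - c)))
   <= 1 + 2 * (theta * B) ^+ 2 - theta * (oval a0 g (pmeans m t) t s - c).
Proof.
move=> hB hc; elim: m t s => [|m IH] t s.
  have := @exp_quadratic_terminal g b B g_itv B_gt0 (- theta) c s.
  rewrite normrN gtr0_norm// => /(_ hB hc).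
  by rewrite !mulNr sqrrN /=; lra.
rewrite [oval _ _ (entropics _ _) _ _]/=.
set a := amin a0 _.
have h : oval a0 g (pmeans m.+1 t) t s
    <= pmean t (fun k => oval a0 g (pmeans m t.+1) t.+1 (step t s a k)).
  exact: (amin_le a0 (fun a => pmean t (fun k =>
    oval a0 g (pmeans m t.+1) t.+1 (step t s a k)))).
set W := fun k => _.
rewrite mulrBr opprB expRD expR_entropic -/W.
apply: (@le_trans _ _ (pmean t (fun k => - theta *
   oval a0 g (pmeans m t.+1) t.+1 (step t s a k) +
   (1 + 2 * (theta * B) ^+ 2 + theta * c)))).
  rewrite -[leLHS]addr0 -pmean_affine; apply: pmean_le => k.
  rewrite addr0 -expRD -opprB -mulrBr.
  apply: le_trans (IH _ _) _; lra.
rewrite pmean_affine.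
have := ler_wpM2l (ltW theta_gt0) h; lra.
Qed.

(** With [c] the true value itself, the linear term of [expR_entropic_value] vanishes. *)
Lemma entropic_value_ge m t s : theta * B <= 2^-1 ->
  oval a0 g (pmeans m t) t s - 2 * theta * B ^+ 2
    <= oval a0 g (entropics m t) t s.
Proof.
move=> hB; set c := oval _ _ _ _ _.
have h := @expR_entropic_value c m t s hB (oval_itv m t s).
rewrite -/c subrr mulr0 subr0 in h.
have {}h := le_trans h (expR_ge1Dx _).
rewrite ler_expR in h.
have {}h : theta * (c - 2 * theta * B ^+ 2) <= theta * oval a0 g (entropics m t) t s.
  by move: h; rewrite exprMn; lra.
by rewrite ler_pM2l in h.
Qed.

Variable rho : R.

(** The continuation [W] is computed with the true laws of the later stages, not with their samples.
    It is therefore a fixed function, and each layer can be controlled separately. *)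
Definition entropic_good (m t : nat) (S : layer) (s : St) (a : A) : bool :=
  let W k := oval a0 g (entropics m t.+1) t.+1 (step t s a k) in
  entropic t W - rho <= avg S W.

Fixpoint all_good (l : seq layer) (t : nat) : bool :=
  if l is x :: l' then
    [forall s, forall a, entropic_good (size l') t x s a] && all_good l' t.+1
  else true.

Lemma all_good_oval l t s : all_good l t ->
  oval a0 g (entropics (size l) t) t s - (size l)%:R * rho
    <= oval a0 g (map avg l) t s.
Proof.
elim: l t s => [|S l IH] t s; first by rewrite mul0r subr0.
move=> /= /andP[/forallP /(_ s) /forallP h1 h2].
set a := amin a0 (fun a => avg S _).
apply: (@le_trans _ _ (avg S (fun k =>
   1 * oval a0 g (entropics (size l) t.+1) t.+1 (step t s a k)
   + - ((size l)%:R * rho)))); last first.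
  by apply: avg_le => k; rewrite mul1r; exact: IH.
rewrite avg_affine mul1r.
have h3 := h1 a; rewrite /entropic_good/= in h3.
apply: (@le_trans _ _ (entropic t (fun k =>
   oval a0 g (entropics (size l) t.+1) t.+1 (step t s a k))
   - (size l).+1%:R * rho)).
  rewrite lerB//; exact: (amin_le a0 (fun a => entropic t (fun k =>
      oval a0 g (entropics (size l) t.+1) t.+1 (step t s a k)))).
rewrite -natr1; move: h3; set X := entropic _ _; set Y := avg _ _; lra.
Qed.

(** Exponential Markov inequality. By the definition of [entropic], the mean of exp (- theta n avg
    W) is exactly exp (- theta n entropic W), so the range of [W] does not occur. *)
Lemma entropic_bad m t s a :
  \sum_S layer_weight t S * (~~ entropic_good m t S s a)%:R
    <= expR (- (n%:R * (theta * rho))).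
Proof.
pose W k := oval a0 g (entropics m t.+1) t.+1 (step t s a k).
have E S : entropic_good m t S s a = (entropic t W - rho <= avg S W) by [].
under eq_bigr do rewrite E.
apply: (@le_trans _ _ (\sum_S layer_weight t S *
   (expR (n%:R * (theta * (entropic t W - rho))) *
    \prod_i expR (- (theta * W (S i)))))).
  apply: ler_sum => S _; rewrite ler_wpM2l ?layer_weight_ge0//.
  rewrite -expR_sum -expRD sumrN -mulr_sumr.
  have -> : \sum_i W (S i) = n%:R * avg S W by rewrite /avg mulVKf.
  have [h|h] := leP (entropic t W - rho); first exact: expR_ge0.
  rewrite /= -[leLHS]expR0 ler_expR.
  rewrite (_ : _ - _ = n%:R * (theta * (entropic t W - rho - avg S W))).
    apply: mulr_ge0 => //; apply: mulr_ge0; first exact: ltW.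
    by rewrite subr_ge0 ltW.
  ring.
under eq_bigr do rewrite mulrCA.
rewrite -mulr_sumr (layer_weight_prod t (fun k => expR (- (theta * W k)))).
rewrite -/(pmean t _) -expR_entropic -expRM_natl -expRD ler_expR.
rewrite le_eqVlt; apply/orP; left; apply/eqP; ring.
Qed.

Lemma all_good_tail m t : sample_mean m t (fun l => (~~ all_good l t)%:R)
  <= m%:R * (#|St|%:R * #|A|%:R) * expR (- (n%:R * (theta * rho))).
Proof.
set X := expR _.
elim: m t => [|m IH] t; first by rewrite /= !mul0r.
rewrite [leLHS]/=.
apply: (@le_trans _ _ (\sum_S (\sum_s \sum_a
   layer_weight t S * (~~ entropic_good m t S s a)%:R + layer_weight t S *
     sample_mean m t.+1 (fun l => (~~ all_good l t.+1)%:R)))).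
  apply: ler_sum => S _.
  under [X in _ <= X + _]eq_bigr do rewrite -mulr_sumr.
  rewrite -mulr_sumr -mulrDr ler_wpM2l ?layer_weight_ge0//.
  rewrite -[X in _ <= X + _](sample_mean_cst m t.+1) -sample_meanD.
  apply: sample_mean_le => l hl; rewrite hl negb_and.
  have nn s : (0 : R) <= \sum_a (~~ entropic_good m t S s a)%:R.
    by apply: sumr_ge0 => a _; rewrite ler0n.
  case: (boolP (all_good l t.+1)) => _; rewrite ?orbT ?orbF /=; last first.
    by rewrite lerDr sumr_ge0.
  rewrite addr0.
  case: (boolP [forall s, _]) => [_|]; first by rewrite sumr_ge0.
  rewrite negb_forall => /existsP[s]; rewrite negb_forall => /existsP[a h].
  rewrite (bigD1 s)//= (bigD1 a)//= h -addrA lerDl addr_ge0//.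
    by apply: sumr_ge0 => ? _; rewrite ler0n.
  exact: sumr_ge0.
rewrite big_split/= -[X in _ + X]mulr_suml layer_weight_sum// mul1r.
rewrite -natr1 !mulrDl mul1r addrC lerD//.
rewrite exchange_big/=.
apply: (@le_trans _ _ (\sum_(s : St) \sum_(a : A) X)).
  apply: ler_sum => s _; rewrite exchange_big/=; apply: ler_sum => a _.
  exact: entropic_bad.
by rewrite !sumr_const -(mulr_natl X) -(mulr_natl (_ * X)) mulrA.
Qed.

End Entropic.

Lemma oval_lower_tail (e : R) m t s : (0 < m)%N -> 0 < e -> e <= 2 * B ->
  sample_mean m t (fun l => (oval a0 g (map avg l) t s
      < oval a0 g (pmeans m t) t s - e)%R%:R)
    <= m%:R * (#|St|%:R * #|A|%:R)
       * expR (- (n%:R * (e ^+ 2 / (8 * m%:R * B ^+ 2)))).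
Proof.
move=> m0 e0 eB; have m0' : (0 : R) < m%:R by rewrite ltr0n.
(* The loss e is halved: [theta] makes the entropic bias 2 theta B^2 equal to e / 2, and [rho] makes
   the m losses of the stages add up to e / 2. *)
pose theta := e / (4 * B ^+ 2); pose rho := e / (2 * m%:R).
have th0 : 0 < theta by rewrite divr_gt0// mulr_gt0// exprn_gt0.
have hth : theta * B <= 2^-1.
  rewrite /theta (_ : _ * B = e / (4 * B)).
    by rewrite ler_pdivrMr ?mulr_gt0//; lra.
  by field; rewrite gt_eqF.
have := @all_good_tail theta th0 rho m t.
have -> : theta * rho = e ^+ 2 / (8 * m%:R * B ^+ 2).
  by rewrite /theta /rho; field; rewrite !gt_eqF.
apply: le_trans; apply: sample_mean_le => l hl; rewrite ler_nat.
case: (boolP (all_good theta rho l t)) => [h|_]; last by case: (_ < _).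
have h1 := all_good_oval s h; rewrite hl in h1.
have h2 := @entropic_value_ge theta th0 m t s hth.
rewrite ltNge (_ : (_ <= _) = true)//.
have h3 : m%:R * rho = e / 2 by rewrite /rho; field; rewrite gt_eqF.
have h4 : 2 * theta * B ^+ 2 = e / 2 by rewrite /theta; field; rewrite gt_eqF.
rewrite h3 in h1; rewrite h4 in h2; lra.
Qed.

End OptimalTails.
End Samples.
End FiniteSystem.

(** * Lattice nets in Euclidean space *)

Section EuclideanNorm.
Context {R : realType}.

(** By Lagrange's identity. *)
Lemma sum_cauchy_schwarz (I : finType) (u v : I -> R) :
  (\sum_i u i * v i) ^+ 2 <= (\sum_i u i ^+ 2) * (\sum_i v i ^+ 2).
Proof.
have h : 0 <= \sum_i \sum_j (u i * v j - u j * v i) ^+ 2.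
  by apply: sumr_ge0 => i _; apply: sumr_ge0 => j _; exact: sqr_ge0.
suff e : \sum_i \sum_j (u i * v j - u j * v i) ^+ 2 =
    2 * ((\sum_i u i ^+ 2) * (\sum_i v i ^+ 2) - (\sum_i u i * v i) ^+ 2).
  by rewrite -subr_ge0; move: h; rewrite e; lra.
transitivity (\sum_i \sum_j (u i ^+ 2 * v j ^+ 2 + u j ^+ 2 * v i ^+ 2
    - 2 * (u i * v i) * (u j * v j))).
  by apply: eq_bigr => i _; apply: eq_bigr => j _; ring.
under eq_bigr do rewrite sumrB big_split/= -!mulr_sumr -mulr_suml.
rewrite sumrB big_split/= -!mulr_suml -!mulr_sumr.
ring.
Qed.

Lemma enorm_ge0 d (u : 'rV[R]_d) : 0 <= enorm u.
Proof. exact: sqrtr_ge0. Qed.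

Let sum_sqr_ge0 d (u : 'rV[R]_d) : 0 <= \sum_i u ord0 i ^+ 2.
Proof. by apply: sumr_ge0 => i _; exact: sqr_ge0. Qed.

Lemma enorm_sqr d (u : 'rV[R]_d) : enorm u ^+ 2 = \sum_i u ord0 i ^+ 2.
Proof. by rewrite sqr_sqrtr. Qed.

Lemma enorm_le d (u : 'rV[R]_d) (r : R) : 0 <= r ->
  \sum_i u ord0 i ^+ 2 <= r ^+ 2 -> enorm u <= r.
Proof.
by move=> r0 h; rewrite -(ler_pXn2r (_ : 0 < 2)%N) ?nnegrE ?enorm_ge0// enorm_sqr.
Qed.

Lemma enorm_triangle d (u v : 'rV[R]_d) : enorm (u + v) <= enorm u + enorm v.
Proof.
apply: enorm_le; first by rewrite addr_ge0 ?enorm_ge0.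
have cs : \sum_i u ord0 i * v ord0 i <= enorm u * enorm v.
  apply: le_trans (ler_norm _) _.
  rewrite -(ler_pXn2r (_ : 0 < 2)%N) ?nnegrE ?mulr_ge0 ?enorm_ge0//.
  rewrite real_normK ?num_real// exprMn !enorm_sqr.
  exact: sum_cauchy_schwarz.
have -> : \sum_i (u + v) ord0 i ^+ 2 = \sum_i u ord0 i ^+ 2 + \sum_i v ord0 i ^+ 2
    + 2 * \sum_i u ord0 i * v ord0 i.
  by rewrite mulr_sumr -!big_split/=; apply: eq_bigr => i _; rewrite mxE; ring.
rewrite -!enorm_sqr; lra.
Qed.

Lemma enormN d (u : 'rV[R]_d) : enorm (- u) = enorm u.
Proof.
by congr (Num.sqrt _); apply: eq_bigr => i _; rewrite mxE sqrrN.
Qed.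

Lemma enorm_distC d (u v : 'rV[R]_d) : enorm (u - v) = enorm (v - u).
Proof. by rewrite -opprB enormN. Qed.

Lemma enorm_dist_triangle d (w u v : 'rV[R]_d) :
  enorm (u - v) <= enorm (u - w) + enorm (w - v).
Proof. by rewrite -[in leLHS](subrK w u) -addrA enorm_triangle. Qed.

Lemma enorm_row_mx d1 d2 (u : 'rV[R]_d1) (v : 'rV[R]_d2) :
  enorm (row_mx u v) <= enorm u + enorm v.
Proof.
apply: enorm_le; first by rewrite addr_ge0 ?enorm_ge0.
rewrite big_split_ord/=.
under eq_bigr do rewrite row_mxEl.
under [X in _ + X]eq_bigr do rewrite row_mxEr.
rewrite -!enorm_sqr.
have := mulr_ge0 (enorm_ge0 u) (enorm_ge0 v); lra.
Qed.

Lemma enorm_scalar (x : R) : enorm (x%:M : 'rV_1) = `|x|.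
Proof. by rewrite /enorm big_ord1 mxE eqxx sqrtr_sqr. Qed.

Lemma sum_norm_le_enorm d (u : 'rV[R]_d) :
  \sum_i `|u ord0 i| <= Num.sqrt d%:R * enorm u.
Proof.
rewrite -(ler_pXn2r (_ : 0 < 2)%N) ?nnegrE ?mulr_ge0 ?enorm_ge0//.
  rewrite exprMn sqr_sqrtr ?ler0n// enorm_sqr.
  have := sum_cauchy_schwarz (fun=> 1) (fun i => `|u ord0 i|).
  under eq_bigr do rewrite mul1r.
  rewrite expr1n sumr_const card_ord.
  by under [X in _ <= _ * X -> _]eq_bigr do rewrite real_normK ?num_real//.
by apply: sumr_ge0 => i _.
Qed.

End EuclideanNorm.

(** Measurability is stated on the fibres, so that no sigma-algebra has to be chosen on the finite
    type. *)
Definition fmeasurable {d} {T : measurableType d} {J : finType} (f : T -> J) :=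
  forall j, measurable [set x | f x = j].

Section FiniteValued.
Context {d} {T : measurableType d}.

Lemma fmeasurable_pred (J : finType) (f : T -> J) (P : pred J) :
  fmeasurable f -> measurable [set x | P (f x)].
Proof.
move=> mf; rewrite (_ : mkset _ = \big[setU/set0]_(j | P j) [set x | f x = j]).
  by apply: bigsetU_measurable => j _; exact: mf.
rewrite -bigcup_seq_cond; apply/seteqP; split => x /=.
  by move=> Px; exists (f x); rewrite //= mem_index_enum.
by move=> [j /andP[_ Pj]] /= ->.
Qed.

Lemma fmeasurable_comp (J J' : finType) (f : T -> J) (h : J -> J') :
  fmeasurable f -> fmeasurable (h \o f).
Proof.
move=> mf j; rewrite (_ : mkset _ = [set x | h (f x) == j]).
  exact: (@fmeasurable_pred _ _ (fun y => h y == j)).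
by apply/seteqP; split => x /=; [move=> ->|move/eqP].
Qed.

Lemma fmeasurable_ffun (I J : finType) (f : I -> T -> J) :
  (forall i, fmeasurable (f i)) -> fmeasurable (fun x => [ffun i => f i x]).
Proof.
move=> mf c.
rewrite (_ : mkset _ = \big[setI/setT]_i [set x | f i x = c i]).
  by apply: bigsetI_measurable => i _; exact: mf.
rewrite -bigcap_seq_cond; apply/seteqP; split => x /=.
  by move=> <- i _ /=; rewrite ffunE.
move=> h; apply/ffunP => i; rewrite ffunE; apply: h.
by rewrite /= mem_index_enum.
Qed.

Lemma fmeasurable_pair (J J' : finType) (f : T -> J) (f' : T -> J') :
  fmeasurable f -> fmeasurable f' -> fmeasurable (fun x => (f x, f' x)).
Proof.
move=> mf mf' [j j'].
rewrite (_ : mkset _ = [set x | f x = j] `&` [set x | f' x = j']).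
  by apply: measurableI; [exact: mf|exact: mf'].
by apply/seteqP; split => x /= [-> ->].
Qed.

Lemma fmeasurable_cst (J : finType) (j : J) : fmeasurable (fun _ : T => j).
Proof.
move=> j'; have [->|h] := eqVneq j j'.
  by rewrite (_ : mkset _ = setT)//; apply/seteqP.
rewrite (_ : mkset _ = set0)//; apply/seteqP; split => x //=.
by move/eqP: h.
Qed.

End FiniteValued.

Section Net.
Context {R : realType} (d : nat) (rad eta : R).
Hypothesis eta_gt0 : 0 < eta.

Let m := Num.truncn (d%:R * (rad / eta)).

(** A coordinate is coded by its sign and the integer part of its absolute value. Truncation is
    towards 0, so the sign separates the two cells adjacent to 0. *)
Definition net_code := {ffun 'I_d -> bool * 'I_m.+1}.

Definition net := {c : net_code | (\sum_i (c i).2 <= m)%N}.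

Let zero_code : net_code := [ffun=> (false, ord0)].

Let zero_code_net : (\sum_i (zero_code i).2 <= m)%N.
Proof. by rewrite big1// => i _; rewrite ffunE. Qed.

Definition net0 : net := Sub zero_code zero_code_net.

(* The Chernoff bound at x = rho / (1 + rho), with rho = rad / eta, for the
   number of integer points of l1-norm at most d * rho.  The cubes of side
   eta / sqrt d meeting the ball have their lower corners there, because the
   l1-norm is at most sqrt d times the Euclidean norm; a plain box count would
   lose a factor d ^ d. *)
Lemma card_net : 0 < rad ->
  (#|{: net}|%:R : R) <= (2 * expR 1 * (1 + rad / eta)) ^+ d.
Proof.
move=> rad0; set rho := rad / eta.
have rho0 : 0 < rho by rewrite divr_gt0.
pose x := rho / (1 + rho).
have x0 : 0 < x by rewrite divr_gt0// addr_gt0.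
have x1 : x < 1 by rewrite ltr_pdivrMr ?addr_gt0// mul1r ltrDr.
have geom : \sum_(b : bool) \sum_(k < m.+1) x ^+ k <= 2 * (1 + rho).
  rewrite big_bool/=.
  suff : \sum_(k < m.+1) x ^+ k <= 1 + rho by lra.
  have e : (1 - x) * \sum_(k < m.+1) x ^+ k = 1 - x ^+ m.+1.
    by rewrite -opprB mulNr -subrX1 opprB.
  have e1 : 1 - x = (1 + rho)^-1 by rewrite /x; field; rewrite gt_eqF// addr_gt0.
  rewrite -[leRHS]mulr1 -ler_pdivrMl ?addr_gt0// -e1 e.
  by rewrite lerBlDr lerDl exprn_ge0// ltW.
have xm : 1 <= expR 1 ^+ d * x ^+ m.
  have h1 : x^-1 <= expR (rho^-1).
    have -> : x^-1 = 1 + rho^-1 by rewrite /x; field; rewrite !gt_eqF// addr_gt0.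
    exact: expR_ge1Dx.
  have h2 : x^-1 ^+ m <= expR 1 ^+ d.
    apply: (@le_trans _ _ (expR (rho^-1) ^+ m)).
      by rewrite lerXn2r ?nnegrE ?expR_ge0 ?invr_ge0 ?(ltW x0).
    rewrite -!expRM_natl ler_expR mulr1 ler_pdivrMr//.
    by rewrite /m truncn_le mulr_ge0// ltW.
  by rewrite -ler_pdivrMr ?exprn_gt0// mul1r -exprVn.
have cardE : (#|{: net}|%:R : R) = \sum_(c : net_code | (\sum_i (c i).2 <= m)%N) 1.
  by rewrite card_sig -sum1_card natr_sum; apply: eq_bigl => c.
rewrite cardE.
apply: (@le_trans _ _ (\sum_(c : net_code) expR 1 ^+ d * \prod_i x ^+ (c i).2)).
  rewrite big_mkcond/=; apply: ler_sum => c _; case: ifP => [hc|_].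
    apply: le_trans xm _; rewrite ler_wpM2l ?exprn_ge0 ?expR_ge0//.
    by rewrite prodrXr; apply: ler_wiXn2l; rewrite ?ltW.
  by rewrite mulr_ge0 ?exprn_ge0 ?expR_ge0//; apply: prodr_ge0 => i _; rewrite exprn_ge0// ltW.
rewrite -mulr_sumr -(bigA_distr_bigA (fun (i : 'I_d) (y : bool * 'I_m.+1) => x ^+ y.2)).
rewrite prodr_const card_ord -exprMn lerXn2r ?nnegrE ?mulr_ge0 ?expR_ge0 ?addr_ge0 ?(ltW rho0)//.
  by apply: sumr_ge0 => y _; rewrite exprn_ge0// ltW.
rewrite -(pair_bigA _ (fun (b : bool) (k : 'I_m.+1) => x ^+ k))/=.
have := ler_wpM2l (expR_ge0 (1 : R)) geom; rewrite mulrA; lra.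
Qed.

End Net.

Section NetPoints.
Context {R : realType} (d : nat) (rad eta : R).
Hypothesis (eta_gt0 : 0 < eta).
Variable z : 'rV[R]_d.

Let m := Num.truncn (d%:R * (rad / eta)).

Let c := Num.sqrt d%:R / eta.

(** In these units a cell has side eta / sqrt d, hence Euclidean diameter eta. *)
Definition lattice_coord (i : 'I_d) (s : 'rV[R]_d) : R :=
  (s ord0 i - z ord0 i) * c.

Definition net_code_of (s : 'rV[R]_d) : net_code d rad eta :=
  [ffun i => (lattice_coord i s < 0, inord (Num.truncn `|lattice_coord i s|))].

Definition net_proj (s : 'rV[R]_d) : net d rad eta :=
  insubd (net0 d rad eta) (net_code_of s).

Let lattice_coord_continuous i : continuous (lattice_coord i).
Proof.
suff : continuous (fun s : 'rV[R]_d => (s ord0 i - z ord0 i) * c) by [].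
move=> s.
have h : {for s, continuous (fun s : 'rV[R]_d => s ord0 i - z ord0 i)}.
  apply: (@continuousB R _ _ (fun s : 'rV[R]_d => s ord0 i) (fun=> z ord0 i)).
    exact: coord_continuous.
  exact: cst_continuous.
exact: (continuousM h (@cst_continuous _ _ c _)).
Qed.

Let measurable_norm_lt i (x : R) :
  measurable ([set s | `|lattice_coord i s| < x] : set (borel 'rV[R]_d)).
Proof.
apply: sub_sigma_algebra.
have : open ((fun s => `|lattice_coord i s|) @^-1` [set y : R | y < x]).
  apply: open_comp => [s _|]; last exact: open_lt.
  by apply: continuous_comp; [exact: lattice_coord_continuous|exact: norm_continuous].
by [].
Qed.

Let fmeasurable_sign i :
  fmeasurable (fun s : borel 'rV[R]_d => lattice_coord i s < 0).
Proof.
have h : measurable ([set s | lattice_coord i s < 0] : set (borel 'rV[R]_d)).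
  apply: sub_sigma_algebra.
  have : open (lattice_coord i @^-1` [set y : R | y < 0]).
    by apply: open_comp => [s _|]; [exact: lattice_coord_continuous|exact: open_lt].
  by [].
move=> [|]; first exact: h.
rewrite (_ : mkset _ = ~` [set s | lattice_coord i s < 0]); first exact: measurableC.
by apply/seteqP; split => s /=; [move=> ->|move/negP/negbTE].
Qed.

Let fmeasurable_trunc i : fmeasurable (fun s : borel 'rV[R]_d =>
  inord (Num.truncn `|lattice_coord i s|) : 'I_m.+1).
Proof.
(* All k with [inord k = j] occur, since [inord] sends the values above m to the default index 0. *)
move=> j; rewrite (_ : mkset _ = \bigcup_(k in [set k : nat | inord k = j])
  ([set s | `|lattice_coord i s| < k.+1%:R]
   `\` [set s | `|lattice_coord i s| < k%:R])).
  by apply: bigcup_measurable => k _; apply: measurableD; exact: measurable_norm_lt.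
apply/seteqP; split => s /=.
  move=> <-; exists (Num.truncn `|lattice_coord i s|) => //=; split.
    exact: truncnS_gt.
  by apply/negP; rewrite -leNgt truncn_le.
move=> [k /= <-] [h1 /negP]; rewrite -leNgt => h2.
by rewrite (@truncn_def _ _ k)// h2.
Qed.

Lemma fmeasurable_net_proj : fmeasurable (net_proj : borel 'rV[R]_d -> _).
Proof.
apply: (fmeasurable_comp (insubd (net0 d rad eta))).
apply: fmeasurable_ffun => i.
by apply: fmeasurable_pair; [exact: fmeasurable_sign|exact: fmeasurable_trunc].
Qed.

(** The l1-norm of the scaled point is at most sqrt d times its Euclidean norm rad (sqrt d / eta),
    which is d rad / eta. *)
Lemma net_codeP s : enorm (s - z) <= rad ->
  (\sum_i Num.truncn `|lattice_coord i s| <= m)%N.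
Proof.
move=> hs; have rad0 := le_trans (enorm_ge0 _) hs.
have c0 : 0 <= c by rewrite divr_ge0// ltW.
rewrite /m truncn_ge_nat ?mulr_ge0 ?invr_ge0 ?(ltW eta_gt0)// natr_sum.
apply: (@le_trans _ _ (\sum_i `|(s - z) ord0 i| * c)).
  apply: ler_sum => i _; rewrite !mxE -(ger0_norm c0) -normrM truncn_le.
  exact: normr_ge0.
rewrite -mulr_suml.
apply: le_trans (ler_wpM2r c0 (sum_norm_le_enorm _)) _.
apply: (@le_trans _ _ (Num.sqrt d%:R * rad * c)).
  by rewrite ler_wpM2r// ler_wpM2l.
rewrite /c mulrACA -expr2 sqr_sqrtr ?ler0n// lexx.
Qed.

Lemma net_proj_close s s' : enorm (s - z) <= rad -> enorm (s' - z) <= rad ->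
  net_proj s = net_proj s' -> enorm (s - s') <= eta.
Proof.
move=> hs hs' e0.
have codeP u : enorm (u - z) <= rad ->
    forall i, (net_code_of u i).2 = Num.truncn `|lattice_coord i u| :> nat.
  move=> hu i; rewrite ffunE /= inordK// ltnS.
  apply: leq_trans (net_codeP hu).
  by rewrite (bigD1 i)//= leq_addr.
have valP u : enorm (u - z) <= rad -> val (net_proj u) = net_code_of u.
  move=> hu; rewrite /net_proj insubdK// /in_mem/=.
  by under eq_bigr do rewrite (codeP _ hu); exact: net_codeP.
have := congr1 val e0; rewrite !valP// => /ffunP e.
apply: enorm_le; first exact: ltW.
have h i : d%:R * ((s - s') ord0 i) ^+ 2 <= eta ^+ 2.
  have : `|lattice_coord i s - lattice_coord i s'| <= 1.
    have e2 : Num.truncn `|lattice_coord i s| = Num.truncn `|lattice_coord i s'|.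
      by rewrite -!codeP// e.
    have e1 : (lattice_coord i s < 0) = (lattice_coord i s' < 0).
      by have := e i; rewrite !ffunE => -[].
    have t1 := truncn_itv (normr_ge0 (lattice_coord i s)).
    have t2 := truncn_itv (normr_ge0 (lattice_coord i s')).
    rewrite e2 in t1; move: t1 t2; set k := Num.truncn _; rewrite -natr1 ler_norml.
    move: e1; case: (ltP (lattice_coord i s) 0) => h1; case: (ltP (lattice_coord i s') 0) => h2 //.
      by rewrite !ltr0_norm//; lra.
    by rewrite !ger0_norm//; lra.
  rewrite /lattice_coord -mulrBl (_ : _ - _ = (s - s') ord0 i); last first.
    by rewrite !mxE; ring.
  move=> h1; have : ((s - s') ord0 i * c) ^+ 2 <= 1.
    by rewrite -[leLHS]real_normK ?num_real// expr_le1.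
  rewrite exprMn /c expr_div_n sqr_sqrtr ?ler0n//.
  rewrite mulrA ler_pdivrMr ?exprn_gt0// mul1r; lra.
have [d0|d0] := posnP d.
  rewrite big1 ?sqr_ge0// => i _; exfalso.
  by have := leq_ltn_trans (leq0n i) (ltn_ord i); rewrite d0.
rewrite -(ler_pM2l (_ : 0 < d%:R)) ?ltr0n// mulr_sumr.
apply: le_trans (ler_sum _ (fun i _ => h i)) _.
by rewrite sumr_const card_ord -[_ *+ d]mulr_natl.
Qed.

End NetPoints.

(** The representatives are taken in [A], because costs, transitions and policies are controlled
    only there; a cell that does not meet [A] receives [s0]. *)
Lemma exists_net {R : realType} d (rad eta : R) (A : set 'rV[R]_d) :
  0 < eta -> A !=set0 -> (exists z, forall s, A s -> enorm (s - z) <= rad) ->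
  exists (pt : net d rad eta -> 'rV[R]_d) (proj : 'rV[R]_d -> net d rad eta),
  [/\ forall j, A (pt j), fmeasurable (proj : borel 'rV[R]_d -> _)
    & forall s, A s -> enorm (s - pt (proj s)) <= eta].
Proof.
move=> eta0 [s0 As0] [z hz].
exists (fun j => xget s0 [set s | A s /\ net_proj rad eta z s = j]).
exists (net_proj rad eta z); split.
- by move=> j; case: xgetP => [s _ []|].
- exact: fmeasurable_net_proj.
- move=> s As; case: xgetP => [s' _ [As' e]|/(_ s)]; last by case.
  by apply: (@net_proj_close _ _ rad _ eta0 z); rewrite ?hz.
Qed.

(** * Conjugates of the divergence *)

Section ConjugateDivergence.
Context {R : realType} (phi : R -> \bar R).
Hypothesis Hphi : divergence_function phi.

Let conj lambda y := conjugate (scaled lambda phi) y.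

Lemma scaled_ge0 lambda x : 0 <= lambda -> (0 <= scaled lambda phi x)%E.
Proof.
move=> l0; rewrite /scaled; case: ifP => // _.
by rewrite mule_ge0 ?lee_fin//; exact: divergence_ge0.
Qed.

Lemma scaledP lambda x r : 0 <= lambda -> scaled lambda phi x = r%:E ->
  [/\ 0 <= x, 0 <= r & exists2 p, phi x = p%:E & r = lambda * p].
Proof.
move=> l0 h; have := scaled_ge0 x l0; rewrite h lee_fin => r0.
move: h; rewrite /scaled; case: eqP => // hx.
have x0 : 0 <= x.
  by rewrite leNgt; apply/negP => /(divergence_neg Hphi).
move: hx; have := divergence_ge0 Hphi x; case: (phi x) => // p _ _.
by rewrite -EFinM => -[e]; split => //; exists p; rewrite ?e.
Qed.

Lemma scaled1 lambda : scaled lambda phi 1 = 0%E.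
Proof. by rewrite /scaled divergence1//= mule0. Qed.

Lemma conjugate_le lambda y u : 0 <= lambda ->
  (forall x r, 0 <= x -> 0 <= r -> scaled lambda phi x = r%:E ->
     ((x * y - r)%:E <= u)%E) ->
  (conj lambda y <= u)%E.
Proof.
move=> l0 h; apply: ge_ereal_sup => _ [x _ <-].
case e : (scaled lambda phi x) => [r| |].
- by have [x0 r0 _] := scaledP l0 e; rewrite -EFinB; exact: h.
- by rewrite addeNy leNye.
- by have := scaled_ge0 x l0; rewrite e.
Qed.

Lemma le_conjugate lambda y x r : scaled lambda phi x = r%:E ->
  ((x * y - r)%:E <= conj lambda y)%E.
Proof.
by move=> e; apply: ereal_sup_ubound; exists x => //; rewrite e EFinB.
Qed.

Lemma conjugate_ge_id lambda y : (y%:E <= conj lambda y)%E.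
Proof.
by have := le_conjugate y (scaled1 lambda); rewrite mul1r subr0.
Qed.

Lemma conjugate_mono lambda y y' : 0 <= lambda -> y <= y' ->
  (conj lambda y <= conj lambda y')%E.
Proof.
move=> l0 yy'; apply: conjugate_le => // x r x0 r0 e.
apply: le_trans (le_conjugate y' e).
by rewrite lee_fin lerB// ler_wpM2l.
Qed.

Lemma conjugate_anti lambda lambda' y : 0 <= lambda -> lambda <= lambda' ->
  (conj lambda' y <= conj lambda y)%E.
Proof.
move=> l0 ll'; apply: conjugate_le => [|x r x0 r0 e]; first exact: le_trans ll'.
have [_ _ [p hp rE]] := scaledP (le_trans l0 ll') e.
have e' : scaled lambda phi x = (lambda * p)%:E by rewrite /scaled hp.
apply: le_trans (le_conjugate y e').
have p0 : 0 <= p by have := divergence_ge0 Hphi x; rewrite hp lee_fin.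
by rewrite lee_fin rE lerB// ler_wpM2r.
Qed.

Lemma conjugate_le0 lambda y : 0 <= lambda -> y <= 0 -> (conj lambda y <= 0)%E.
Proof.
move=> l0 y0; apply: conjugate_le => // x r x0 r0 _.
by rewrite lee_fin subr_le0; apply: le_trans r0; rewrite mulr_ge0_le0.
Qed.

(* The maximizers are at most 1 on the negative half-line and can be taken at
   least 1 on the positive one. *)
Lemma conjugate_slope_le1 lambda y' y : 0 <= lambda -> y' <= y -> y <= 0 ->
  (conj lambda y <= conj lambda y' + (y - y')%:E)%E.
Proof.
move=> l0 yy' y0; apply: conjugate_le => // x r x0 r0 e.
have [x1|x1] := leP x 1.
  apply: le_trans (leeD2r _ (le_conjugate y' e)).
  by rewrite -EFinD lee_fin; nra.
apply: le_trans (leeD2r _ (conjugate_ge_id lambda y')).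
rewrite -EFinD lee_fin; nra.
Qed.

Lemma conjugate_slope_ge1 lambda y' y : 0 <= lambda -> 0 <= y' -> y' <= y ->
  (conj lambda y' + (y - y')%:E <= conj lambda y)%E.
Proof.
move=> l0 y0 yy'; rewrite -leeBrDr//.
apply: conjugate_le => // x r x0 r0 e; rewrite leeBrDr//.
have [x1|x1] := leP 1 x.
  apply: le_trans (le_conjugate y e).
  by rewrite -EFinD lee_fin; nra.
apply: le_trans (conjugate_ge_id lambda y).
rewrite -EFinD lee_fin; nra.
Qed.

(** Up to x0 the slope is at most x0. Beyond x0 one has phi x >= c x, so x y - lambda phi x <= x (y
    - lambda c) <= 0, and the competitor x = 1 at y', where phi vanishes, is already good enough. *)
Lemma conjugate_lipschitz lambda c x0 y' y : 0 <= lambda -> 1 <= x0 ->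
  (c%:E <= growth phi x0)%E -> y' <= y -> y <= lambda * c ->
  (conj lambda y <= conj lambda y' + (x0 * (y - y'))%:E)%E.
Proof.
move=> l0 x01 hc yy' yY; apply: conjugate_le => // x r x0' r0 e.
have [xx0|xx0] := leP x x0.
  apply: le_trans (leeD2r _ (le_conjugate y' e)).
  by rewrite -EFinD lee_fin; nra.
have [_ _ [p hp rE]] := scaledP l0 e.
have xpos : 0 < x by apply: lt_trans xx0; apply: lt_le_trans x01.
have hcp : c * x <= p.
  have : (growth phi x0 <= phi x * (x^-1)%:E)%E.
    by apply: ereal_inf_lbound; exists x => //=; exact: ltW.
  move=> /(le_trans hc); rewrite hp -EFinM lee_fin.
  by rewrite ler_pdivlMr.
apply: le_trans (leeD2r _ (conjugate_ge_id lambda y')).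
rewrite -EFinD lee_fin rE.
have h1 : x * y - lambda * p <= x * (y - lambda * c).
  by have := ler_wpM2l l0 hcp; lra.
have h2 : x * (y - lambda * c) <= 0 by rewrite mulr_ge0_le0 ?subr_le0// ltW.
have h3 : y <= y' + x0 * (y - y') by nra.
have [y0|y0] := leP 0 y; first lra.
apply: le_trans h3.
have p0 : 0 <= p by have := divergence_ge0 Hphi x; rewrite hp lee_fin.
have := mulr_ge0 l0 p0; nra.
Qed.

Lemma growth_exists c : exists x0, 1 <= x0 /\ (c%:E <= growth phi x0)%E.
Proof.
have /cvgeyPge/(_ c) := divergence_superlinear Hphi.
move=> [M [_ hM]]; exists (Num.max 1 (M + 1)); split.
  by rewrite le_max lexx.
apply: le_ereal_inf_tmp => _ [x /= hx <-]; apply: hM => /=.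
by move: hx; rewrite ge_max => /andP[_]; lra.
Qed.

Let growth_set_lb c : lbound [set x | 1 <= x /\ (c%:E <= growth phi x)%E] 1.
Proof. by move=> x []. Qed.

Lemma growth_inv_ge1 c : 1 <= growth_inv phi c.
Proof.
by apply: lb_le_inf; [exact: growth_exists|exact: growth_set_lb].
Qed.

(** The infimum in [growth_inv] may fail to be attained. It is at least 1, so a slack of 1 costs a
    factor 2; this is the 2 in the Lipschitz constant 2 G. *)
Lemma growth_inv_approx c :
  exists x0, [/\ 1 <= x0, (c%:E <= growth phi x0)%E & x0 <= 2 * growth_inv phi c].
Proof.
have h : has_inf [set x | 1 <= x /\ (c%:E <= growth phi x)%E].
  by split; [exact: growth_exists|exists 1; exact: growth_set_lb].
have [x0 [h1 h2] h3] := inf_adherent (@ltr01 R) h.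
exists x0; split => //; have := growth_inv_ge1 c.
by rewrite -/(growth_inv phi c) in h3; lra.
Qed.

End ConjugateDivergence.

(* Rounding lambda up is cheap because the conjugate of lambda * phi decreases
   with lambda, and rounding mu up because the conjugate is nondecreasing; so
   the grid needs no regularity in lambda, and its smallest value of lambda
   provides the Lipschitz constant. *)
Section RiskGrid.
Context {R : realType} (phi : R -> \bar R).
Hypothesis Hphi : divergence_function phi.
Variables (T : nat) (tau eps : R).
Hypotheses (T_gt0 : (0 < T)%N) (tau_gt0 : 0 < tau) (eps_gt0 : 0 < eps).

Let Y : R := T%:R + 1.
Let G := growth_inv phi (16 * T%:R * tau / eps).
Let lambda0 := eps / (8 * tau).
Let top := (Num.truncn (8 * Y / eps)).+1.

Definition grid_size := top.+1.
Definition grid_lambda (k : nat) : R := k.+1%:R * lambda0.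
Definition grid_mu (l : nat) : R := l%:R * (eps / 8).
(** Extends the grid functions from [0, T + 1], where the total costs lie, to bounded Lipschitz
    functions on the line. *)
Definition clamp (z : R) := Num.max 0 (Num.min z Y).
Definition grid_fun (k l : nat) (z : R) : R :=
  fine (conjugate (scaled (grid_lambda k) phi) (clamp z - grid_mu l)).
Definition grid_cost (k l : nat) : R := grid_lambda k * tau + grid_mu l.

Let T1 : (1 : R) <= T%:R. Proof. by rewrite ler1n. Qed.

Let lambda0_gt0 : 0 < lambda0. Proof. by rewrite divr_gt0// mulr_gt0. Qed.

Let grid_lambda_ge0 k : 0 <= grid_lambda k.
Proof. by rewrite mulr_ge0// ltW. Qed.

Let grid_mu_ge0 l : 0 <= grid_mu l.
Proof. by rewrite mulr_ge0// divr_ge0// ltW. Qed.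

Let lambda0_tau : lambda0 * tau = eps / 8.
Proof. by rewrite /lambda0; field; rewrite gt_eqF. Qed.

Let grid_lambda_growth k : Y <= grid_lambda k * (16 * T%:R * tau / eps).
Proof.
apply: (@le_trans _ _ (lambda0 * (16 * T%:R * tau / eps))).
  have -> : lambda0 * (16 * T%:R * tau / eps) = 2 * T%:R.
    by rewrite /lambda0; field; rewrite !gt_eqF.
  by rewrite /Y; have := T1; lra.
rewrite ler_wpM2r//; first by rewrite !(mulr_ge0, invr_ge0)// ltW.
by rewrite /grid_lambda ler_peMl ?ler1n// ltW.
Qed.

Let G_ge1 : 1 <= G. Proof. exact: growth_inv_ge1. Qed.

Lemma grid_conjugate_lipschitz k y' y : y' <= y -> y <= Y ->
  (conjugate (scaled (grid_lambda k) phi) y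
    <= conjugate (scaled (grid_lambda k) phi) y' + (2 * G * (y - y'))%:E)%E.
Proof.
move=> yy' yY.
have [x0 [x01 hx0 x0G]] := growth_inv_approx Hphi (16 * T%:R * tau / eps).
apply: le_trans (conjugate_lipschitz Hphi (grid_lambda_ge0 k) x01 hx0 yy' _) _.
  exact: le_trans (grid_lambda_growth k).
by rewrite leeD2l// lee_fin ler_wpM2r ?subr_ge0.
Qed.

Lemma grid_conjugate_fin k y : y <= Y ->
  conjugate (scaled (grid_lambda k) phi) y \is a fin_num.
Proof.
move=> yY; have [y0|y0] := leP y 0.
  rewrite fin_real//; apply/andP; split.
    by apply: lt_le_trans (conjugate_ge_id Hphi _ _); rewrite ltNyr.
  by apply: le_lt_trans (conjugate_le0 Hphi (grid_lambda_ge0 k) y0) _; rewrite ltry.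
rewrite fin_real//; apply/andP; split.
  by apply: lt_le_trans (conjugate_ge_id Hphi _ _); rewrite ltNyr.
apply: le_lt_trans (grid_conjugate_lipschitz k (ltW y0) yY) _.
apply: (@le_lt_trans _ _ (0 + (2 * G * (y - 0))%:E)%E).
  by rewrite leeD2r// (conjugate_le0 Hphi).
by rewrite add0e ltry.
Qed.

Lemma clampE z : 0 <= z <= Y -> clamp z = z.
Proof. by move=> /andP[z0 zY]; rewrite /clamp min_l// max_r. Qed.

Lemma clamp_itv z : 0 <= clamp z <= Y.
Proof.
have Y0 : 0 <= Y by rewrite /Y addr_ge0.
by rewrite /clamp le_max lexx/= ge_max Y0 ge_min lexx orbT.
Qed.

Lemma clamp_mono z z' : z <= z' -> clamp z <= clamp z'.
Proof. by move=> zz'; rewrite /clamp le_max2// le_min2. Qed.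

Lemma clamp_contract z z' : z <= z' -> clamp z' - clamp z <= z' - z.
Proof.
have Y0 : 0 <= Y by rewrite /Y addr_ge0.
move=> zz'; rewrite /clamp.
have h : Num.min z' Y - Num.min z Y <= z' - z.
  by case: (leP z Y) => h1; case: (leP z' Y) => h2; lra.
have h' : Num.min z Y <= Num.min z' Y by rewrite le_min2.
apply: le_trans h; move: h'.
set a := Num.min z Y; set b := Num.min z' Y.
by case: (leP 0 a) => h1; case: (leP 0 b) => h2; lra.
Qed.

Let arg_le z l : clamp z - grid_mu l <= Y.
Proof. by have := clamp_itv z; have := grid_mu_ge0 l; lra. Qed.

Lemma grid_funE k l z : 0 <= z <= Y ->
  conjugate (scaled (grid_lambda k) phi) (z - grid_mu l) = (grid_fun k l z)%:E.
Proof.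
move=> hz; rewrite /grid_fun clampE// fineK//; apply: grid_conjugate_fin.
by rewrite -(clampE hz).
Qed.

Let grid_funK k l z :
  conjugate (scaled (grid_lambda k) phi) (clamp z - grid_mu l) = (grid_fun k l z)%:E.
Proof. by rewrite /grid_fun fineK//; exact: grid_conjugate_fin. Qed.

Lemma grid_fun_mono k l z z' : z <= z' -> grid_fun k l z <= grid_fun k l z'.
Proof.
move=> zz'; rewrite -lee_fin -!grid_funK; apply: conjugate_mono => //.
by rewrite lerB// clamp_mono.
Qed.

Lemma grid_fun_lip_mono k l z z' : z <= z' ->
  grid_fun k l z' <= grid_fun k l z + 2 * G * (clamp z' - clamp z).
Proof.
move=> zz'; rewrite -lee_fin EFinD -!grid_funK.
have -> : clamp z' - clamp z = clamp z' - grid_mu l - (clamp z - grid_mu l) by ring.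
by apply: grid_conjugate_lipschitz => //; rewrite lerB// clamp_mono.
Qed.

Lemma grid_fun_lipschitz k l z z' :
  `|grid_fun k l z - grid_fun k l z'| <= 2 * G * `|z - z'|.
Proof.
wlog zz' : z z' / z <= z'.
  move=> h; case: (leP z z') => [|/ltW]; first exact: h.
  by move=> zz'; rewrite distrC [in leRHS]distrC; exact: h.
rewrite distrC [in leRHS]distrC !ger0_norm ?subr_ge0//; last exact: grid_fun_mono.
have := grid_fun_lip_mono k l zz'; have := clamp_contract zz'.
have := G_ge1; nra.
Qed.

Lemma grid_fun_itv k l z : grid_fun k l 0 <= grid_fun k l z
  <= grid_fun k l 0 + Y * (2 * G).
Proof.
have Y0 : 0 <= Y by rewrite /Y addr_ge0.
have c0 : clamp 0 = 0 by rewrite clampE// lexx.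
have h0 : grid_fun k l 0 <= grid_fun k l z.
  rewrite -lee_fin -!grid_funK; apply: conjugate_mono => //.
  by rewrite c0 lerB//; have /andP[] := clamp_itv z.
rewrite h0/=.
apply: (@le_trans _ _ (grid_fun k l 0 + 2 * G * (clamp z - clamp 0))).
  rewrite -lee_fin EFinD -!grid_funK.
  have -> : clamp z - clamp 0 = clamp z - grid_mu l - (clamp 0 - grid_mu l) by ring.
  apply: grid_conjugate_lipschitz => //.
  by rewrite c0 lerB//; have /andP[] := clamp_itv z.
have := clamp_itv z; rewrite c0; have := G_ge1; nra.
Qed.

Let truncn_lt_size x : 0 <= x -> x <= 8 * Y / eps -> (Num.truncn x < top)%N.
Proof. by move=> x0 hx; rewrite /top ltnS; exact: le_truncn. Qed.

Let grid_mu_top : Y < grid_mu top /\ grid_mu top <= Y + eps / 8.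
Proof.
have Y0 : 0 <= Y by rewrite /Y addr_ge0.
have e8 : 0 < eps / 8 by rewrite divr_gt0.
have h0 : 0 <= 8 * Y / eps by rewrite !(mulr_ge0, invr_ge0)// ltW.
have e : 8 * Y / eps * (eps / 8) = Y by field; rewrite gt_eqF.
split; rewrite /grid_mu /top.
  by rewrite -[ltLHS]e ltr_pM2r// truncnS_gt.
rewrite -natr1 mulrDl mul1r lerD2r -[leRHS]e ler_pM2r//.
by rewrite truncn_le.
Qed.

(** The comparison is pointwise in the cost z, so the grid point depends neither on the law nor on
    the policy. *)
Lemma grid_dominates lambda mu : 0 <= lambda ->
  exists k l, [/\ (k < grid_size)%N, (l < grid_size)%N &
    forall z, 0 <= z <= Y ->
    ((grid_fun k l z + grid_cost k l - eps / 4 - (lambda * tau + mu))%:E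
       <= conjugate (scaled lambda phi) (z - mu))%E].
Proof.
move=> l0; have Y0 : 0 <= Y by rewrite /Y addr_ge0.
have [top1 top2] := grid_mu_top.
(* If lambda tau >= T + 1, the objective is at least T + 1 because the conjugate is above the
   identity, while the smallest lambda with the largest mu of the grid costs at most T + 1 + eps /
   4. *)
have [lY|lY] := leP Y (lambda * tau).
  exists 0%N, top; split => // z hz.
  apply: le_trans (conjugate_ge_id Hphi _ _); rewrite lee_fin.
  have : grid_fun 0 top z <= 0.
    rewrite -lee_fin -grid_funE//; apply: conjugate_le0 => //.
    by move: hz; lra.
  rewrite /grid_cost /grid_lambda mul1r lambda0_tau.
  by move: hz; lra.
pose k := Num.truncn (lambda / lambda0).
have q0 : 0 <= lambda / lambda0 by rewrite divr_ge0// ltW.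
have kl : lambda <= grid_lambda k.
  by rewrite /grid_lambda -ler_pdivrMr// ltW// truncnS_gt.
have lk : grid_lambda k <= lambda + lambda0.
  rewrite /grid_lambda -natr1 mulrDl mul1r lerD2r -ler_pdivlMr//.
  by rewrite truncn_le.
have ks : (k < grid_size)%N.
  rewrite /grid_size ltnS ltnW// truncn_lt_size//.
  rewrite ler_pdivrMr// (_ : 8 * Y / eps * lambda0 = Y / tau).
    by rewrite ler_pdivlMr// ltW.
  by rewrite /lambda0; field; rewrite !gt_eqF.
have lkt : grid_lambda k * tau <= lambda * tau + eps / 8.
  by rewrite -lambda0_tau -mulrDl ler_wpM2r// ltW.
suff [l [ls hl]] : exists l, (l < grid_size)%N /\ forall z, 0 <= z <= Y ->
    ((grid_fun k l z + grid_mu l - eps / 8 - mu)%:E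
       <= conjugate (scaled (grid_lambda k) phi) (z - mu))%E.
  exists k, l; split => // z hz.
  apply: le_trans (conjugate_anti Hphi _ l0 kl).
  by apply: le_trans (hl z hz); rewrite lee_fin /grid_cost; lra.
(* A mu outside the range of the grid is moved to the nearer end. For mu <= 0 the arguments are
   nonnegative and the slope is at least 1; beyond the top they are nonpositive and the slope is at
   most 1. In both cases the objective does not increase. *)
have [mu0|mu0] := leP mu 0.
  exists 0%N; split => // z hz.
  have := @conjugate_slope_ge1 _ _ Hphi (grid_lambda k) z (z - mu) (grid_lambda_ge0 k).
  have g0 : grid_mu 0 = 0 by rewrite /grid_mu mul0r.
  have -> : conjugate (scaled (grid_lambda k) phi) z = (grid_fun k 0 z)%:E.
    by rewrite -grid_funE// g0 subr0.
  move=> h; apply: le_trans (h _ _); rewrite ?g0 -?EFinD ?lee_fin; move: hz; lra.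
have [mut|mut] := leP (grid_mu top) mu.
  exists top; split => // z hz.
  have := @conjugate_slope_le1 _ _ Hphi (grid_lambda k) (z - mu) (z - grid_mu top)
    (grid_lambda_ge0 k).
  rewrite grid_funE// => h.
  have {}h : ((grid_fun k top z)%:E <=
      conjugate (scaled (grid_lambda k) phi) (z - mu)
      + (z - grid_mu top - (z - mu))%:E)%E by apply: h; move: hz; lra.
  rewrite -leeBlDr// in h; apply: le_trans h.
  by rewrite -EFinB lee_fin; lra.
pose l := (Num.truncn (8 * mu / eps)).+1.
have e8 : 0 < eps / 8 by rewrite divr_gt0.
have e : 8 * mu / eps * (eps / 8) = mu by field; rewrite gt_eqF.
have h0 : 0 <= 8 * mu / eps by rewrite !(mulr_ge0, invr_ge0)// ltW.
have l1 : mu <= grid_mu l.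
  by rewrite /grid_mu -[leLHS]e ler_pM2r// ltW// truncnS_gt.
have l2 : grid_mu l <= mu + eps / 8.
  rewrite /grid_mu /l -natr1 mulrDl mul1r lerD2r -[leRHS]e ler_pM2r//.
  by rewrite truncn_le.
exists l; split.
  rewrite /grid_size /l ltnS truncn_lt_nat//.
  by rewrite -(ltr_pM2r e8) e.
move=> z hz.
have := @conjugate_mono _ _ Hphi (grid_lambda k) (z - grid_mu l) (z - mu)
  (grid_lambda_ge0 k).
rewrite grid_funE// => h; apply: le_trans (h _); last by lra.
by rewrite lee_fin; lra.
Qed.

End RiskGrid.

(** * Integrals bounded without measurability *)

Section IntegralBounds.
Context {d : measure_display} {T : measurableType d} {R : realType}.
Variable mu : {measure set T -> \bar R}.

(* Measurability is not needed: the library integral is a supremum over simple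
   functions. *)
Lemma integral_mono (D : set T) (f g : T -> \bar R) :
  (forall x, D x -> (f x <= g x)%E) ->
  (\int[mu]_(x in D) f x <= \int[mu]_(x in D) g x)%E.
Proof.
move=> fg; have h x : ((f \_ D) x <= (g \_ D) x)%E.
  by rewrite !patchE; case: ifPn => // /set_mem; exact: fg.
have sup_mono (u v : T -> \bar R) : (forall x, (u x <= v x)%E) ->
  (ereal_sup [set sintegral mu (HBNNSimple.NonNegSimpleFun.sort s) |
     s in [set s | (forall x, ((HBNNSimple.NonNegSimpleFun.sort s) x)%:E <= u x)%E]]
   <= ereal_sup [set sintegral mu (HBNNSimple.NonNegSimpleFun.sort s) |
     s in [set s | (forall x, ((HBNNSimple.NonNegSimpleFun.sort s) x)%:E <= v x)%E]])%E.
  move=> uv; apply: ereal_sup_le => _ [s /= hs <-]; exists s => //= x.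
  exact: le_trans (uv x).
rewrite /integral; apply: leeB; apply: sup_mono => x.
  by apply: (@funepos_le _ _ setT) => //; rewrite inE.
by apply: (@funeneg_le _ _ setT) => //; rewrite inE.
Qed.

Lemma integral_finite_valued (D : set T) (J : finType) (cell : T -> J) (v : J -> R) :
  measurable D -> fmeasurable cell -> (mu D < +oo)%E ->
  (\int[mu]_(x in D) (v (cell x))%:E
    = (\sum_j fine (mu (D `&` [set x | cell x = j])) * v j)%:E)%E.
Proof.
move=> mD mcell Dfin.
pose F j := D `&` [set x | cell x = j].
have mF j : measurable (F j) by apply: measurableI => //; exact: mcell.
have DE : D = \big[setU/set0]_(j <- index_enum J) F j.
  rewrite -bigcup_seq; apply/seteqP; split => x.
    by move=> Dx; exists (cell x); rewrite //= mem_index_enum.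
  by move=> [j _ []].
have mv : measurable_fun D (EFin \o (fun x => v (cell x))).
  move=> _ Y _; apply: measurableI => //.
  rewrite (_ : _ @^-1` _ = [set x | `[< Y (v (cell x))%:E >]]).
    exact: (fmeasurable_pred (fun j => `[< Y (v j)%:E >]) mcell).
  by apply/seteqP; split => x /=; move/asboolP.
rewrite [in LHS]DE integral_bigsetU_EFin//=.
- rewrite -sumEFin; apply: eq_bigr => j _.
  have e : (\int[mu]_(x in F j) (v (cell x))%:E = (v j)%:E * mu (F j))%E.
    rewrite -(integral_cst mu (mF j)); apply: eq_integral => x /[!inE].
    by move=> -[_ /= ->].
  rewrite e EFinM fineK; first by rewrite muleC.
  rewrite ge0_fin_numE//; apply: le_lt_trans Dfin.
  apply: le_measure; [|exact/mem_set|exact: subIsetl].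
  by apply/mem_set; exact: mF.
- exact: index_enum_uniq.
- by move=> i j _ _ [x [[_ <-] [_ <-]]].
- by rewrite -DE.
Qed.

Lemma integral_ge_finite (D : set T) (J : finType) (cell : T -> J) (v : J -> R)
    (g : T -> \bar R) :
  measurable D -> fmeasurable cell -> (mu D < +oo)%E ->
  (forall x, D x -> ((v (cell x))%:E <= g x)%E) ->
  ((\sum_j fine (mu (D `&` [set x | cell x = j])) * v j)%:E
     <= \int[mu]_(x in D) g x)%E.
Proof.
by move=> mD mcell Dfin h; rewrite -integral_finite_valued//; exact: integral_mono.
Qed.

Lemma integral_le_finite (D : set T) (J : finType) (cell : T -> J) (v : J -> R)
    (g : T -> \bar R) :
  measurable D -> fmeasurable cell -> (mu D < +oo)%E ->
  (forall x, D x -> (g x <= (v (cell x))%:E)%E) ->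
  (\int[mu]_(x in D) g x
    <= (\sum_j fine (mu (D `&` [set x | cell x = j])) * v j)%:E)%E.
Proof.
by move=> mD mcell Dfin h; rewrite -integral_finite_valued//; exact: integral_mono.
Qed.

Lemma integral_ge_cst (D : set T) (c : R) (g : T -> \bar R) :
  measurable D -> mu D = 1%E -> (forall x, D x -> (c%:E <= g x)%E) ->
  (c%:E <= \int[mu]_(x in D) g x)%E.
Proof.
move=> mD D1 h; rewrite -[leLHS]mule1 -D1 -integral_cst//.
exact: integral_mono.
Qed.

Lemma integral_le_cst (D : set T) (c : R) (g : T -> \bar R) :
  measurable D -> mu D = 1%E -> (forall x, D x -> (g x <= c%:E)%E) ->
  (\int[mu]_(x in D) g x <= c%:E)%E.
Proof.
move=> mD D1 h; rewrite -[leRHS]mule1 -D1 -integral_cst//.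
exact: integral_mono.
Qed.

Lemma sum_fine_partition (D : set T) (J : finType) (cell : T -> J) :
  measurable D -> fmeasurable cell -> (mu D < +oo)%E ->
  \sum_j fine (mu (D `&` [set x | cell x = j])) = fine (mu D).
Proof.
move=> mD mcell Dfin.
have := @integral_finite_valued D J cell (fun=> 1) mD mcell Dfin.
rewrite (integral_cst _ mD) mul1e => ->.
by apply: eq_bigr => j _; rewrite mulr1.
Qed.

End IntegralBounds.

Lemma l1dist_ge {R : realType} d (X : measurableType d)
    (mu nu : {finite_measure set X -> \bar R}) (A : set X) : measurable A ->
  (mu A - nu A <= l1dist mu nu)%E.
Proof.
move=> mA; rewrite /l1dist; case: cid => P PN; case: cid => N rhoPN.
set rho := cadd _ _ in rhoPN *.
have -> : (mu A - nu A = rho A)%E.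
  by rewrite /rho /cadd/= /copp/=.
apply: le_trans (lee_abs _) _.
apply: le_trans (abse_charge_variation rhoPN mA) _.
by apply: le_measure; rewrite ?inE.
Qed.

(** Both laws have mass 1 on [D], so [v] may be replaced by [v - b], with values in [0, B]. The
    indices where [m] exceeds [n] then suffice, and their total excess is the difference of the two
    laws on one set. *)
Lemma l1dist_finite_sum {R : realType} d (X : measurableType d)
    (mu nu : {finite_measure set X -> \bar R}) (D : set X) (J : finType)
    (cell : X -> J) (v : J -> R) (b B delta : R) :
  measurable D -> fmeasurable cell -> mu D = 1%E -> nu D = 1%E ->
  (l1dist mu nu <= delta%:E)%E -> 0 <= B -> (forall j, b <= v j <= b + B) ->
  \sum_j fine (mu (D `&` [set x | cell x = j])) * v j
   <= \sum_j fine (nu (D `&` [set x | cell x = j])) * v j + B * delta.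
Proof.
move=> mD mcell muD nuD hdelta B0 hv.
pose m j := fine (mu (D `&` [set x | cell x = j])).
pose n j := fine (nu (D `&` [set x | cell x = j])).
rewrite -/(\sum_j m j * v j) -/(\sum_j n j * v j).
have muDfin : (mu D < +oo)%E by rewrite muD ltry.
have nuDfin : (nu D < +oo)%E by rewrite nuD ltry.
have m1 : \sum_j m j = 1.
  exact: etrans (sum_fine_partition mD mcell muDfin) (congr1 fine muD).
have n1 : \sum_j n j = 1.
  exact: etrans (sum_fine_partition mD mcell nuDfin) (congr1 fine nuD).
pose A := [set x | m (cell x) > n (cell x)].
have mA : measurable (D `&` A).
  apply: measurableI => //.
  exact: (fmeasurable_pred (fun j => n j < m j) mcell).
have half (rho : {finite_measure set X -> \bar R}) :
    fine (rho (D `&` A)) =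
    \sum_(j | n j < m j) fine (rho (D `&` [set x | cell x = j])).
  have rfin : (rho (D `&` A) < +oo)%E by rewrite -ge0_fin_numE// fin_num_measure.
  rewrite -(sum_fine_partition mA mcell rfin).
  rewrite [RHS]big_mkcond; apply: eq_bigr => j _; case: ifPn => hj.
    congr (fine (rho _)); apply/seteqP; split => x [].
      by move=> [Dx _] /= xj; split.
    by move=> Dx /= xj; split => //; split => //; rewrite /A/= xj.
  rewrite (_ : _ `&` _ = set0) ?measure0//; apply/seteqP; split => x //.
  by move=> [[_]]; rewrite /A/= => + xj; rewrite xj (negPf hj).
have key : \sum_(j | n j < m j) (m j - n j) <= delta.
  rewrite sumrB -half -half -lee_fin EFinB !fineK ?fin_num_measure//.
  by apply: le_trans hdelta; exact: l1dist_ge.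
have -> : \sum_j m j * v j = \sum_j n j * v j + \sum_j (m j - n j) * (v j - b).
  under [X in _ + X]eq_bigr do rewrite mulrBr !mulrBl.
  rewrite !sumrB -!mulr_suml m1 n1; ring.
rewrite lerD2l; apply: (@le_trans _ _ (\sum_j (if n j < m j then m j - n j else 0) * B)).
  apply: ler_sum => j _; have := hv j; case: ifP => [h|/negbT]; first nra.
  by rewrite -leNgt; nra.
by rewrite -mulr_suml -big_mkcond mulrC ler_wpM2l.
Qed.

(** * From the samples to finite layers *)

Section SampleLayers.
Context {R : realType} {dS dA : nat} (M : soc R dS dA).
Variables (T n : nat) (P : forall t, probability (borel (noise M t)) R).
Context {d : measure_display} {Omega : measurableType d}.
Variables (Pr : probability Omega R) (X : forall t, nat -> Omega -> noise M t).
Hypothesis iid : iid_samples T n P Pr X.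
Variables (K : finType) (kp : forall t, noise M t -> K).
Hypothesis fmeasurable_kp : forall t, fmeasurable (@kp t : borel (noise M t) -> K).

Let p t k : R := fine (P t [set xi | kp xi = k]).

Definition layer (t : nat) (omega : Omega) : {ffun 'I_n -> K} :=
  [ffun i : 'I_n => kp (X t i omega)].

Definition layers (m t : nat) (omega : Omega) := [seq layer u omega | u <- iota t m].

Let fmeasurable_layer t : (t < T)%N -> fmeasurable (layer t).
Proof.
move=> tT; apply: fmeasurable_ffun => i k.
have := sample_measurable iid tT (ltn_ord i).
by move=> /(_ measurableT _ (fmeasurable_kp k)); rewrite setTI.
Qed.

Lemma measurable_layers m t (G : seq {ffun 'I_n -> K} -> bool) : (t + m <= T)%N ->
  measurable [set omega | G (layers m t omega)].
Proof.
elim: m t G => [|m IH] t G tm.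
  rewrite /layers/=; case: (G [::]).
    by rewrite (_ : mkset _ = setT)//; apply/seteqP.
  by rewrite (_ : mkset _ = set0)//; apply/seteqP; split.
have tT : (t < T)%N by apply: leq_trans tm; rewrite addnS ltnS leq_addr.
rewrite (_ : mkset _ = \big[setU/set0]_(S : {ffun 'I_n -> K})
  ([set omega | layer t omega = S] `&` [set omega | G (S :: layers m t.+1 omega)])).
  apply: bigsetU_measurable => S _; apply: measurableI.
    exact: fmeasurable_layer.
  by apply: (IH t.+1 (fun l => G (S :: l))); rewrite addSnnS.
rewrite -bigcup_seq; apply/seteqP; split => omega /=.
  by move=> h; exists (layer t omega) => //=; rewrite mem_index_enum.
by move=> [S _ /= [<-]].
Qed.

Let pre t (S : nat -> {ffun 'I_n -> K}) : set Omega :=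
  [set omega | forall u, (u < t)%N -> layer u omega = S u].

Let preS t S : pre t.+1 S = pre t S `&` [set omega | layer t omega = S t].
Proof.
apply/seteqP; split => omega.
  by move=> h; split => [u ut|]; apply: h => //; exact: leqW.
move=> [h1 h2] u; rewrite ltnS leq_eqVlt => /orP[/eqP ->//|]; exact: h1.
Qed.

Let measurable_pre t S : (t <= T)%N -> measurable (pre t S).
Proof.
elim: t => [|t IH] tT; first by rewrite (_ : pre 0 S = setT)//; apply/seteqP.
by rewrite preS; apply: measurableI; [exact/IH/ltnW|exact: fmeasurable_layer].
Qed.

Let pre_full S : fine (Pr (pre T S)) = \prod_(t < T) layer_weight p t (S t).
Proof.
(* The product formula wants sets indexed by natural numbers, whence the quantification over the
   ordinals of value i. *)
pose B t i : set (borel (noise M t)) :=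
  [set xi | forall j : 'I_n, nat_of_ord j = i -> kp xi = S t j].
have BE t (i : 'I_n) : B t i = [set xi | kp xi = S t i].
  by apply/seteqP; split => xi /=; [apply|move=> h j /val_inj ->].
have mB t i : (t < T)%N -> (i < n)%N -> measurable (B t i).
  by move=> _ ni; rewrite (BE t (Ordinal ni)); exact: fmeasurable_kp.
have -> : pre T S = \bigcap_(t in `I_T) \bigcap_(i in `I_n) X t i @^-1` B t i.
  apply/seteqP; split => omega.
    move=> h t /= tT i /= ni j ji.
    by rewrite -(h t tT) ffunE ji.
  move=> h t tT; apply/ffunP => i; rewrite ffunE.
  exact: (h t tT i (ltn_ord i) i).
rewrite (sample_independent iid mB).
have hE t (i : 'I_n) : (t < T)%N -> Pr (X t i @^-1` B t i) = (p t (S t i))%:E.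
  move=> tT; rewrite (sample_law iid tT (ltn_ord i)) ?BE; last first.
    exact: fmeasurable_kp.
  rewrite /p fineK// fin_num_measure//; exact: fmeasurable_kp.
under eq_bigr do under eq_bigr do rewrite hE//.
under eq_bigr do rewrite prodEFin.
by rewrite prodEFin.
Qed.

(** Independence is given as a product formula over all stages and samples, so the base case
    prescribes all T layers; the induction frees the last prescribed layer by summing over its
    values. *)
Let pre_layers m t S (G : seq {ffun 'I_n -> K} -> bool) : (t + m = T)%N ->
  fine (Pr (pre t S `&` [set omega | G (layers m t omega)]))
    = (\prod_(u < t) layer_weight p u (S u))
      * sample_mean p m t (fun l => (G l)%:R).
Proof.
elim: m t S G => [|m IH] t S G tm.
  rewrite addn0 in tm; subst t; rewrite /layers/=; case: (G [::]).
    by rewrite (_ : mkset _ = setT) ?setIT ?mulr1 ?pre_full//; apply/seteqP.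
  rewrite (_ : mkset _ = set0) ?setI0 ?measure0 ?mulr0//; by apply/seteqP; split.
have tT : (t < T)%N by rewrite -tm addnS ltnS leq_addr.
have mD : measurable (pre t S `&` [set omega | G (layers m.+1 t omega)]).
  by apply: measurableI; [exact/measurable_pre/ltnW|apply: measurable_layers; rewrite tm].
rewrite -(sum_fine_partition mD (fmeasurable_layer tT)); last first.
  by apply: le_lt_trans (probability_le1 _ mD) _; rewrite ltry.
rewrite /= mulr_sumr; apply: eq_bigr => V _.
pose S' u := if u == t then V else S u.
have e : \prod_(u < t.+1) layer_weight p u (S' u)
    = (\prod_(u < t) layer_weight p u (S u)) * layer_weight p t V.
  rewrite big_ord_recr/= {2}/S' eqxx; congr (_ * _).
  by apply: eq_bigr => u _; rewrite /S' ltn_eqF.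
rewrite mulrA -e -(IH t.+1 S' (fun l => G (V :: l))) ?addSnnS//.
congr (fine (Pr _)); apply/seteqP; split => omega.
  move=> [[h1 h2] h3]; rewrite preS; split; first split.
  - by move=> u ut; rewrite /S' ltn_eqF//; exact: h1.
  - by rewrite /S'/= eqxx.
  - by move: h2; rewrite /layers/= h3.
rewrite preS => -[[h1 h3] h2]; rewrite /S'/= eqxx in h3; split; first split.
- by move=> u ut; rewrite h1// /S' ltn_eqF.
- by rewrite /layers/= h3.
- exact: h3.
Qed.

Lemma probability_layers (G : seq {ffun 'I_n -> K} -> bool) :
  fine (Pr [set omega | G (layers T 0 omega)])
    = sample_mean p T 0 (fun l => (G l)%:R).
Proof.
(* An arbitrary sequence of layers, as [pre 0] imposes no condition. *)
have k0 : nat -> {ffun 'I_n -> K}.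
  by move=> t; exact: (layer t point).
have := @pre_layers T 0 k0 G (add0n T).
rewrite (_ : pre 0 k0 = setT) ?setTI; last by apply/seteqP.
by rewrite big_ord0 mul1r.
Qed.

(** The witness is an event on quantized samples, hence measurable, whereas [Good] will be a
    statement about all initial states. *)
Lemma with_probability_layers (delta : R) (G : seq {ffun 'I_n -> K} -> bool)
    (Good : Omega -> Prop) :
  sample_mean p T 0 (fun l => (~~ G l)%:R) <= delta ->
  (forall omega, G (layers T 0 omega) -> Good omega) ->
  with_probability_ge Pr (1 - delta) Good.
Proof.
move=> hdelta hG; exists [set omega | G (layers T 0 omega)].
have mG := @measurable_layers T 0 G (leqnn T).
split => //; rewrite -(setCK [set omega | G _]) probability_setC; last exact: measurableC.
have mC : measurable (~` [set omega | G (layers T 0 omega)]) by exact: measurableC.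
rewrite -(@fineK _ (Pr (~` _))); last exact: fin_num_measure.
rewrite lee_fin lerB//; apply: le_trans hdelta.
rewrite -probability_layers le_eqVlt; apply/orP; left; apply/eqP.
congr (fine (Pr _)); apply/seteqP; split => omega /=; first by move/negP.
by move/negP.
Qed.

End SampleLayers.

(** * The discretized control problem *)

Lemma continuous_borel_preimage (X Y : ptopologicalType) (f : X -> Y)
    (B : set (borel Y)) :
  continuous f -> measurable B -> measurable (f @^-1` B : set (borel X)).
Proof.
move=> cf; pose S := [set C : set Y | measurable (f @^-1` C : set (borel X))].
apply: (@smallest_sub _ _ _ S) => [|V oV].
  split.
  - by rewrite /S/= preimage_set0; exact: measurable0.
  - by move=> C mC; rewrite /S/= setTD preimage_setC; exact: measurableC.
  - by move=> F mF; rewrite /S/= preimage_bigcup; exact: bigcupT_measurable.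
by apply: sub_sigma_algebra; move/continuousP : cf; apply.
Qed.

Section Discretization.
Context {R : realType} {dS dA : nat} (M : soc R dS dA).
Variables (T : nat) (rad L eta : R).
Hypotheses (wf : soc_wf M T) (reg : soc_regular M T rad L).
Hypotheses (L_ge0 : 0 <= L) (eta_gt0 : 0 < eta).
Variables (SI AI : finType).
Variables (spt : nat -> SI -> 'rV[R]_dS) (sproj : nat -> 'rV[R]_dS -> SI).
Variables (apt : nat -> AI -> 'rV[R]_dA) (aproj : nat -> 'rV[R]_dA -> AI).
Hypothesis spt_state : forall t j, (t <= T)%N -> state M t (spt t j).
Hypothesis apt_control : forall t j, (t <= T)%N -> control M t (apt t j).
Hypothesis fmeasurable_sproj :
  forall t, (t <= T)%N -> fmeasurable (sproj t : borel _ -> SI).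
Hypothesis fmeasurable_aproj :
  forall t, (t <= T)%N -> fmeasurable (aproj t : borel _ -> AI).
Hypothesis sproj_close : forall t s, (t <= T)%N -> state M t s ->
  enorm (s - spt t (sproj t s)) <= eta.
Hypothesis aproj_close : forall t a, (t <= T)%N -> control M t a ->
  enorm (a - apt t (aproj t a)) <= eta.

Let N := Num.truncn (T%:R / eta : R).

Definition grid_state := (SI * 'I_N.+1)%type.
(** A noise is reduced to the whole table of transitions between net points. There are very many
    tables, but the tail bounds count grid states and actions only. *)
Definition grid_noise := {ffun SI * AI -> SI}.

(** Cut off at t to stay in [0, t], where the policy is admissible and Lipschitz. *)
Definition xpt (t : nat) (i : 'I_N.+1) : R := Num.min (i%:R * eta) t%:R.
Definition xproj (x : R) : 'I_N.+1 := inord (Num.truncn (x / eta)).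

Definition grid_step (t : nat) (z : grid_state) (a : AI) (k : grid_noise)
    : grid_state :=
  (k (z.1, a), xproj (xpt t z.2 + cost M t (spt t z.1) (apt t a))).

Definition kappa (t : nat) (xi : noise M t) : grid_noise :=
  [ffun ja => if (t < T)%N
    then sproj t.+1 (trans (spt t ja.1) (apt t ja.2) xi) else ja.1].

Lemma xpt_itv t i : 0 <= xpt t i <= t%:R.
Proof.
rewrite /xpt ge_min lexx orbT andbT le_min mulr_ge0 ?ler0n//.
exact: ltW.
Qed.

Lemma xproj_close t x : (t <= T)%N -> 0 <= x <= t%:R ->
  `|x - xpt t (xproj x)| <= eta.
Proof.
move=> tT /andP[x0 xt].
have q0 : 0 <= x / eta by rewrite divr_ge0// ltW.
have i1 : (xproj x : nat) = Num.truncn (x / eta).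
  rewrite /xproj inordK// ltnS /N; apply: le_truncn.
  rewrite ler_wpM2r ?invr_ge0 ?(ltW eta_gt0)//.
  by apply: le_trans xt _; rewrite ler_nat.
have /andP[h1 h2] := truncn_itv q0.
have h3 : (Num.truncn (x / eta))%:R * eta <= x by rewrite -ler_pdivlMr.
have h4 : x <= (Num.truncn (x / eta))%:R * eta + eta.
  rewrite -[X in _ + X]mul1r -mulrDl natr1 -ler_pdivrMr//; exact: ltW.
rewrite /xpt i1 min_l; last exact: le_trans xt.
by rewrite ger0_norm ?subr_ge0//; lra.
Qed.

Lemma trans_noise_continuous t s a : (t < T)%N -> state M t s ->
  control M t a -> continuous (fun xi : noise M t => trans s a xi).
Proof.
move=> tT hs ha xi.
have /subspace_continuousP/(_ ((s, a), xi)) := trans_continuous wf tT.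
move=> /(_ (conj (conj hs ha) I)) h.
apply: (cvg_comp (fun xi : noise M t => ((s, a), xi)) _ _ h).
move=> U hU.
have : \forall xi' \near xi,
    (state M t `*` control M t `*` [set: noise M t]) ((s, a), xi') ->
    U ((s, a), xi').
  have c : (fun xi' : noise M t => ((s, a), xi')) @ xi --> ((s, a), xi).
    have c1 : (fun _ : noise M t => (s, a)) @ xi --> (s, a) by exact: cvg_cst.
    have c2 : (fun x : noise M t => x) @ xi --> xi by exact: cvg_id.
    exact: (cvg_pair c1 c2).
  exact: (c _ hU).
by move=> h2; apply: (filterS _ h2) => xi' h3; apply: h3.
Qed.

Lemma fmeasurable_kappa t : fmeasurable (@kappa t : borel (noise M t) -> _).
Proof.
apply: fmeasurable_ffun => -[j a] /=; have [tT|tT] := ltnP t T; last first.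
  exact: fmeasurable_cst.
move=> j'.
apply: (@continuous_borel_preimage _ _ (fun xi => trans (spt t j) (apt t a) xi)
  [set s | sproj t.+1 s = j']).
  by apply: trans_noise_continuous => //; [exact/spt_state/ltnW|exact/apt_control/ltnW].
exact: fmeasurable_sproj.
Qed.

Definition gap t s x (z : grid_state) : R :=
  enorm (s - spt t z.1) + `|x - xpt t z.2|.

(** In one stage the gap becomes at most gap + 2 L (gap + eta) + 2 eta: cost and transition are
    L-Lipschitz with the control rounded by eta, and state and accumulated cost are each rounded
    once more. With gap and eta at most r this is at most (4 L + 3) r. *)
Let rho : R := 4 * L + 3.

Definition radius (t : nat) : R := rho ^+ t * eta.

Let rho_ge1 : 1 <= rho. Proof. by rewrite /rho; have := L_ge0; lra. Qed.

Lemma radius_ge t : eta <= radius t.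
Proof. by rewrite /radius ler_peMl ?exprn_ege1// ltW. Qed.

Lemma radius_mono t t' : (t <= t')%N -> radius t <= radius t'.
Proof.
move=> tt'; rewrite /radius ler_wpM2r ?(ltW eta_gt0)//.
exact: ler_weXn2l.
Qed.

Lemma cost_close t s x z a a' : (t <= T)%N -> state M t s -> control M t a ->
  enorm (a - apt t a') <= eta -> gap t s x z <= radius t ->
  `|x + cost M t s a - (xpt t z.2 + cost M t (spt t z.1) (apt t a'))|
    <= radius t.+1.
Proof.
move=> tT hs ha haa' hgap.
have hc : `|cost M t s a - cost M t (spt t z.1) (apt t a')|
    <= L * (enorm (s - spt t z.1) + eta).
  apply: le_trans (cost_lipschitz reg tT hs (spt_state _ tT) ha (apt_control _ tT)) _.
  apply: ler_wpM2l => //; apply: le_trans (enorm_row_mx _ _) _.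
  by rewrite lerD2l.
have e : x + cost M t s a - (xpt t z.2 + cost M t (spt t z.1) (apt t a'))
  = (x - xpt t z.2) + (cost M t s a - cost M t (spt t z.1) (apt t a')).
  by ring.
rewrite e; apply: le_trans (ler_normD _ _) _.
have := radius_ge t; have := enorm_ge0 (s - spt t z.1).
move: hgap hc; rewrite /gap /radius exprS -mulrA -/(radius t).
set r := radius t; set A := `|_|; set B := `|_|; set E := enorm _.
rewrite /rho; have := L_ge0; have : 0 <= A by exact: normr_ge0.
move=> A0 L0 h1 h2 E0 rE.
have : L * (E + eta) <= L * (r + r) by apply: ler_wpM2l => //; lra.
have := mulr_ge0 L0 (le_trans E0 (_ : E <= r)).
by move=> /(_ ltac:(lra)); have := eta_gt0; lra.
Qed.

Lemma state_close t s x z a a' (xi : noise M t) : (t < T)%N -> state M t s ->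
  control M t a -> enorm (a - apt t a') <= eta -> 0 <= x <= t%:R -> gap t s x z <= radius t ->
  let s' := trans s a xi in let x' := x + cost M t s a in
  [/\ state M t.+1 s', 0 <= x' <= t.+1%:R &
    gap t.+1 s' x' (grid_step t z a' (kappa xi)) <= radius t.+1].
Proof.
move=> tT hs ha haa' hx hgap s' x'; have tT' := ltnW tT.
have hspt := spt_state z.1 tT'; have hapt := apt_control a' tT'.
have c1 := cost_itv wf tT' hs ha.
have c2 := cost_itv wf tT' hspt hapt.
split; first exact: (trans_state wf).
  by rewrite /x' -natr1; move: hx c1; lra.
set u := enorm (s - spt t z.1) + eta.
have hrow : enorm (row_mx (s - spt t z.1) (a - apt t a')) <= u.
  by apply: le_trans (enorm_row_mx _ _) _; rewrite lerD2l.
have hF : enorm (s' - spt t.+1 (kappa xi (z.1, a'))) <= L * u + eta.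
  rewrite ffunE tT/=; set y := trans (spt t z.1) _ xi.
  apply: le_trans (enorm_dist_triangle y _ _) _.
  rewrite lerD ?sproj_close//; last exact: (trans_state wf).
  apply: le_trans (trans_lipschitz reg xi tT hs hspt ha hapt) _.
  exact: ler_wpM2l.
have hC : `|cost M t s a - cost M t (spt t z.1) (apt t a')| <= L * u.
  apply: le_trans (cost_lipschitz reg tT' hs hspt ha hapt) _.
  exact: ler_wpM2l.
set y := xpt t z.2 + cost M t (spt t z.1) (apt t a').
have hy : `|y - xpt t.+1 (xproj y)| <= eta.
  apply: xproj_close => //; rewrite /y -natr1.
  by have := xpt_itv t z.2; move: c2; lra.
have hX : `|x' - xpt t.+1 (xproj y)| <= `|x - xpt t z.2| + L * u + eta.
  have -> : x' - xpt t.+1 (xproj y) = (x - xpt t z.2)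
     + (cost M t s a - cost M t (spt t z.1) (apt t a'))
     + (y - xpt t.+1 (xproj y)) by rewrite /x' /y; ring.
  apply: le_trans (ler_normD _ _) _; apply: lerD => //.
  by apply: le_trans (ler_normD _ _) _; apply: lerD.
rewrite {1}/gap /= -/y.
apply: le_trans (lerD hF hX) _.
have := radius_ge t; rewrite /radius exprS -mulrA -/(radius t) /rho.
move: hgap; rewrite /gap /u; have := enorm_ge0 (s - spt t z.1).
have := normr_ge0 (x - xpt t z.2); have := L_ge0; have := eta_gt0.
set r := radius t; set A := `|_|; set E := enorm _ => eta0 L0 A0 E0 hg hr.
have : L * (E + eta) <= L * (r + r) by apply: ler_wpM2l => //; lra.
lra.
Qed.

(** * Discrete values against iterated integrals *)

Section Measures.
Variable Q : forall t, {measure set (borel (noise M t)) -> \bar R}.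
Hypothesis Q1 : forall t, Q t setT = 1%E.

Definition pmf (t : nat) (k : grid_noise) : R :=
  fine (Q t [set xi | kappa xi = k]).

Lemma pmf_ge0 t k : 0 <= pmf t k.
Proof. by apply: fine_ge0; exact: measure_ge0. Qed.

Lemma pmf_sum t : \sum_k pmf t k = 1.
Proof.
have Qfin : (Q t setT < +oo)%E by rewrite Q1 ltry.
transitivity (fine (Q t setT)); last by rewrite Q1.
rewrite -(sum_fine_partition measurableT (@fmeasurable_kappa t) Qfin).
by apply: eq_bigr => k _; rewrite setTI.
Qed.

Lemma pmean_kappa_le t (v : grid_noise -> R) (h : noise M t -> \bar R) :
  (forall xi, ((v (kappa xi))%:E <= h xi)%E) ->
  ((pmean pmf t v)%:E <= \int[Q t]_xi h xi)%E.
Proof.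
move=> vh; have Qfin : (Q t setT < +oo)%E by rewrite Q1 ltry.
have := integral_ge_finite measurableT (@fmeasurable_kappa t) Qfin
  (fun xi _ => vh xi).
by apply: le_trans; rewrite lee_fin; apply: ler_sum => k _; rewrite setTI.
Qed.

Lemma pmean_kappa_ge t (v : grid_noise -> R) (h : noise M t -> \bar R) :
  (forall xi, (h xi <= (v (kappa xi))%:E)%E) ->
  (\int[Q t]_xi h xi <= (pmean pmf t v)%:E)%E.
Proof.
move=> vh; have Qfin : (Q t setT < +oo)%E by rewrite Q1 ltry.
have := integral_le_finite measurableT (@fmeasurable_kappa t) Qfin
  (fun xi _ => vh xi).
move/le_trans; apply; rewrite lee_fin; apply: ler_sum => k _; by rewrite setTI.
Qed.

Lemma pmean_addr t W c : pmean pmf t (fun k => W k + c) = pmean pmf t W + c.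
Proof.
rewrite -[in RHS](mul1r (pmean _ _ _)) -(pmean_affine pmf_sum).
by congr pmean; apply: funext => k; rewrite mul1r.
Qed.

Lemma measurable_control t : (t <= T)%N ->
  measurable (control M t : set (borel 'rV[R]_dA)).
Proof.
move=> tT.
have cl : closed (control M t).
  by apply: compact_closed; [exact: norm_hausdorff|exact: (control_compact reg)].
rewrite -(setCK (control M t)); apply: measurableC; apply: sub_sigma_algebra.
exact: closed_openC.
Qed.

Section Terminal.
Variables (f : R -> \bar R) (f' : R -> R) (c G2 : R).
Hypothesis G2_ge0 : 0 <= G2.
Hypothesis f'_lip : forall z z', `|f' z - f' z'| <= G2 * `|z - z'|.

Let f'_close (z z' r : R) : `|z - z'| <= r -> f' z <= f' z' + G2 * r /\ f' z' <= f' z + G2 * r.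
Proof.
move=> h; have : `|f' z - f' z'| <= G2 * r.
  by apply: le_trans (f'_lip _ _) _; rewrite ler_wpM2l.
by rewrite ler_norml; lra.
Qed.

Variable s0 : 'rV[R]_dS.
Let g (t : nat) (w : traj M t) (a : 'rV[R]_dA) : \bar R :=
  f (traj_cost s0 w + cost M t (traj_state s0 w) a).

Let total_cost_itv t s a (x : R) : (t <= T)%N -> state M t s -> control M t a ->
  0 <= x <= t%:R -> 0 <= x + cost M t s a <= T%:R + 1.
Proof.
move=> tT hs ha hx; have := cost_itv wf tT hs ha.
have : t%:R <= (T%:R : R) by rewrite ler_nat.
move: hx; lra.
Qed.

Definition terminal_cost (z : grid_state) (a : AI) : R :=
  f' (xpt T z.2 + cost M T (spt T z.1) (apt T a)).

Section OptimalValue.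
Variable a0 : AI.

(** No noise follows the last control, so its minimization is part of the terminal cost. *)
Definition opt_terminal (z : grid_state) : R :=
  terminal_cost z (amin a0 (terminal_cost z)).

Let V k t z := oval grid_step a0 opt_terminal (pmeans pmf k t) t z.

(** The control drawn by the rule is rounded to a net point, over which the discrete value
    minimizes. In the application [f] is a conjugate with arbitrary dual variables, [f'] a grid
    function, and [c] the shift between them. *)
Lemma oval_le_iterated (ru : rule M) :
  (forall t (w : traj M t), (t <= T)%N -> ru t w (control M t) = 1%E) ->
  (forall z : R, 0 <= z <= T%:R + 1 -> ((f' z - c)%:E <= f z)%E) ->
  forall k t (w : traj M t) z, (t + k = T)%N -> state M t (traj_state s0 w) ->
  0 <= traj_cost s0 w <= t%:R ->
  gap t (traj_state s0 w) (traj_cost s0 w) z <= radius t ->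
  ((V k t z - c - G2 * radius T.+1)%:E <= iterated_integral Q ru g k w)%E.
Proof.
move=> ru1 hf; elim=> [|k IH] t w z htk hs hx hgap /=.
  rewrite addn0 in htk; subst t.
  apply: integral_ge_cst; [exact: measurable_control|exact: ru1|move=> a ha].
  apply: le_trans (hf _ (total_cost_itv (leqnn _) hs ha hx)).
  rewrite lee_fin.
  have := cost_close (leqnn _) hs ha (aproj_close (leqnn _) ha) hgap.
  move=> /f'_close[_ h].
  have := amin_le a0 (terminal_cost z) (aproj T a).
  rewrite -/(opt_terminal z) /V/= /terminal_cost; move: h; lra.
have tT : (t < T)%N by rewrite -htk addnS ltnS leq_addr.
have tT' := ltnW tT.
apply: integral_ge_cst; [exact: measurable_control|exact: ru1|move=> a ha].
pose v k' := V k t.+1 (grid_step t z (aproj t a) k') + (- c - G2 * radius T.+1).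
apply: (@le_trans _ _ (pmean pmf t v)%:E).
  have h : V k.+1 t z
      <= pmean pmf t (fun k' => V k t.+1 (grid_step t z (aproj t a) k')).
    exact: (amin_le a0 (fun a => pmean pmf t
      (fun k' => V k t.+1 (grid_step t z a k')))).
  by rewrite lee_fin /v pmean_addr; lra.
apply: pmean_kappa_le => xi.
have [h1 h2 h3] := state_close xi tT hs ha (aproj_close (ltnW tT) ha) hx hgap.
have -> : v (kappa xi) = V k t.+1 (grid_step t z (aproj t a) (kappa xi))
    - c - G2 * radius T.+1 by rewrite /v; ring.
by apply: IH => //; rewrite addSnnS.
Qed.

Definition grid_action (t : nat) (z : grid_state) : AI :=
  if (t < T)%N then greedy grid_step pmf a0 opt_terminal T t z
  else amin a0 (terminal_cost z).

(** The discrete optimal policy is deterministic, so the past noises determine the grid state;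
    tracking it turns the greedy actions into a history-dependent policy. *)
Fixpoint grid_history (z0 : grid_state) (t : nat) : history M t -> grid_state :=
  match t return history M t -> grid_state with
  | 0 => fun=> z0
  | t'.+1 => fun h => let z := grid_history z0 h.1 in
      grid_step t' z (grid_action t' z) (kappa h.2)
  end.

Lemma fmeasurable_grid_history z0 t : fmeasurable (@grid_history z0 t).
Proof.
elim: t => [|t IH]; first exact: fmeasurable_cst.
have m1 : fmeasurable (fun h : history M t.+1 => grid_history z0 h.1).
  move=> z; have := @measurable_fst _ _ (history M t) (borel (noise M t)).
  by move=> /(_ measurableT _ (IH z)); rewrite setTI.
have m2 : fmeasurable (fun h : history M t.+1 => kappa h.2).
  move=> k; have := @measurable_snd _ _ (history M t) (borel (noise M t)).
  by move=> /(_ measurableT _ (@fmeasurable_kappa t k)); rewrite setTI.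
exact: (fmeasurable_comp (fun zk => grid_step t zk.1 (grid_action t zk.1) zk.2)
  (fmeasurable_pair m1 m2)).
Qed.

Definition grid_control z0 t (h : history M t) : borel 'rV[R]_dA :=
  apt t (grid_action t (grid_history z0 h)).

Lemma measurable_grid_control z0 t : measurable_fun setT (@grid_control z0 t).
Proof.
move=> _ B mB; rewrite setTI (_ : _ @^-1` _ =
  [set h | `[< B (apt t (grid_action t (grid_history z0 h))) >]]).
  exact: (fmeasurable_pred (fun z => `[< B (apt t (grid_action t z)) >])
    (@fmeasurable_grid_history z0 t)).
by apply/seteqP; split => h /=; move/asboolP.
Qed.

Definition grid_policy z0 : history_policy M :=
  fun t => [the R.-pker (history M t) ~> borel 'rV[R]_dA of
    kdirac (@measurable_grid_control z0 t)].

Lemma grid_policy_admissible z0 : history_admissible T (grid_policy z0).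
Proof.
by move=> t h tT; rewrite /grid_policy/= /kdirac diracE mem_set//; exact: apt_control.
Qed.

(** The integrand is dominated by the function equal to v at a and to +oo elsewhere, which is
    measurable. *)
Let integral_dirac_le d (X : measurableType d) (a : X) (D : set X)
    (h : X -> \bar R) (v : \bar R) :
  measurable D -> measurable [set a] -> D a -> (h a <= v)%E ->
  (\int[\d_a]_(x in D) h x <= v)%E.
Proof.
move=> mD ma Da hv.
pose h' (x : X) : \bar R := if `[< x = a >] then v else +oo%E.
have mh' : measurable_fun D h'.
  have mcell : fmeasurable (fun x : X => `[< x = a >]).
    move=> [|].
      rewrite (_ : mkset _ = [set a])//.
      by apply/seteqP; split => x /=; [move/asboolP|move=> ->; apply/asboolP].
    rewrite (_ : mkset _ = ~` [set a]); first exact: measurableC.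
    by apply/seteqP; split => x /= => [/asboolPn|/asboolPn/negbTE].
  move=> _ Y _; apply: measurableI => //.
  rewrite (_ : _ @^-1` _ = [set x | `[< Y (if `[< x = a >] then v else +oo%E) >]]).
    exact: (fmeasurable_pred (fun b : bool => `[< Y (if b then v else +oo%E) >]) mcell).
  by apply/seteqP; split => x /=; move/asboolP.
apply: (@le_trans _ _ (\int[\d_a]_(x in D) h' x)%E).
  apply: integral_mono => x Dx; rewrite /h'; case: asboolP => [->//|_]; exact: leey.
rewrite integral_dirac// diracE mem_set// mul1e /h'.
by case: asboolP.
Qed.

Let measurable_point (a : 'rV[R]_dA) : measurable ([set a] : set (borel 'rV[R]_dA)).
Proof.
rewrite -(setCK [set a]); apply: measurableC; apply: sub_sigma_algebra.
apply: closed_openC; apply: accessible_closed_set1.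
by apply: hausdorff_accessible; exact: norm_hausdorff.
Qed.

Lemma iterated_le_oval z0 :
  (forall z : R, 0 <= z <= T%:R + 1 -> (f z <= (f' z)%:E)%E) ->
  forall k t (w : traj M t), (t + k = T)%N -> state M t (traj_state s0 w) ->
  0 <= traj_cost s0 w <= t%:R ->
  let z := grid_history z0 (traj_history w) in
  gap t (traj_state s0 w) (traj_cost s0 w) z <= radius t ->
  (iterated_integral Q (history_rule (grid_policy z0)) g k w
     <= (V k t z + G2 * radius T.+1)%:E)%E.
Proof.
move=> hf; elim=> [|k IH] t w htk hs hx z hgap /=.
  rewrite addn0 in htk; subst t.
  have ha : control M T (apt T (grid_action T z)) by exact: apt_control.
  apply: integral_dirac_le => //; first exact: measurable_control.
  apply: le_trans (hf _ (total_cost_itv (leqnn _) hs ha hx)) _.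
  rewrite lee_fin.
  have haa : enorm (apt T (grid_action T z) - apt T (grid_action T z)) <= eta.
    rewrite subrr; apply: enorm_le; first exact: ltW.
    by rewrite big1 ?sqr_ge0// => i _; rewrite mxE expr0n.
  have := cost_close (leqnn _) hs ha haa hgap.
  move=> /f'_close[h _]; apply: le_trans h _.
  by rewrite lerD2r /V/= /opt_terminal /terminal_cost /grid_action ltnn.
have tT : (t < T)%N by rewrite -htk addnS ltnS leq_addr.
have tT' := ltnW tT.
have ha : control M t (apt t (grid_action t z)) by exact: apt_control.
apply: integral_dirac_le => //; first exact: measurable_control.
have haa : enorm (apt t (grid_action t z) - apt t (grid_action t z)) <= eta.
  rewrite subrr; apply: enorm_le; first exact: ltW.
  by rewrite big1 ?sqr_ge0// => i _; rewrite mxE expr0n.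
pose v k' := V k t.+1 (grid_step t z (grid_action t z) k') + G2 * radius T.+1.
apply: (@le_trans _ _ (pmean pmf t v)%:E).
  apply: pmean_kappa_ge => xi.
  have [h1 h2 h3] := state_close xi tT hs ha haa hx hgap.
  by apply: IH => //=; rewrite addSnnS.
rewrite lee_fin /v pmean_addr lerD2r /grid_action tT /greedy /V.
have -> : (T - t.+1 = k)%N by rewrite -htk addnS subSS addnC addnK.
by [].
Qed.

End OptimalValue.

Section MarkovValue.
Variable a0 : AI.
Variables (pi : @markov_policy R dS dA) (Lpi b B : R).
Hypotheses (pi_adm : markov_admissible M T pi) (Lpi_ge0 : 0 <= Lpi).
Hypothesis pi_lip : markov_lipschitz M T Lpi pi.
Hypotheses (B_ge0 : 0 <= B) (f'_itv : forall z, b <= f' z <= b + B).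

Definition action_law (t : nat) (s : 'rV[R]_dS) (x : R) (a : AI) : R :=
  fine (pi t (s, x) (control M t `&` [set u | aproj t u = a])).

(** After the horizon a point mass at [a0] stands in, so that the weights sum to 1 at every stage,
    as the finite model demands. *)
Definition grid_law (t : nat) (z : grid_state) (a : AI) : R :=
  if (t <= T)%N then action_law t (spt t z.1) (xpt t z.2) a else (a == a0)%:R.

Let pi_fin t s (x : R) : (t <= T)%N -> state M t s -> 0 <= x <= t%:R ->
  (pi t (s, x) (control M t) < +oo)%E.
Proof. by move=> tT hs hx; rewrite pi_adm// ltry. Qed.

Lemma action_law_sum t s (x : R) : (t <= T)%N -> state M t s -> 0 <= x <= t%:R ->
  \sum_a action_law t s x a = 1.
Proof.
move=> tT hs hx; transitivity (fine (pi t (s, x) (control M t))).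
  exact: (sum_fine_partition (measurable_control tT) (fmeasurable_aproj tT)
    (pi_fin tT hs hx)).
by rewrite pi_adm.
Qed.

Lemma grid_law_ge0 t z a : 0 <= grid_law t z a.
Proof.
rewrite /grid_law; case: ifP => _; last by rewrite ler0n.
by apply: fine_ge0; exact: measure_ge0.
Qed.

Lemma grid_law_sum t z : \sum_a grid_law t z a = 1.
Proof.
rewrite /grid_law; case: leqP => tT.
  by apply: action_law_sum => //; [exact: spt_state|exact: xpt_itv].
rewrite (bigD1 a0)//= eqxx big1 ?addr0// => a /negPf ->//.
Qed.

Definition markov_terminal (z : grid_state) : R :=
  \sum_a grid_law T z a * terminal_cost z a.

Let average_itv t z (v : AI -> R) : (forall a, b <= v a <= b + B) ->
  b <= \sum_a grid_law t z a * v a <= b + B.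
Proof.
move=> hv; rewrite -[X in X <= _ <= _]mul1r -[X in _ <= _ <= X]mul1r.
rewrite -(grid_law_sum t z) !mulr_suml; apply/andP; split;
  by apply: ler_sum => a _; apply: ler_wpM2l; rewrite ?grid_law_ge0//;
  have /andP[] := hv a.
Qed.

(** Values lie in an interval of length B, so moving the policy to the grid state costs B times an
    l1-distance. [l1dist_finite_sum] is one-sided, whence its two uses. *)
Let action_law_close t s (x : R) z (v : AI -> R) : (t <= T)%N -> state M t s ->
  0 <= x <= t%:R -> gap t s x z <= radius t -> (forall a, b <= v a <= b + B) ->
  `|\sum_a action_law t s x a * v a - \sum_a grid_law t z a * v a|
    <= B * Lpi * radius T.+1.
Proof.
move=> tT hs hx hgap hv.
have hz := spt_state z.1 tT; have hxz := xpt_itv t z.2.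
have gle : enorm (row_mx (s - spt t z.1) (x - xpt t z.2)%:M) <= radius T.+1.
  apply: le_trans (enorm_row_mx _ _) _; rewrite enorm_scalar.
  by apply: le_trans hgap _; apply: radius_mono; apply: leqW.
have d1 : (l1dist (kernel_law (pi t) (s, x))
    (kernel_law (pi t) (spt t z.1, xpt t z.2)) <= (Lpi * radius T.+1)%:E)%E.
  apply: le_trans (pi_lip tT hs hz hx hxz) _.
  by rewrite lee_fin ler_wpM2l.
have d2 : (l1dist (kernel_law (pi t) (spt t z.1, xpt t z.2))
    (kernel_law (pi t) (s, x)) <= (Lpi * radius T.+1)%:E)%E.
  apply: le_trans (pi_lip tT hz hs hxz hx) _.
  rewrite lee_fin ler_wpM2l//; apply: le_trans (enorm_row_mx _ _) _.
  rewrite enorm_scalar enorm_distC distrC.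
  by apply: le_trans hgap _; apply: radius_mono; apply: leqW.
have m1 : kernel_law (pi t) (s, x) (control M t) = 1%E := pi_adm tT hs hx.
have m2 : kernel_law (pi t) (spt t z.1, xpt t z.2) (control M t) = 1%E.
  exact: pi_adm.
have h1 := l1dist_finite_sum (measurable_control tT) (fmeasurable_aproj tT)
  m1 m2 d1 B_ge0 hv.
have h2 := l1dist_finite_sum (measurable_control tT) (fmeasurable_aproj tT)
  m2 m1 d2 B_ge0 hv.
rewrite /grid_law tT ler_norml.
have {}h1 : \sum_a action_law t s x a * v a <=
  \sum_a action_law t (spt t z.1) (xpt t z.2) a * v a + B * (Lpi * radius T.+1) := h1.
have {}h2 : \sum_a action_law t (spt t z.1) (xpt t z.2) a * v a <=
  \sum_a action_law t s x a * v a + B * (Lpi * radius T.+1) := h2.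
by move: h1 h2; lra.
Qed.

Let V k t z := pval grid_step grid_law markov_terminal (pmeans pmf k t) t z.

Let markov_terminal_itv z : b <= markov_terminal z <= b + B.
Proof. by apply: average_itv => a; exact: f'_itv. Qed.

Let V_itv k t z : b <= V k t z <= b + B.
Proof.
exact: (pval_itv grid_step pmf_ge0 pmf_sum grid_law_ge0 grid_law_sum markov_terminal_itv).
Qed.

Let average_addr t s (x : R) (v : AI -> R) d : (t <= T)%N -> state M t s ->
  0 <= x <= t%:R ->
  \sum_a action_law t s x a * (v a + d) = \sum_a action_law t s x a * v a + d.
Proof.
move=> tT hs hx; rewrite -[in RHS](mul1r d) -(action_law_sum tT hs hx).
by rewrite mulr_suml -big_split/=; apply: eq_bigr => a _; ring.
Qed.

Let step_value_itv k t z a :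
  b <= pmean pmf t (fun k' => V k t.+1 (grid_step t z a k')) <= b + B.
Proof.
have hb d : pmean pmf t (fun=> 0 + d) = d.
  by rewrite (pmean_addr t (fun=> 0) d) /pmean big1 ?add0r// => ? _; rewrite mulr0.
rewrite -[X in X <= _ <= _]hb -[X in _ <= _ <= X]hb.
apply/andP; split; apply: (pmean_le pmf_ge0) => k'; rewrite add0r;
  by have /andP[] := V_itv k t.+1 (grid_step t z a k').
Qed.

(** The policy error is paid at each of the k + 1 stages from t to T, the terminal error G2 radius
    only once. *)
Lemma pval_le_iterated :
  (forall z : R, 0 <= z <= T%:R + 1 -> ((f' z - c)%:E <= f z)%E) ->
  forall k t (w : traj M t) z, (t + k = T)%N -> state M t (traj_state s0 w) ->
  0 <= traj_cost s0 w <= t%:R ->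
  gap t (traj_state s0 w) (traj_cost s0 w) z <= radius t ->
  ((V k t z - c - G2 * radius T.+1 - B * Lpi * radius T.+1 * k.+1%:R)%:E
     <= iterated_integral Q (markov_rule pi s0) g k w)%E.
Proof.
move=> hf; elim=> [|k IH] t w z htk hs hx hgap /=.
  rewrite addn0 in htk; subst t.
  have := integral_ge_finite (mu := pi T (traj_state s0 w, traj_cost s0 w))
    (v := fun a => terminal_cost z a + (- c - G2 * radius T.+1))
    (g := fun a => g w a)
    (measurable_control (leqnn T)) (fmeasurable_aproj (leqnn T))
    (pi_fin (leqnn T) hs hx) _.
  move=> h; apply: le_trans (h _); last first.
    move=> a ha; apply: le_trans (hf _ (total_cost_itv (leqnn _) hs ha hx)).
    rewrite lee_fin.
    have := cost_close (leqnn _) hs ha (aproj_close (leqnn _) ha) hgap.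
    by move=> /f'_close[_]; rewrite /terminal_cost; lra.
  rewrite lee_fin (average_addr (terminal_cost z) _ (leqnn _) hs hx).
  have := action_law_close (v := terminal_cost z) (leqnn _) hs hx hgap
    (fun a => f'_itv _).
  by rewrite /V/= /markov_terminal ler_norml mulr1; lra.
have tT : (t < T)%N by rewrite -htk addnS ltnS leq_addr.
have tT' := ltnW tT.
pose v a := pmean pmf t (fun k' => V k t.+1 (grid_step t z a k')).
pose C := - c - G2 * radius T.+1 - B * Lpi * radius T.+1 * k.+1%:R.
have := integral_ge_finite (mu := pi t (traj_state s0 w, traj_cost s0 w))
  (v := fun a => v a + C)
  (g := fun a => (\int[Q t]_xi iterated_integral Q (markov_rule pi s0) g k
     (t := t.+1) (w, (a, xi)))%E)
  (measurable_control tT') (fmeasurable_aproj tT') (pi_fin tT' hs hx) _.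
move=> h; apply: le_trans (h _); last first.
  move=> a ha; rewrite /v -pmean_addr; apply: pmean_kappa_le => xi.
  have [h1 h2 h3] := state_close xi tT hs ha (aproj_close tT' ha) hx hgap.
  rewrite /C !addrA; apply: IH => //; by rewrite addSnnS.
rewrite lee_fin (average_addr v _ tT' hs hx).
have := action_law_close (v := v) tT' hs hx hgap (step_value_itv k t z).
have -> : V k.+1 t z = \sum_a grid_law t z a * v a by [].
have -> : k.+2%:R = k.+1%:R + 1 :> R by rewrite natr1.
by rewrite ler_norml /C; lra.
Qed.

Lemma iterated_le_pval :
  (forall z : R, 0 <= z <= T%:R + 1 -> (f z <= (f' z)%:E)%E) ->
  forall k t (w : traj M t) z, (t + k = T)%N -> state M t (traj_state s0 w) ->
  0 <= traj_cost s0 w <= t%:R ->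
  gap t (traj_state s0 w) (traj_cost s0 w) z <= radius t ->
  (iterated_integral Q (markov_rule pi s0) g k w <=
   (V k t z + G2 * radius T.+1 + B * Lpi * radius T.+1 * k.+1%:R)%:E)%E.
Proof.
move=> hf; elim=> [|k IH] t w z htk hs hx hgap /=.
  rewrite addn0 in htk; subst t.
  have := integral_le_finite (mu := pi T (traj_state s0 w, traj_cost s0 w))
    (v := fun a => terminal_cost z a + G2 * radius T.+1)
    (g := fun a => g w a)
    (measurable_control (leqnn T)) (fmeasurable_aproj (leqnn T))
    (pi_fin (leqnn T) hs hx) _.
  move=> h; apply: (le_trans (h _)).
    move=> a ha; apply: le_trans (hf _ (total_cost_itv (leqnn _) hs ha hx)) _.
    rewrite lee_fin.
    have := cost_close (leqnn _) hs ha (aproj_close (leqnn _) ha) hgap.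
    by move=> /f'_close[+ _]; rewrite /terminal_cost; lra.
  rewrite lee_fin (average_addr (terminal_cost z) _ (leqnn _) hs hx).
  have := action_law_close (v := terminal_cost z) (leqnn _) hs hx hgap
    (fun a => f'_itv _).
  by rewrite /V/= /markov_terminal ler_norml mulr1; lra.
have tT : (t < T)%N by rewrite -htk addnS ltnS leq_addr.
have tT' := ltnW tT.
pose v a := pmean pmf t (fun k' => V k t.+1 (grid_step t z a k')).
pose C := G2 * radius T.+1 + B * Lpi * radius T.+1 * k.+1%:R.
have := integral_le_finite (mu := pi t (traj_state s0 w, traj_cost s0 w))
  (v := fun a => v a + C)
  (g := fun a => (\int[Q t]_xi iterated_integral Q (markov_rule pi s0) g k
     (t := t.+1) (w, (a, xi)))%E)
  (measurable_control tT') (fmeasurable_aproj tT') (pi_fin tT' hs hx) _.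
move=> h; apply: (le_trans (h _)).
  move=> a ha; rewrite /v -pmean_addr; apply: pmean_kappa_ge => xi.
  have [h1 h2 h3] := state_close xi tT hs ha (aproj_close tT' ha) hx hgap.
  rewrite /C !addrA; apply: IH => //; by rewrite addSnnS.
rewrite lee_fin (average_addr v _ tT' hs hx).
have := action_law_close (v := v) tT' hs hx hgap (step_value_itv k t z).
have -> : V k.+1 t z = \sum_a grid_law t z a * v a by [].
have -> : k.+2%:R = k.+1%:R + 1 :> R by rewrite natr1.
by rewrite ler_norml /C; lra.
Qed.

End MarkovValue.
End Terminal.
End Measures.

Section EmpiricalMeasure.
Context {d : measure_display} {Omega : measurableType d}.
Variables (n : nat) (X : forall t, nat -> Omega -> noise M t).
Hypothesis n_gt0 : (0 < n)%N.

Let empiricalE omega t (B : set (borel (noise M t))) :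
  empirical n X omega t B = (n%:R^-1 * \sum_(i < n) (\1_B (X t i omega) : R))%:E.
Proof.
by rewrite /empirical /= /mscale /= /msum EFinM -sumEFin.
Qed.

Lemma empiricalT omega t : empirical n X omega t setT = 1%E.
Proof.
rewrite empiricalE (eq_bigr (fun=> 1)) => [|i _]; last by rewrite indicT.
by rewrite sumr_const card_ord mulVf// pnatr_eq0 -lt0n.
Qed.

(** Identifies the discretization of the empirical problem with the sampled value of the finite
    model, so that one comparison with integrals serves both problems. *)
Lemma pmeans_empirical omega m t :
  pmeans (pmf (empirical n X omega)) m t
    = map (@avg _ _ n) (layers n X (@kappa) m t omega).
Proof.
rewrite /pmeans /layers -map_comp; apply: eq_map => u /=.
apply: funext => W; rewrite /pmean /avg.
under eq_bigr do rewrite /pmf empiricalE/= -mulrA mulr_suml.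
rewrite -mulr_sumr exchange_big/=; congr (_ * _); apply: eq_bigr => i _.
rewrite ffunE (bigD1 (kappa (X u i omega)))//= big1 ?addr0 => [|k hk].
  by rewrite indicE mem_set// mul1r.
by rewrite indicE memNset ?mul0r//= => e; rewrite e eqxx in hk.
Qed.

End EmpiricalMeasure.

(** * A priori bounds on the risks *)

Section CrudeBounds.
Variable Q : forall t, {measure set (borel (noise M t)) -> \bar R}.
Hypothesis Q1 : forall t, Q t setT = 1%E.
Variables (s0 : 'rV[R]_dS) (ru : rule M).
Hypothesis s0_state : state M 0 s0.
Hypothesis ru1 : forall t (w : traj M t), (t <= T)%N ->
  state M t (traj_state s0 w) -> 0 <= traj_cost s0 w <= t%:R ->
  ru w (control M t) = 1%E.

(** The relation [le] stands for either order, so that both bounds share one induction. *)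
Let expectation_cst (f : R -> \bar R) (c : R) (le : \bar R -> \bar R -> Prop) :
  (forall (d : measure_display) (Y : measurableType d)
     (mu : {measure set Y -> \bar R}) (D : set Y) (h : Y -> \bar R),
     measurable D -> mu D = 1%E -> (forall y, D y -> le c%:E (h y)) ->
     le c%:E (\int[mu]_(y in D) h y)%E) ->
  (forall z : R, 0 <= z <= T%:R + 1 -> le c%:E (f z)) ->
  le c%:E (soc_expectation T Q ru s0 f).
Proof.
move=> hle hf; rewrite /soc_expectation.
suff : forall k t (w : traj M t), (t + k = T)%N -> state M t (traj_state s0 w) ->
    0 <= traj_cost s0 w <= t%:R -> le c%:E (iterated_integral Q ru
      (fun t w a => f (traj_cost s0 w + cost M t (traj_state s0 w) a)) k w).
  by move=> h; apply: (h T 0%N tt) => //=; rewrite lexx.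
elim=> [|k IH] t w htk hs hx /=.
  rewrite addn0 in htk; subst t.
  apply: (hle); [exact: measurable_control|exact: ru1|move=> a ha; apply: hf].
  by have := cost_itv wf (leqnn T) hs ha; move: hx; lra.
have tT : (t < T)%N by rewrite -htk addnS ltnS leq_addr.
have tT' := ltnW tT.
apply: (hle); [exact: measurable_control|exact: ru1|move=> a ha].
apply: (hle); [exact: measurableT|exact: Q1|move=> xi _]; apply: IH => /=; first by rewrite addSnnS.
  exact: (trans_state wf).
by rewrite -natr1; have := cost_itv wf tT' hs ha; move: hx; lra.
Qed.

(** Below, the conjugate is above the identity and costs are nonnegative; above, lambda = 0 and mu =
    T + 1 make all arguments nonpositive. This gives finiteness and settles large eps. *)
Lemma risk_itv (phi : R -> \bar R) (tau : R) : divergence_function phi -> 0 < tau ->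
  (0 <= risk T phi tau Q ru s0 <= (T%:R + 1)%:E)%E.
Proof.
move=> Hphi tau0; apply/andP; split.
  apply: le_ereal_inf_tmp => _ [lambda [mu [l0 ->]]].
  have h := @expectation_cst (fun z => conjugate (scaled lambda phi) (z - mu))
    (- mu) (fun x y => (x <= y)%E).
  have {}h : ((- mu)%:E <= soc_expectation T Q ru s0
      (fun z => conjugate (scaled lambda phi) (z - mu)))%E.
    apply: h => [d Y nu D h mD D1 hh|z hz]; first exact: integral_ge_cst.
    apply: le_trans (conjugate_ge_id Hphi _ _); rewrite lee_fin; move: hz; lra.
  apply: le_trans (leeD2l (lambda * tau + mu)%:E h).
  by rewrite -EFinD lee_fin addrK mulr_ge0// ltW.
have h := @expectation_cst (fun z => conjugate (scaled 0 phi) (z - (T%:R + 1)))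
  0 (fun x y => (y <= x)%E).
have {}h : (soc_expectation T Q ru s0
      (fun z => conjugate (scaled 0 phi) (z - (T%:R + 1))) <= 0%:E)%E.
  apply: h => [d Y nu D h mD D1 hh|z hz]; first exact: integral_le_cst.
  by apply: (conjugate_le0 Hphi) => //; move: hz; lra.
apply: (@le_trans _ _ ((0 * tau + (T%:R + 1))%:E + 0%:E)%E).
  apply: le_trans (leeD2l _ h).
  by apply: ereal_inf_lbound; exists 0, (T%:R + 1).
by rewrite mul0r add0r -EFinD addr0.
Qed.

End CrudeBounds.

Section CrudeRisks.
Variable Q : forall t, {measure set (borel (noise M t)) -> \bar R}.
Hypothesis Q1 : forall t, Q t setT = 1%E.
Variables (phi : R -> \bar R) (tau : R) (s0 : 'rV[R]_dS).
Hypotheses (Hphi : divergence_function phi) (tau_gt0 : 0 < tau).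
Hypothesis s0_state : state M 0 s0.

Lemma markov_risk_itv (pi : @markov_policy R dS dA) : markov_admissible M T pi ->
  (0 <= markov_risk T phi tau Q pi s0 <= (T%:R + 1)%:E)%E.
Proof. by move=> pi_adm; apply: risk_itv => // t w tT hs hx; exact: pi_adm. Qed.

Lemma optimal_risk_itv : (0 <= optimal_risk T phi tau Q s0 <= (T%:R + 1)%:E)%E.
Proof.
pose act t : borel 'rV[R]_dA := xget 0 (control M t).
have mact t : measurable_fun [set: history M t] (fun=> act t).
  exact: measurable_cst.
pose pi : history_policy M :=
  fun t => [the R.-pker (history M t) ~> borel 'rV[R]_dA of kdirac (mact t)].
have pi_adm : history_admissible T pi.
  move=> t h tT; rewrite /pi/= /kdirac diracE mem_set//.
  by have [a ha] := control_neq0 wf tT; exact: (xgetPex 0 (ex_intro _ a ha)).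
apply/andP; split.
  apply: le_ereal_inf_tmp => _ [pi' pi'_adm <-].
  have := @risk_itv Q Q1 s0 (history_rule pi') s0_state
    (fun t w tT _ _ => pi'_adm t _ tT) phi tau Hphi tau_gt0.
  by case/andP.
apply: (@le_trans _ _ (risk T phi tau Q (history_rule pi) s0)).
  by apply: ereal_inf_lbound; exists pi.
have := @risk_itv Q Q1 s0 (history_rule pi) s0_state
  (fun t w tT _ _ => pi_adm t _ tT) phi tau Hphi tau_gt0.
by case/andP.
Qed.

End CrudeRisks.

(** * Risks as minima over the dual grid *)

Section RiskSandwich.
Variables (phi : R -> \bar R) (tau eps : R).
Hypothesis Hphi : divergence_function phi.
Hypotheses (T_gt0 : (0 < T)%N) (tau_gt0 : 0 < tau) (eps_gt0 : 0 < eps).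

Let size := grid_size T eps.
Let F k l := grid_fun phi T tau eps k l.
Let cost0 k l := grid_cost tau eps k l.
Let G2 := 2 * growth_inv phi (16 * T%:R * tau / eps).
Let B := (T%:R + 1) * G2.

Let G2_ge0 : 0 <= G2.
Proof. by have := growth_inv_ge1 Hphi (16 * T%:R * tau / eps); rewrite /G2; lra. Qed.

Let B_ge0 : 0 <= B. Proof. by rewrite mulr_ge0// addr_ge0. Qed.

(** Says that [r] is close to the minimum of [cost0 + W] over the grid, without writing the minimum.
    The loss eps / 4 of the dual grid affects the lower half only, as grid points are feasible. *)
Definition sandwiched (err : R) (W : nat -> nat -> R) (r : \bar R) : Prop :=
  (forall k l, (k < size)%N -> (l < size)%N ->
     (r <= (cost0 k l + W k l + err)%:E)%E) /\
  (forall m, (forall k l, (k < size)%N -> (l < size)%N -> m <= cost0 k l + W k l) ->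
     ((m - err - eps / 4)%:E <= r)%E).

Lemma sandwiched_close err e W W' r r' : r \is a fin_num -> r' \is a fin_num ->
  sandwiched err W r -> sandwiched err W' r' ->
  (forall k l, (k < size)%N -> (l < size)%N -> `|W k l - W' k l| <= e) ->
  (`|r - r'| <= (2 * err + e + eps / 4)%:E)%E.
Proof.
move=> rfin r'fin [u lo] [u' lo'] h.
rewrite -(fineK rfin) -(fineK r'fin) -EFinB abse_EFin lee_fin ler_norml.
rewrite -(fineK rfin) in u lo; rewrite -(fineK r'fin) in u' lo'.
have {}u k l hk hl := u k l hk hl; have {}u' k l hk hl := u' k l hk hl.
have h1 : fine r' - err - e - err - eps / 4 <= fine r.
  rewrite -lee_fin; apply: lo => k l hk hl.
  by have := u' k l hk hl; have := h k l hk hl; rewrite lee_fin ler_norml; lra.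
have h2 : fine r - err - e - err - eps / 4 <= fine r'.
  rewrite -lee_fin; apply: lo' => k l hk hl.
  by have := u k l hk hl; have := h k l hk hl; rewrite lee_fin ler_norml; lra.
lra.
Qed.

Section OneMeasure.
Variable Q : forall t, {measure set (borel (noise M t)) -> \bar R}.

Lemma risk_upper ru s0 k l w :
  (soc_expectation T Q ru s0 (fun z => conjugate (scaled (grid_lambda tau eps k) phi)
     (z - grid_mu eps l)) <= w%:E)%E ->
  (risk T phi tau Q ru s0 <= (cost0 k l + w)%:E)%E.
Proof.
move=> h; apply: (@le_trans _ _ ((grid_lambda tau eps k * tau + grid_mu eps l)%:E
  + soc_expectation T Q ru s0 (fun z => conjugate
     (scaled (grid_lambda tau eps k) phi) (z - grid_mu eps l)))%E).
  apply: ereal_inf_lbound; exists (grid_lambda tau eps k), (grid_mu eps l).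
  split => //; rewrite /grid_lambda mulr_ge0// divr_ge0 ?(ltW eps_gt0)//.
  by rewrite mulr_ge0// ltW.
by rewrite (EFinD (cost0 k l)) leeD2l.
Qed.

Lemma risk_lower ru s0 err W :
  (forall k l c f, (forall z : R, 0 <= z <= T%:R + 1 -> ((F k l z - c)%:E <= f z)%E) ->
     ((W k l - c - err)%:E <= soc_expectation T Q ru s0 f)%E) ->
  forall m, (forall k l, (k < size)%N -> (l < size)%N -> m <= cost0 k l + W k l) ->
     ((m - err - eps / 4)%:E <= risk T phi tau Q ru s0)%E.
Proof.
move=> h m hm; apply: le_ereal_inf_tmp => _ [lambda [mu [l0 ->]]].
have [k [l [hk hl hz]]] := grid_dominates Hphi T_gt0 tau_gt0 eps_gt0 mu l0.
(* The shift that turns the conclusion of [grid_dominates] into the hypothesis on [f]. *)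
pose c := lambda * tau + mu + eps / 4 - cost0 k l.
have := h k l c (fun z => conjugate (scaled lambda phi) (z - mu)).
move=> /(_ _)/(leeD2l (lambda * tau + mu)%:E); rewrite -EFinD => h'.
apply: le_trans (h' _).
  rewrite lee_fin; have := hm k l hk hl; rewrite /c; lra.
move=> z /hz; apply: le_trans; rewrite lee_fin /c /F /cost0; lra.
Qed.

Hypothesis Q1 : forall t, Q t setT = 1%E.

Let start (s0 : 'rV[R]_dS) : grid_state := (sproj 0 s0, ord0).

Let gap0 s0 : state M 0 s0 -> gap 0 s0 0 (start s0) <= radius 0.
Proof.
move=> hs; rewrite /gap /radius expr0 mul1r.
have -> : xpt 0 (start s0).2 = 0.
  by apply/eqP; rewrite eq_le; have /andP[-> ->] := xpt_itv 0 (start s0).2.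
by rewrite subrr normr0 addr0 sproj_close.
Qed.

Let x0 : ((0 : R) <= 0) && ((0 : R) <= 0%:R). Proof. by rewrite lexx. Qed.

Section Markov.
Variables (a0 : AI) (pi : @markov_policy R dS dA) (Lpi : R).
Hypotheses (pi_adm : markov_admissible M T pi) (Lpi_ge0 : 0 <= Lpi).
Hypothesis pi_lip : markov_lipschitz M T Lpi pi.

Definition markov_value k l (E : seq ((grid_noise -> R) -> R)) (j : SI) : R :=
  pval grid_step (grid_law a0 pi) (markov_terminal (F k l) a0 pi) E 0 (j, ord0).

Lemma markov_sandwiched err s0 : state M 0 s0 ->
  G2 * radius T.+1 + B * Lpi * radius T.+1 * T.+1%:R <= err ->
  sandwiched err (fun k l => markov_value k l (pmeans (pmf Q) T 0) (sproj 0 s0))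
    (markov_risk T phi tau Q pi s0).
Proof.
move=> hs herr; split.
  move=> k l _ _; rewrite -addrA; apply: risk_upper.
  have := iterated_le_pval Q1 G2_ge0 (grid_fun_lipschitz Hphi T_gt0 tau_gt0 eps_gt0 k l)
    a0 pi_adm Lpi_ge0 pi_lip B_ge0
    (grid_fun_itv Hphi T_gt0 tau_gt0 eps_gt0 k l)
    (f := fun z => conjugate (scaled (grid_lambda tau eps k) phi) (z - grid_mu eps l))
    (s0 := s0) _ (k := T) (t := 0%N) (w := tt) (z := start s0) (add0n T) hs x0 (gap0 hs).
  move=> h; apply: le_trans (h _) _.
    by move=> z hz; rewrite (grid_funE Hphi T_gt0 tau_gt0 eps_gt0 k l hz).
  rewrite lee_fin -addrA lerD2l; exact: herr.
apply: risk_lower => k l c f hf.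
have := pval_le_iterated Q1 G2_ge0 (grid_fun_lipschitz Hphi T_gt0 tau_gt0 eps_gt0 k l)
    a0 pi_adm Lpi_ge0 pi_lip B_ge0
    (grid_fun_itv Hphi T_gt0 tau_gt0 eps_gt0 k l) hf
    (s0 := s0) (k := T) (t := 0%N) (w := tt) (z := start s0) (add0n T) hs x0 (gap0 hs).
apply: le_trans; rewrite lee_fin; move: herr.
rewrite /markov_value /start; set V := pval _ _ _ _ _ _; lra.
Qed.

End Markov.

Section Optimal.
Variable a0 : AI.

Definition optimal_value k l (E : seq ((grid_noise -> R) -> R)) (j : SI) : R :=
  oval grid_step a0 (opt_terminal (F k l) a0) E 0 (j, ord0).

Lemma optimal_sandwiched err s0 : state M 0 s0 -> G2 * radius T.+1 <= err ->
  sandwiched err (fun k l => optimal_value k l (pmeans (pmf Q) T 0) (sproj 0 s0))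
    (optimal_risk T phi tau Q s0).
Proof.
move=> hs herr; split.
  move=> k l _ _; rewrite -addrA.
  apply: (@le_trans _ _ (risk T phi tau Q
    (history_rule (grid_policy Q (F k l) a0 (start s0))) s0)).
    apply: ereal_inf_lbound; exists (grid_policy Q (F k l) a0 (start s0)) => //.
    exact: grid_policy_admissible.
  apply: risk_upper.
  have := iterated_le_oval Q1 G2_ge0 (grid_fun_lipschitz Hphi T_gt0 tau_gt0 eps_gt0 k l)
    (a0 := a0)
    (f := fun z => conjugate (scaled (grid_lambda tau eps k) phi) (z - grid_mu eps l))
    (s0 := s0) (z0 := start s0) _ (k := T) (t := 0%N) (w := tt) (add0n T) hs x0 (gap0 hs).
  move=> h; apply: le_trans (h _) _.
    by move=> z hz; rewrite (grid_funE Hphi T_gt0 tau_gt0 eps_gt0 k l hz).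
  rewrite lee_fin lerD2l; exact: herr.
move=> m hm; apply: le_ereal_inf_tmp => _ [pi pi_adm <-].
apply: risk_lower m hm => k l c f hf.
have := oval_le_iterated Q1 G2_ge0 (grid_fun_lipschitz Hphi T_gt0 tau_gt0 eps_gt0 k l)
    a0 (ru := history_rule pi) _ hf
    (s0 := s0) (k := T) (t := 0%N) (w := tt) (z := start s0) (add0n T) hs x0 (gap0 hs).
move=> h; apply: le_trans (h _); last by move=> t w tT; exact: pi_adm.
rewrite lee_fin; move: herr.
rewrite /optimal_value /start; set V := oval _ _ _ _ _ _; lra.
Qed.

End Optimal.
End OneMeasure.

(** * Union bound over the dual grid and the initial states *)

Section Concentration.
Variables (n : nat) (P : forall t, probability (borel (noise M t)) R).
Context {d : measure_display} {Omega : measurableType d}.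
Variables (Pr : probability Omega R) (X : forall t, nat -> Omega -> noise M t).
Hypotheses (n_gt0 : (0 < n)%N) (iid : iid_samples T n P Pr X).

Let p := pmf (fun t => P t).
Let P1 t : P t setT = 1%E. Proof. exact: probability_setT. Qed.
Let p_ge0 t k : 0 <= p t k. Proof. exact: pmf_ge0. Qed.
Let p_sum t : \sum_k p t k = 1. Proof. exact: (pmf_sum P1). Qed.

Variable value : nat -> nat -> seq ((grid_noise -> R) -> R) -> SI -> R.
Variable r : (forall t, {measure set (borel (noise M t)) -> \bar R}) ->
  'rV[R]_dS -> \bar R.
Variables (err e delta : R).
Hypothesis r_sandwiched : forall Q : (forall t, {measure set (borel (noise M t)) -> \bar R}),
  (forall t, Q t setT = 1%E) -> forall s,
  state M 0 s ->
  sandwiched err (fun k l => value k l (pmeans (pmf Q) T 0) (sproj 0 s)) (r Q s).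
Hypothesis r_fin : forall Q : (forall t, {measure set (borel (noise M t)) -> \bar R}),
  (forall t, Q t setT = 1%E) -> forall s,
  state M 0 s -> r Q s \is a fin_num.
Hypotheses (e_ge0 : 0 <= e) (delta_ge0 : 0 <= delta).

Let close omega := forall s, state M 0 s ->
  (`|r (empirical n X omega) s - r (fun t => P t) s|
    <= (2 * err + e + eps / 4)%:E)%E.

Let close_of_value omega :
  (forall k l j, (k < size)%N -> (l < size)%N ->
     `|value k l (map (@avg _ _ n) (layers n X (@kappa) T 0 omega)) j
       - value k l (pmeans p T 0) j| <= e) -> close omega.
Proof.
move=> h s hs; have E1 := empiricalT X n_gt0 omega.
apply: (sandwiched_close (r_fin E1 hs) (r_fin P1 hs)
  (r_sandwiched E1 hs) (r_sandwiched P1 hs)) => k l hk hl.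
by rewrite pmeans_empirical; exact: h.
Qed.

(** The count is that of the pairs of dual indices, the initial net points and the two tails. The
    accumulated cost starts at 0, so the initial grid state varies in [SI] only. *)
Lemma concentration x :
  (forall k l j, sample_mean (n := n) p T 0 (fun L =>
     (value k l (pmeans p T 0) j + e <= value k l (map (@avg _ _ n) L) j)%R%:R) <= x) ->
  (forall k l j, sample_mean (n := n) p T 0 (fun L =>
     (value k l (map (@avg _ _ n) L) j < value k l (pmeans p T 0) j - e)%R%:R) <= x) ->
  (size ^ 2 * #|SI| * 2)%:R * x <= delta ->
  with_probability_ge Pr (1 - delta) close.
Proof.
move=> up lo hx.
pose bad (i : 'I_size * 'I_size * SI * bool) (L : seq {ffun 'I_n -> grid_noise}) :=
  let: (k, l, j, b) := i in
  if b then value k l (pmeans p T 0) j + e <= value k l (map (@avg _ _ n) L) j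
  else value k l (map (@avg _ _ n) L) j < value k l (pmeans p T 0) j - e.
apply: (with_probability_layers (kp := @kappa) iid fmeasurable_kappa
  (G := fun L => [forall i, ~~ bad i L])).
  apply: le_trans hx; have := @sample_mean_union _ _ p p_ge0 n _ T 0%N bad x.
  rewrite !card_prod !card_ord card_bool mulnn; apply.
  by move=> [[[k l] j] [|]]; [exact: up|exact: lo].
move=> omega /forallP h; apply: close_of_value => k l j hk hl.
have h1 := h (Ordinal hk, Ordinal hl, j, true).
have h2 := h (Ordinal hk, Ordinal hl, j, false).
by move: h1 h2; rewrite /bad/= -ltNge -leNgt ler_norml; lra.
Qed.

Lemma deterministic_close :
  (forall k l (L : seq {ffun 'I_n -> grid_noise}) j,
     value k l (map (@avg _ _ n) L) j = value k l (pmeans p (seq.size L) 0) j) ->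
  with_probability_ge Pr (1 - delta) close.
Proof.
move=> h; apply: (with_probability_layers (kp := @kappa) iid fmeasurable_kappa
  (G := fun=> true)) => [|omega _].
  by rewrite (sample_mean_cst p_sum).
apply: close_of_value => k l j _ _.
by rewrite h /layers size_map size_iota subrr normr0.
Qed.

End Concentration.

Section MainBounds.
Variables (n : nat) (P : forall t, probability (borel (noise M t)) R).
Context {d : measure_display} {Omega : measurableType d}.
Variables (Pr : probability Omega R) (X : forall t, nat -> Omega -> noise M t).
Hypotheses (n_gt0 : (0 < n)%N) (iid : iid_samples T n P Pr X).
Variables (a0 : AI) (err e delta : R).
Hypotheses (e_gt0 : 0 < e) (e_le : e <= 2 * B) (delta_ge0 : 0 <= delta).

Let p := pmf (fun t => P t).
Let P1 t : P t setT = 1%E. Proof. exact: probability_setT. Qed.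
Let p_ge0 t k : 0 <= p t k. Proof. exact: pmf_ge0. Qed.
Let p_sum t : \sum_k p t k = 1. Proof. exact: (pmf_sum P1). Qed.
Let B_gt0 : 0 < B. Proof. by have := e_gt0; have := e_le; lra. Qed.

Let tail := expR (- (n%:R * (e ^+ 2 / (8 * B ^+ 2)))).

Lemma markov_concentration (pi : @markov_policy R dS dA) (Lpi : R) :
  markov_admissible M T pi -> 0 <= Lpi -> markov_lipschitz M T Lpi pi ->
  G2 * radius T.+1 + B * Lpi * radius T.+1 * T.+1%:R <= err ->
  (#|SI| = 1)%N \/ (size ^ 2 * #|SI| * 2)%:R * tail <= delta ->
  with_probability_ge Pr (1 - delta) (fun omega => forall s, state M 0 s ->
   (`|markov_risk T phi tau (empirical n X omega) pi s
      - markov_risk T phi tau (fun t => P t) pi s|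
     <= (2 * err + e + eps / 4)%:E)%E).
Proof.
move=> pi_adm Lpi0 pi_lip herr alt.
have sw (Q : forall t, {measure set (borel (noise M t)) -> \bar R})
  (Q1 : forall t, Q t setT = 1%E) s (hs : state M 0 s) :=
  markov_sandwiched Q1 a0 pi_adm Lpi0 pi_lip hs herr.
have fn (Q : forall t, {measure set (borel (noise M t)) -> \bar R})
  (Q1 : forall t, Q t setT = 1%E) s (hs : state M 0 s) :
    markov_risk T phi tau Q pi s \is a fin_num.
  have /andP[h1 h2] := markov_risk_itv Q1 Hphi tau_gt0 hs pi_adm.
  by rewrite ge0_fin_numE//; apply: le_lt_trans h2 _; rewrite ltry.
have q0 := grid_law_ge0 a0 pi; have q1 := grid_law_sum a0 pi_adm.
have mitv k l z : grid_fun phi T tau eps k l 0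
    <= markov_terminal (F k l) a0 pi z <= grid_fun phi T tau eps k l 0 + B.
  have hf a := grid_fun_itv Hphi T_gt0 tau_gt0 eps_gt0 k l
     (xpt T z.2 + cost M T (spt T z.1) (apt T a)).
  rewrite -[X in X <= _ <= _]mul1r -[X in _ <= _ <= X]mul1r.
  rewrite -(q1 T z) !mulr_suml; apply/andP; split;
    by apply: ler_sum => a _; apply: ler_wpM2l => //; have /andP[] := hf a.
case: alt => [card1|htail].
  apply: (deterministic_close n_gt0 iid sw fn (ltW e_gt0) delta_ge0) => k l ls j.
  apply: (pval_deterministic p_sum n_gt0) => t z a k1 k2.
  rewrite /grid_step; congr (_, _).
  have /fintype_le1P h : (#|SI| <= 1)%N by rewrite card1.
  exact: h.
apply: (concentration n_gt0 iid sw fn _ _ htail) => k l j.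
  exact: (pval_upper_tail grid_step p_ge0 p_sum n_gt0 q0 q1 (mitv k l) B_gt0).
apply: le_trans (pval_lower_tail grid_step p_ge0 p_sum n_gt0 q0 q1 T 0 (j, ord0)
  (mitv k l) e_gt0 e_le).
apply: sample_mean_le => // ls _; rewrite ler_nat /markov_value.
by case: (ltP (pval _ _ _ (map _ _) _ _)) => // /ltW ->.
Qed.

Lemma optimal_concentration : G2 * radius T.+1 <= err ->
  (#|SI| = 1)%N \/ (size ^ 2 * #|SI| * 2)%:R *
    (T%:R * (#|{: grid_state}|%:R * #|AI|%:R)
       * expR (- (n%:R * (e ^+ 2 / (8 * T%:R * B ^+ 2))))) <= delta ->
  with_probability_ge Pr (1 - delta) (fun omega => forall s, state M 0 s ->
   (`|optimal_risk T phi tau (empirical n X omega) s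
      - optimal_risk T phi tau (fun t => P t) s|
     <= (2 * err + e + eps / 4)%:E)%E).
Proof.
move=> herr alt.
have sw (Q : forall t, {measure set (borel (noise M t)) -> \bar R})
  (Q1 : forall t, Q t setT = 1%E) s (hs : state M 0 s) :=
  optimal_sandwiched Q1 a0 hs herr.
have fn (Q : forall t, {measure set (borel (noise M t)) -> \bar R})
  (Q1 : forall t, Q t setT = 1%E) s (hs : state M 0 s) :
    optimal_risk T phi tau Q s \is a fin_num.
  have /andP[h1 h2] := optimal_risk_itv Q1 Hphi tau_gt0 hs.
  by rewrite ge0_fin_numE//; apply: le_lt_trans h2 _; rewrite ltry.
have oitv k l z : grid_fun phi T tau eps k l 0
    <= opt_terminal (F k l) a0 z <= grid_fun phi T tau eps k l 0 + B.
  exact: (grid_fun_itv Hphi T_gt0 tau_gt0 eps_gt0 k l).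
case: alt => [card1|htail].
  apply: (deterministic_close n_gt0 iid sw fn (ltW e_gt0) delta_ge0) => k l ls j.
  apply: (oval_deterministic p_sum n_gt0) => t z a k1 k2.
  rewrite /grid_step; congr (_, _).
  have /fintype_le1P h : (#|SI| <= 1)%N by rewrite card1.
  exact: h.
apply: (concentration n_gt0 iid sw fn _ _ htail) => k l j; last first.
  exact: (oval_lower_tail grid_step p_ge0 p_sum n_gt0 a0 (oitv k l) B_gt0).
apply: le_trans (oval_upper_tail grid_step p_ge0 p_sum n_gt0 a0 (oitv k l) B_gt0 T
  (j, ord0) e_gt0 e_le) _.
have c1 : (0 < #|{: grid_state}|)%N by apply/card_gt0P; exists (j, ord0).
have c2 : (0 < #|AI|)%N by apply/card_gt0P; exists a0.
have T1 : (1 : R) <= T%:R by rewrite ler1n.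
(* The upper tail, better by a factor T in the exponent, is weakened to the form of the lower
   one. *)
apply: (@le_trans _ _ (1 * expR (- (n%:R * (e ^+ 2 / (8 * T%:R * B ^+ 2)))))).
  rewrite mul1r ler_expR lerN2 ler_wpM2l// ler_wpM2l ?sqr_ge0//.
  have B2 : 0 < B ^+ 2 by exact: exprn_gt0.
  have T0 : (0 : R) < 8 * T%:R by rewrite mulr_gt0// ltr0n.
  have T8 : (0 : R) < 8 by [].
  rewrite lef_pV2 ?posrE; [|exact: mulr_gt0 T0 B2|exact: mulr_gt0 T8 B2].
  by apply: ler_wpM2r; [exact: ltW|lra].
apply: ler_wpM2r; first exact: expR_ge0.
by rewrite mulr_ege1// mulr_ege1// ler1n.
Qed.

End MainBounds.
End RiskSandwich.
End Discretization.

(** * The sample size *)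

Section SampleSize.
Context {R : realType} (rad kappa : R).
Hypotheses (rad_gt0 : 0 < rad) (kappa_gt0 : 0 < kappa).

(* Each of T / eps, L, Lpi, G and 1 / delta is at most scale0 times the argument
   of the logarithm, because the other factors are bounded below.  In
   sample_constant, b ^ (24 T D) bounds the number of events in the union bound,
   where b = scale1 * exp (max (1, log)), and 8 * 16 * 16 is the inverse of the
   numerical factor in (eps / 4) ^ 2 / (8 (4 T G) ^ 2). *)
Definition kappa1 := Num.min kappa 1.
Definition scale0 := 2 / kappa1 ^+ 3.
Definition scale1 := 14 * expR 1 * (1 + rad) * scale0.
Definition sample_constant := 24 * (8 * 16 * 16) * (ln scale1 + 1).

Let kappa1_gt0 : 0 < kappa1. Proof. by rewrite lt_min kappa_gt0 ltr01. Qed.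
Let kappa1_le1 : kappa1 <= 1. Proof. by rewrite ge_min lexx orbT. Qed.
Let k3_gt0 : 0 < kappa1 ^+ 3. Proof. exact: exprn_gt0. Qed.
Let k3_le1 : kappa1 ^+ 3 <= 1.
Proof. by apply: exprn_ile1 => //; exact: ltW. Qed.
Let scale0_ge2 : 2 <= scale0.
Proof. by rewrite /scale0 ler_pdivlMr// -[leRHS]mulr1 ler_wpM2l. Qed.
Let e_ge2 : 2 <= expR (1 : R).
Proof. by have := expR_ge1Dx (1 : R); lra. Qed.

Lemma scale1_ge1 : 1 <= scale1.
Proof.
rewrite /scale1 -!mulrA.
have h1 : 1 <= 1 + rad by have := rad_gt0; lra.
have h2 : 1 <= scale0 by have := scale0_ge2; lra.
have h3 : 1 <= expR (1 : R) by have := e_ge2; lra.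
by apply: mulr_ege1; [rewrite ler1n|do 2![apply: mulr_ege1 => //]].
Qed.

Let ln_scale1_ge0 : 0 <= ln scale1. Proof. exact/ln_ge0/scale1_ge1. Qed.

Lemma sample_constant_gt0 : 0 < sample_constant.
Proof. by rewrite /sample_constant mulr_gt0 ?mulr_gt0//; have := ln_scale1_ge0; lra. Qed.

Variables (T : nat) (L Lpi tau G eps delta : R).
Hypotheses (T_gt0 : (0 < T)%N) (eps_gt0 : 0 < eps) (eps_le : eps <= 2 * T%:R).
Hypotheses (kL : kappa1 <= L) (kLpi : kappa1 <= Lpi) (ktau : kappa1 <= tau).
Hypotheses (G_ge1 : 1 <= G) (delta_gt0 : 0 < delta) (delta_lt1 : delta < 1).

Let A := T%:R * Lpi * L * tau * G / (delta * eps).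
Let Lam := Num.max 1 (ln A).
Let q := scale0 * expR Lam.
Let b := scale1 * expR Lam.

Let T_ge1 : (1 : R) <= T%:R. Proof. by rewrite ler1n. Qed.
Let L_gt0 : 0 < L. Proof. exact: lt_le_trans kL. Qed.
Let Lpi_gt0 : 0 < Lpi. Proof. exact: lt_le_trans kLpi. Qed.
Let tau_gt0 : 0 < tau. Proof. exact: lt_le_trans ktau. Qed.
Let G_gt0 : 0 < G. Proof. exact: lt_le_trans G_ge1. Qed.
Let Teps_ge : 2^-1 <= T%:R / eps.
Proof. by rewrite ler_pdivlMr//; have := eps_le; lra. Qed.
Let idelta_ge1 : 1 <= delta^-1.
Proof. by rewrite invf_ge1// ltW. Qed.
Let Lam_ge1 : 1 <= Lam. Proof. by rewrite le_max lexx. Qed.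

Let A_le : A <= expR Lam.
Proof.
have A0 : 0 < A by rewrite divr_gt0 ?mulr_gt0// ltr0n.
rewrite -[A]lnK ?posrE// ler_expR le_max lexx orbT//.
Qed.

Let AE : A = T%:R / eps * (Lpi * (L * (tau * (G * delta^-1)))).
Proof. by rewrite /A; field; rewrite !gt_eqF. Qed.

Let le_q (x : R) : x * (kappa1 ^+ 3 / 2) <= A -> x <= q.
Proof.
move=> h; rewrite /q /scale0 mulrAC ler_pdivlMr//.
by have := A_le; lra.
Qed.

Let prodP (u v1 v2 v3 v4 v5 w1 w2 w3 w4 w5 w6 : R) :
  0 <= w1 -> 0 <= w2 -> 0 <= w3 -> 0 <= w4 -> 0 <= w5 -> 0 <= w6 ->
  w1 <= u -> w2 <= v1 -> w3 <= v2 -> w4 <= v3 -> w5 <= v4 -> w6 <= v5 ->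
  w1 * (w2 * (w3 * (w4 * (w5 * w6)))) <= u * (v1 * (v2 * (v3 * (v4 * v5)))).
Proof. by move=> *; do ?[apply: ler_pM => //]; rewrite ?mulr_ge0. Qed.

Let k_le : kappa1 ^+ 3 / 2 <= kappa1 ^+ 2 / 2.
Proof. by rewrite ler_pM2r// exprS ler_piMl// exprn_ge0// ltW. Qed.

Lemma Teps_le_q : T%:R / eps <= q.
Proof.
apply: le_q; rewrite AE.
have := @prodP (T%:R / eps) Lpi L tau G delta^-1 (T%:R / eps) kappa1 kappa1 kappa1 1 1.
rewrite !ler01 !lexx (ltW kappa1_gt0) kL kLpi ktau G_ge1 idelta_ge1.
have u0 : 0 <= T%:R / eps by apply: le_trans Teps_ge.
rewrite u0 => /(_ isT isT isT isT isT isT isT isT isT isT isT isT).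
apply: le_trans; rewrite ler_wpM2l// !mulr1.
rewrite (_ : kappa1 * (kappa1 * kappa1) = kappa1 ^+ 3); last by ring.
have := k3_gt0; lra.
Qed.

Lemma L_le_q : L <= q.
Proof.
apply: le_q; rewrite AE.
have := @prodP (T%:R / eps) Lpi L tau G delta^-1 2^-1 kappa1 L kappa1 1 1.
rewrite invr_ge0 !ler0n !ler01 !lexx (ltW kappa1_gt0) (ltW L_gt0) kLpi ktau G_ge1
  idelta_ge1 Teps_ge.
move=> /(_ isT isT isT isT isT isT isT isT isT isT isT isT).
apply: le_trans; rewrite !mulr1.
rewrite (_ : 2^-1 * _ = L * (kappa1 ^+ 2 / 2)); last by ring.
by rewrite ler_wpM2l// ltW.
Qed.

Lemma Lpi_le_q : Lpi <= q.
Proof.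
apply: le_q; rewrite AE.
have := @prodP (T%:R / eps) Lpi L tau G delta^-1 2^-1 Lpi kappa1 kappa1 1 1.
rewrite invr_ge0 !ler0n !ler01 !lexx (ltW kappa1_gt0) (ltW Lpi_gt0) kL ktau G_ge1
  idelta_ge1 Teps_ge.
move=> /(_ isT isT isT isT isT isT isT isT isT isT isT isT).
apply: le_trans; rewrite !mulr1.
rewrite (_ : 2^-1 * _ = Lpi * (kappa1 ^+ 2 / 2)); last by ring.
by rewrite ler_wpM2l// ltW.
Qed.

Lemma G_le_q : G <= q.
Proof.
apply: le_q; rewrite AE.
have := @prodP (T%:R / eps) Lpi L tau G delta^-1 2^-1 kappa1 kappa1 kappa1 G 1.
rewrite invr_ge0 !ler0n !ler01 !lexx (ltW kappa1_gt0) (ltW G_gt0) kL kLpi ktau idelta_ge1 Teps_ge.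
move=> /(_ isT isT isT isT isT isT isT isT isT isT isT isT).
apply: le_trans; rewrite !mulr1 le_eqVlt; apply/orP; left; apply/eqP; ring.
Qed.

Lemma idelta_le_q : delta^-1 <= q.
Proof.
apply: le_q; rewrite AE.
have := @prodP (T%:R / eps) Lpi L tau G delta^-1 2^-1 kappa1 kappa1 kappa1 1 delta^-1.
have d0 : 0 <= delta^-1 by exact: le_trans idelta_ge1.
rewrite d0 invr_ge0 !ler0n !ler01 !lexx (ltW kappa1_gt0) kL kLpi ktau G_ge1 Teps_ge.
move=> /(_ isT isT isT isT isT isT isT isT isT isT isT isT).
apply: le_trans; rewrite mul1r le_eqVlt; apply/orP; left; apply/eqP; ring.
Qed.

Let q_ge2 : 2 <= q.
Proof.
have h : 1 <= expR Lam by rewrite -expR0 ler_expR (le_trans _ Lam_ge1).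
rewrite /q; have := scale0_ge2; nra.
Qed.

Let bE : b = 14 * expR 1 * (1 + rad) * q.
Proof. by rewrite /b /q /scale1 !mulrA. Qed.

Let cst_ge : 28 <= 14 * expR 1 * (1 + rad).
Proof. have := e_ge2; have := rad_gt0; nra. Qed.

Let b_ge : 28 * q <= b.
Proof. by rewrite bE; apply: ler_wpM2r => //; have := q_ge2; lra. Qed.

Let b_ge1 : 1 <= b. Proof. by have := b_ge; have := q_ge2; lra. Qed.

Let nat_le_exp (x : R) : 2 <= x -> T%:R <= x ^+ T.
Proof.
move=> x2; apply: (@le_trans _ _ ((2 ^ T)%:R)).
  by rewrite ler_nat ltnW// ltn_expl.
by rewrite natrX lerXn2r ?nnegrE//; lra.
Qed.

Lemma base_ge2 : 2 <= b.
Proof. by have := b_ge; have := q_ge2; lra. Qed.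

Lemma horizon_le : T%:R <= b ^+ T.
Proof. exact: nat_le_exp base_ge2. Qed.

(** Solves the equation that the discretization error for [radius T.+1] be eps / 8. *)
Definition mesh : R :=
  eps / (8 * (2 * G + (T%:R + 1) * (2 * G) * Lpi * T.+1%:R) * (4 * L + 3) ^+ T.+1).

Let den_gt0 : 0 < 8 * (2 * G + (T%:R + 1) * (2 * G) * Lpi * T.+1%:R).
Proof.
by rewrite mulr_gt0// addr_gt0 ?mulr_gt0 ?ltr0n//.
Qed.

Let rho_gt0 : 0 < (4 * L + 3) ^+ T.+1.
Proof. by apply: exprn_gt0; have := L_gt0; lra. Qed.

Lemma mesh_gt0 : 0 < mesh.
Proof. by rewrite /mesh divr_gt0// mulr_gt0. Qed.

Lemma mesh_err : 2 * G * ((4 * L + 3) ^+ T.+1 * mesh)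
  + (T%:R + 1) * (2 * G) * Lpi * ((4 * L + 3) ^+ T.+1 * mesh) * T.+1%:R = eps / 8.
Proof.
have h1 := lt0r_neq0 den_gt0; have h2 := lt0r_neq0 rho_gt0.
rewrite /mesh; move: h1 h2; set r := _ ^+ T.+1; set s := (T%:R + 1) * _ * _ * _.
set X := 2 * G + s => h1 h2.
have -> : 2 * G * (r * (eps / (8 * X * r)))
  + (T%:R + 1) * (2 * G) * Lpi * (r * (eps / (8 * X * r))) * T.+1%:R
  = X * (r * (eps / (8 * X * r))) by rewrite /X /s; ring.
have h3 : X != 0 by apply: contraNneq h1 => ->; rewrite mulr0.
by field; rewrite h2 h3.
Qed.

(** The numerical factor with q^2 and T / eps fits into (7 q)^3, a remaining T into (7 q)^T and the
    growth of the radius into (7 q)^(T + 1); the exponents add up to at most 6 T. *)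
Let mesh_inv : mesh^-1 <= (7 * q) ^+ (6 * T).
Proof.
have q2 := q_ge2; have q7 : 1 <= 7 * q by lra.
have -> : mesh^-1 = 8 * (2 * G + (T%:R + 1) * (2 * G) * Lpi * T.+1%:R)
   * (eps^-1 * (4 * L + 3) ^+ T.+1).
  by rewrite /mesh invf_div; rewrite mulrAC -!mulrA; congr (_ * (_ * _)); rewrite mulrC.
have h1 : (4 * L + 3) ^+ T.+1 <= (7 * q) ^+ T.+1.
  apply: lerXn2r; rewrite ?nnegrE; have := L_le_q; have := L_gt0; lra.
have h2 : 8 * (2 * G + (T%:R + 1) * (2 * G) * Lpi * T.+1%:R)
    <= 80 * (T%:R * T%:R) * (q * q).
  have := G_le_q; have := Lpi_le_q; have := T_ge1; have := G_gt0; have := Lpi_gt0.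
  have -> : T.+1%:R = T%:R + 1 :> R by rewrite natr1.
  set t := T%:R => Lp0 G0 t1 Lq Gq.
  have a1 : G <= q * q by nra.
  have a2 : G * Lpi <= q * q by apply: ler_pM => //; exact: ltW.
  have a3 : (t + 1) * (t + 1) <= 4 * (t * t) by nra.
  have a4 : (t + 1) * (t + 1) * (G * Lpi) <= 4 * (t * t) * (q * q).
    by apply: ler_pM => //; rewrite mulr_ge0//; lra.
  have a5 : 1 * G <= t * t * (q * q) by apply: ler_pM => //; nra.
  have -> : 8 * (2 * G + (t + 1) * (2 * G) * Lpi * (t + 1))
     = 16 * (1 * G) + 16 * ((t + 1) * (t + 1) * (G * Lpi)) by ring.
  lra.
have i0 : 0 <= eps^-1 by rewrite invr_ge0 ltW.
apply: (@le_trans _ _ (80 * (T%:R * T%:R) * (q * q) * (eps^-1 * (7 * q) ^+ T.+1))).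
  apply: ler_pM => //; first exact: ltW.
    by rewrite mulr_ge0// ltW.
  by rewrite ler_wpM2l.
have h3 := Teps_le_q.
have q0 : 0 <= q by lra.
have u0 : 0 <= T%:R / eps by rewrite divr_ge0// ltW.
have h4 : T%:R <= (7 * q) ^+ T by apply: nat_le_exp; lra.
have p0 : 0 <= (7 * q) ^+ T.+1 by rewrite exprn_ge0//; lra.
have -> : 80 * (T%:R * T%:R) * (q * q) * (eps^-1 * (7 * q) ^+ T.+1)
  = (80 * (q * q) * (T%:R / eps)) * (T%:R * (7 * q) ^+ T.+1) by ring.
apply: (@le_trans _ _ ((7 * q) ^+ 3 * ((7 * q) ^+ T * (7 * q) ^+ T.+1))).
  apply: ler_pM.
  - by apply: mulr_ge0 => //; apply: mulr_ge0; [rewrite ler0n|exact: mulr_ge0].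
  - by rewrite mulr_ge0.
  - have : q * q * (T%:R / eps) <= q * q * q.
      by apply: ler_wpM2l => //; exact: mulr_ge0.
    have -> : (7 * q) ^+ 3 = 343 * (q * q * q) by ring.
    have : 0 <= q * q * q by apply: mulr_ge0 => //; exact: mulr_ge0.
    lra.
  - by apply: ler_wpM2r.
have hm : (3 + (T + T.+1) <= 6 * T)%N by have := T_gt0; clear; lia.
by rewrite -(exprD _ T) -exprD; exact: ler_weXn2l.
Qed.

Lemma net_size_le d : (2 * expR 1 * (1 + rad / mesh)) ^+ d <= b ^+ (6 * T * d).
Proof.
have q2 := q_ge2; have e2 := e_ge2.
rewrite exprM; apply: lerXn2r; rewrite ?nnegrE.
- by rewrite !mulr_ge0 ?expR_ge0// addr_ge0// divr_ge0 ?ltW ?mesh_gt0.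
- by rewrite exprn_ge0// (le_trans ler01 b_ge1).
have q7 : 1 <= (7 * q) ^+ (6 * T) by apply: exprn_ege1; lra.
have h1 : 1 + rad / mesh <= (1 + rad) * (7 * q) ^+ (6 * T).
  have := ler_wpM2l (ltW rad_gt0) mesh_inv; lra.
apply: (@le_trans _ _ (2 * expR 1 * (1 + rad) * (7 * q) ^+ (6 * T))).
  by rewrite -[leRHS]mulrA ler_wpM2l// mulr_ge0// expR_ge0.
have -> : b = 2 * expR 1 * (1 + rad) * (7 * q) by rewrite bE; ring.
rewrite [in leRHS]exprMn ler_wpM2r//; first lra.
apply: ler_eXnr; first by rewrite muln_gt0.
by have := cst_ge; lra.
Qed.

Lemma cost_grid_le : (Num.truncn (T%:R / mesh)).+1%:R <= b ^+ (7 * T).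
Proof.
have q2 := q_ge2.
have q7 : 1 <= (7 * q) ^+ (6 * T) by apply: exprn_ege1; lra.
have m0 := mesh_gt0.
have h0 : 0 <= T%:R / mesh by rewrite divr_ge0 ?ler0n ?ltW.
have h1 : (Num.truncn (T%:R / mesh)).+1%:R <= T%:R * (1 + mesh^-1).
  rewrite -natr1 mulrDr mulr1 addrC lerD//; by rewrite truncn_le.
apply: (le_trans h1); rewrite mulSn exprD.
apply: ler_pM => //.
- by rewrite addr_ge0// invr_ge0 ltW.
- by apply: nat_le_exp; have := b_ge; lra.
apply: (@le_trans _ _ (2 * (7 * q) ^+ (6 * T))); first by have := mesh_inv; lra.
apply: (@le_trans _ _ (2 ^+ (6 * T) * (7 * q) ^+ (6 * T))).
  rewrite ler_wpM2r//; first lra.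
  by apply: ler_eXnr; rewrite ?muln_gt0//; lra.
rewrite -exprMn; apply: lerXn2r; rewrite ?nnegrE; have := b_ge; have := b_ge1; lra.
Qed.

Lemma grid_size_le : (grid_size T eps)%:R <= b.
Proof.
have h0 : 0 <= 8 * (T%:R + 1) / eps.
  by apply: divr_ge0; [rewrite mulr_ge0// addr_ge0|exact: ltW].
apply: (@le_trans _ _ (8 * (T%:R + 1) / eps + 2)).
  by rewrite /grid_size -addn2 natrD lerD// truncn_le.
apply: le_trans b_ge.
have : 8 * (T%:R + 1) / eps <= 16 * (T%:R / eps).
  rewrite mulrA ler_wpM2r ?invr_ge0 ?(ltW eps_gt0)//; have := T_ge1; lra.
by have := Teps_le_q; have := q_ge2; lra.
Qed.

Lemma delta_ge_b : b^-1 <= delta.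
Proof.
rewrite invf_ple ?posrE//; last by rewrite (lt_le_trans ltr01 b_ge1).
by apply: le_trans idelta_le_q _; have := b_ge; have := q_ge2; lra.
Qed.

Lemma union_tail (D m : nat) (x : R) : (m + 1 <= 24 * T * D)%N ->
  24 * T%:R * D%:R * (ln scale1 + 1) * Lam <= x ->
  b ^+ m * expR (- x) <= delta.
Proof.
move=> hm hx; apply: le_trans delta_ge_b.
have b0 : 0 < b by rewrite (lt_le_trans ltr01 b_ge1).
rewrite -[leLHS](mulKf (lt0r_neq0 b0)) -[leRHS]mulr1 ler_pM2l ?invr_gt0//.
rewrite mulrA -exprS -addn1.
(* Since b = scale1 exp Lam, where ln scale1 >= 0 and Lam >= 1. *)
have lnb : ln b <= (ln scale1 + 1) * Lam.
  rewrite /b lnM ?posrE ?expR_gt0//; last by rewrite (lt_le_trans ltr01 scale1_ge1).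
  by rewrite expRK; have := ln_scale1_ge0; have := Lam_ge1; nra.
have -> : b ^+ (m + 1) = expR ((m + 1)%:R * ln b) by rewrite expRM_natl lnK// posrE.
rewrite -expRD -[leRHS]expR0 ler_expR subr_le0; apply: le_trans hx.
have lnb0 : 0 <= ln b by rewrite ln_ge0.
apply: (@le_trans _ _ ((24 * T * D)%:R * ln b)).
  by rewrite ler_wpM2r// ler_nat.
by rewrite !natrM -[leRHS]mulrA ler_wpM2l//.
Qed.

End SampleSize.

(** * The two sample complexity bounds *)

Lemma exists_nets {R : realType} d (T : nat) (rad eta : R) (S : nat -> set 'rV[R]_d) :
  0 < eta -> (forall t, (t <= T)%N -> S t !=set0) ->
  (forall t, (t <= T)%N -> exists z, forall s, S t s -> enorm (s - z) <= rad) ->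
  exists (pt : nat -> net d rad eta -> 'rV[R]_d)
    (proj : nat -> 'rV[R]_d -> net d rad eta),
  [/\ forall t j, (t <= T)%N -> S t (pt t j),
      forall t, (t <= T)%N -> fmeasurable (proj t : borel 'rV[R]_d -> _)
    & forall t s, (t <= T)%N -> S t s -> enorm (s - pt t (proj t s)) <= eta].
Proof.
move=> eta0 S0 Sr.
have h t : exists pp : (net d rad eta -> 'rV[R]_d) * ('rV[R]_d -> net d rad eta),
    (t <= T)%N -> [/\ forall j, S t (pp.1 j),
      fmeasurable (pp.2 : borel 'rV[R]_d -> _)
      & forall s, S t s -> enorm (s - pp.1 (pp.2 s)) <= eta].
  have [tT|tT] := leqP t T; last by exists (fun=> 0, fun=> net0 d rad eta).
  by have [pt [proj hp]] := exists_net eta0 (S0 t tT) (Sr t tT); exists (pt, proj).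
have [f hf] := choice h.
exists (fun t => (f t).1), (fun t => (f t).2); split.
- by move=> t j tT; have [h1 _ _] := hf t tT.
- by move=> t tT; have [_ h1 _] := hf t tT.
- by move=> t s tT hs; have [_ _ h1] := hf t tT; exact: h1.
Qed.

Lemma with_probability_sure {R : realType} d (Omega : measurableType d)
    (Pr : probability Omega R) (delta : R) (Q : Omega -> Prop) :
  0 <= delta -> (forall omega, Q omega) -> with_probability_ge Pr (1 - delta) Q.
Proof.
move=> d0 hQ; exists setT; split => //.
by rewrite probability_setT lee_fin gerBl.
Qed.

Lemma with_probability_mono {R : realType} d (Omega : measurableType d)
    (Pr : probability Omega R) (p : R) (Q Q' : Omega -> Prop) :
  (forall omega, Q omega -> Q' omega) ->
  with_probability_ge Pr p Q -> with_probability_ge Pr p Q'.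
Proof. by move=> h [E [mE PE hE]]; exists E; split => // omega /hE/h. Qed.

Lemma card_net_dim0 {R : realType} d (rad eta : R) : d = 0%N -> 0 < rad -> 0 < eta ->
  #|{: net d rad eta}| = 1%N.
Proof.
move=> -> rad0 eta0; apply/eqP; rewrite eqn_leq; apply/andP; split.
  by have := card_net 0 eta0 rad0; rewrite expr0 -[X in _ <= X]/(1%:R) ler_nat.
by apply/card_gt0P; exists (net0 0 rad eta).
Qed.

Lemma dist_le_of_itv {R : realType} (x y : \bar R) (c e : R) :
  (0 <= x <= c%:E)%E -> (0 <= y <= c%:E)%E -> c <= e -> (`|x - y| <= e%:E)%E.
Proof.
move=> hx hy ce.
have fin (z : \bar R) : (0 <= z <= c%:E)%E -> z \is a fin_num.
  by move=> /andP[z0 zc]; rewrite ge0_fin_numE//; apply: le_lt_trans zc _; rewrite ltry.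
have fx := fin _ hx; have fy := fin _ hy; move: hx hy.
rewrite -(fineK fx) -(fineK fy) -EFinB abse_EFin !lee_fin ler_norml; lra.
Qed.

Section SampleComplexity.
Context {R : realType} (rad kappa : R).
Hypotheses (rad_gt0 : 0 < rad) (kappa_gt0 : 0 < kappa).
Variables (T dS dA : nat) (M : soc R dS dA) (L tau : R) (phi : R -> \bar R).
Variable P : forall t, probability (borel (noise M t)) R.
Hypotheses (T_gt0 : (0 < T)%N) (wf : soc_wf M T) (L_gt0 : 0 < L).
Hypotheses (reg : soc_regular M T rad L) (Hphi : divergence_function phi).
Hypotheses (tau_gt0 : 0 < tau) (kL : kappa <= L) (ktau : kappa <= tau).
Variables (eps delta : R) (n : nat).
Hypotheses (eps_gt0 : 0 < eps) (delta_itv : 0 < delta < 1) (n_gt0 : (0 < n)%N).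
Context {d : measure_display} {Omega : measurableType d}.
Variables (Pr : probability Omega R) (X : forall t, nat -> Omega -> noise M t).
Hypothesis iid : iid_samples T n P Pr X.

Let G := growth_inv phi (16 * T%:R * tau / eps).
Let B := (T%:R + 1) * (2 * G).
Let k1 := kappa1 kappa.
Let delta_gt0 : 0 < delta. Proof. by case/andP: delta_itv. Qed.
Let delta_lt1 : delta < 1. Proof. by case/andP: delta_itv. Qed.
Let k1_le x : kappa <= x -> k1 <= x.
Proof. by apply: le_trans; rewrite /k1 /kappa1 ge_min lexx. Qed.
Let k1_le1 : k1 <= 1. Proof. by rewrite /k1 /kappa1 ge_min lexx orbT. Qed.
Let G_ge1 : 1 <= G. Proof. exact: growth_inv_ge1. Qed.
Let T_ge1 : (1 : R) <= T%:R. Proof. by rewrite ler1n. Qed.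
Let P1 t : P t setT = 1%E. Proof. exact: probability_setT. Qed.

(** The nets need a point in every state space; an initial state is propagated by arbitrary controls
    and noises. *)
Let states_neq0 s0 : state M 0 s0 -> forall t, (t <= T)%N -> state M t !=set0.
Proof.
move=> hs; elim=> [|t IH] tT; first by exists s0.
have [s hst] := IH (ltnW tT).
have [a ha] := control_neq0 wf (ltnW tT).
by exists (trans s a (point : noise M t)); exact: (trans_state wf).
Qed.

Let B_bounds : 0 < B /\ B <= 4 * T%:R * G.
Proof. by rewrite /B; have := G_ge1; have := T_ge1; split; nra. Qed.

Let count_natr (a c : nat) : (a ^ 2 * c * 2)%:R = a%:R ^+ 2 * c%:R * 2 :> R.
Proof. by rewrite !natrM expr2. Qed.

Let exponent_ge (c D Lam N : R) : 0 <= c -> 0 <= D -> 0 <= Lam ->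
  24 * (8 * 16 * 16) * c * (T%:R ^+ 3 * G ^+ 2 * D / eps ^+ 2 * Lam) <= N ->
  24 * T%:R * D * c * Lam <= N * ((eps / 4) ^+ 2 / (8 * B ^+ 2)).
Proof.
move=> c0 D0 Lam0 hn; have [B0 B4] := B_bounds.
have T0 : (0 : R) < T%:R by rewrite ltr0n.
have G0 : 0 < G by exact: lt_le_trans G_ge1.
have -> : 24 * T%:R * D * c * Lam =
    24 * (8 * 16 * 16) * c * (T%:R ^+ 3 * G ^+ 2 * D / eps ^+ 2 * Lam)
      * ((eps / 4) ^+ 2 / (8 * (4 * T%:R * G) ^+ 2)).
  by field; rewrite !gt_eqF.
apply: ler_pM => //.
- by rewrite !mulr_ge0// ?invr_ge0 ?exprn_ge0// ltW.
- by rewrite divr_ge0 ?sqr_ge0// mulr_ge0// sqr_ge0.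
rewrite ler_wpM2l ?sqr_ge0// lef_pV2 ?posrE ?mulr_gt0 ?exprn_gt0//.
by rewrite ler_pM2l//; apply: lerXn2r; rewrite ?nnegrE ?(ltW B0)// (le_trans (ltW B0)).
Qed.

Lemma markov_sample_complexity (Lpi : R) (pi : @markov_policy R dS dA) :
  0 < Lpi -> kappa <= Lpi -> markov_admissible M T pi -> markov_lipschitz M T Lpi pi ->
  sample_constant rad kappa * (T%:R ^+ 3 * G ^+ 2 * dS%:R / eps ^+ 2
    * Num.max 1 (ln (T%:R * Lpi * L * tau * G / (delta * eps)))) <= n%:R ->
  with_probability_ge Pr (1 - delta) (fun omega => forall s, state M 0 s ->
    (`|markov_risk T phi tau (empirical n X omega) pi s
       - markov_risk T phi tau (fun t => P t) pi s| <= eps%:E)%E).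
Proof.
move=> Lpi0 kLpi pi_adm pi_lip hn.
have [[s0 hs0]|ns] := pselect (exists s, state M 0 s); last first.
  apply: with_probability_sure => [|omega s hs]; first exact: ltW.
  by exfalso; apply: ns; exists s.
(* For eps > 2 T >= T + 1 the a priori bounds suffice. *)
have [epsT|epsT] := ltP (2 * T%:R) eps.
  apply: with_probability_sure => [|omega s hs]; first exact: ltW.
  apply: dist_le_of_itv (markov_risk_itv wf reg (empiricalT X n_gt0 omega) Hphi tau_gt0 hs pi_adm)
    (markov_risk_itv wf reg P1 Hphi tau_gt0 hs pi_adm) _.
  by have := T_ge1; move: epsT; lra.
have kL' := k1_le kL; have kLpi' := k1_le kLpi; have ktau' := k1_le ktau.
pose eta := mesh T L Lpi G eps.
have eta0 : 0 < eta by exact: (mesh_gt0 kappa_gt0).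
have [spt [sproj [h1 h2 h3]]] := exists_nets eta0 (states_neq0 hs0)
  (fun t tT => state_radius reg tT).
have [apt [aproj [h4 h5 h6]]] := exists_nets eta0 (fun t tT => control_neq0 wf tT)
  (fun t tT => control_radius reg tT).
have merr := mesh_err kappa_gt0 T eps kL' kLpi' G_ge1.
have [B0 B4] := B_bounds.
have e0 : 0 < eps / 4 by rewrite divr_gt0.
have eB : eps / 4 <= 2 * B.
  by rewrite /B; have := G_ge1; have := T_ge1; move: epsT; nra.
have main := markov_concentration wf reg (ltW L_gt0) eta0 h1 h4 h2 h5 h3 h6
  Hphi T_gt0 tau_gt0 eps_gt0 n_gt0 iid (net0 dA rad eta) (err := eps / 8) e0 eB (ltW delta_gt0)
  pi_adm (ltW Lpi0) pi_lip.
have herr := lexx (eps / 8); rewrite -{1}merr in herr.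
apply: (with_probability_mono _ (main herr _)) => [omega h s hs|].
  by apply: le_trans (h s hs) _; rewrite lee_fin; have := eps_gt0; lra.
have [dS0|dS_gt0] := posnP dS.
  by left; exact: card_net_dim0.
right; have D1 : (0 < dS)%N by [].
have b2 := base_ge2 rad_gt0 kappa_gt0 T L Lpi tau G eps delta.
have sz := grid_size_le rad_gt0 kappa_gt0 T_gt0 eps_gt0 epsT kL' kLpi' ktau'
  G_ge1 delta_gt0 delta_lt1.
have cn := le_trans (card_net dS eta0 rad_gt0)
  (net_size_le rad_gt0 kappa_gt0 T_gt0 eps_gt0 epsT kL' kLpi' ktau' G_ge1 delta_gt0 delta_lt1 dS).
have hx := @exponent_ge (ln (scale1 rad kappa) + 1) dS%:R _ _ _ _ _ hn.
(* In the exponent [m], 2 stands for the pairs of dual indices, 6 T dS for the initial net points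
   and 1 for the two tails. *)
have tl := union_tail rad_gt0 kappa_gt0 T_gt0 eps_gt0 epsT kL' kLpi' ktau'
  G_ge1 delta_gt0 delta_lt1
  (D := dS) (m := 2 + 6 * T * dS + 1) _ (hx _ _ _).
apply: le_trans (tl _ _ _ _).
- rewrite ler_wpM2r ?expR_ge0// count_natr !exprD expr1.
  set b := scale1 rad kappa * _ in b2 sz cn *.
  have b0 : 0 <= b by apply: le_trans b2.
  apply: ler_pM => //.
  by apply: ler_pM => //; rewrite lerXn2r ?nnegrE.
- by move: T_gt0 D1; clear; nia.
- by rewrite addr_ge0// ln_ge0// scale1_ge1.
- by [].
- by rewrite le_max ler01.
Qed.

Lemma optimal_sample_complexity :
  sample_constant rad kappa * (T%:R ^+ 4 * G ^+ 2 * (dS + dA)%:R / eps ^+ 2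
    * Num.max 1 (ln (T%:R * L * tau * G / (delta * eps)))) <= n%:R ->
  with_probability_ge Pr (1 - delta) (fun omega => forall s, state M 0 s ->
    (`|optimal_risk T phi tau (empirical n X omega) s
       - optimal_risk T phi tau (fun t => P t) s| <= eps%:E)%E).
Proof.
move=> hn.
have [[s0 hs0]|ns] := pselect (exists s, state M 0 s); last first.
  apply: with_probability_sure => [|omega s hs]; first exact: ltW.
  by exfalso; apply: ns; exists s.
have [epsT|epsT] := ltP (2 * T%:R) eps.
  apply: with_probability_sure => [|omega s hs]; first exact: ltW.
  apply: dist_le_of_itv (optimal_risk_itv wf reg (empiricalT X n_gt0 omega) Hphi tau_gt0 hs)
    (optimal_risk_itv wf reg P1 Hphi tau_gt0 hs) _.
  by have := T_ge1; move: epsT; lra.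
have kL' := k1_le kL; have ktau' := k1_le ktau.
(* Taking Lpi = 1, allowed since kappa1 <= 1, makes the same size estimates available and turns
   their logarithm into the one of (ii). *)
pose eta := mesh T L 1 G eps.
have eta0 : 0 < eta by exact: (mesh_gt0 kappa_gt0).
have [spt [sproj [h1 h2 h3]]] := exists_nets eta0 (states_neq0 hs0)
  (fun t tT => state_radius reg tT).
have [apt [aproj [h4 h5 h6]]] := exists_nets eta0 (fun t tT => control_neq0 wf tT)
  (fun t tT => control_radius reg tT).
have merr := mesh_err kappa_gt0 T eps kL' k1_le1 G_ge1.
have [B0 B4] := B_bounds.
have e0 : 0 < eps / 4 by rewrite divr_gt0.
have eB : eps / 4 <= 2 * B.
  by rewrite /B; have := G_ge1; have := T_ge1; move: epsT; nra.
have herr : 2 * G * ((4 * L + 3) ^+ T.+1 * eta) <= eps / 8.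
  rewrite -merr -/eta lerDl; have L1 : 0 <= 4 * L + 3 by have := L_gt0; lra.
  have G0 : 0 <= G by exact: le_trans G_ge1.
  have r0 : 0 <= (4 * L + 3) ^+ T.+1 * eta by apply: mulr_ge0; [exact: exprn_ge0|exact: ltW].
  by move: r0; move: (_ * eta) => r r0; rewrite !mulr_ge0// addr_ge0.
have main := optimal_concentration wf reg (ltW L_gt0) eta0 h1 h4 h2 h3 h6
  Hphi T_gt0 tau_gt0 eps_gt0 n_gt0 iid (net0 dA rad eta) (err := eps / 8) e0 eB (ltW delta_gt0).
apply: (with_probability_mono _ (main herr _)) => [omega h s hs|].
  by apply: le_trans (h s hs) _; rewrite lee_fin; have := eps_gt0; lra.
have [dS0|dS_gt0] := posnP dS.
  by left; exact: card_net_dim0.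
right.
have b2 := base_ge2 rad_gt0 kappa_gt0 T L 1 tau G eps delta.
have hT := horizon_le rad_gt0 kappa_gt0 T L 1 tau G eps delta.
have sz := grid_size_le rad_gt0 kappa_gt0 T_gt0 eps_gt0 epsT kL' k1_le1 ktau'
  G_ge1 delta_gt0 delta_lt1.
have ns := net_size_le rad_gt0 kappa_gt0 T_gt0 eps_gt0 epsT kL' k1_le1 ktau'
  G_ge1 delta_gt0 delta_lt1.
have cS := le_trans (card_net dS eta0 rad_gt0) (ns dS).
have cA := le_trans (card_net dA eta0 rad_gt0) (ns dA).
have cg := cost_grid_le rad_gt0 kappa_gt0 T_gt0 eps_gt0 epsT kL' k1_le1 ktau'
  G_ge1 delta_gt0 delta_lt1.
have T0 : (0 : R) < T%:R by rewrite ltr0n.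
(* The tail has n / T in place of n; the fourth factor T is spent here. *)
have hn' : 24 * (8 * 16 * 16) * (ln (scale1 rad kappa) + 1) *
    (T%:R ^+ 3 * G ^+ 2 * (dS + dA)%:R / eps ^+ 2
      * Num.max 1 (ln (T%:R * 1 * L * tau * G / (delta * eps)))) <= n%:R / T%:R.
  rewrite ler_pdivlMr//; apply: le_trans hn; rewrite mulr1.
  by rewrite le_eqVlt; apply/orP; left; apply/eqP; rewrite /sample_constant; ring.
have hx := @exponent_ge (ln (scale1 rad kappa) + 1) (dS + dA)%:R _ _ _ _ _ hn'.
(* The exponent gains T for the stages, 6 T dS + 7 T for the grid states and 6 T dA for the
   controls. As dS >= 1, the sum plus 1 is below 24 T (dS + dA), which is the origin of 24. *)
have tl := union_tail rad_gt0 kappa_gt0 T_gt0 eps_gt0 epsT kL' k1_le1 ktau'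
  G_ge1 delta_gt0 delta_lt1
  (D := dS + dA) (m := 2 + 6 * T * dS + 1 + (T + (6 * T * dS + 7 * T + 6 * T * dA))) _ (hx _ _ _).
apply: le_trans (tl _ _ _ _).
- rewrite mulrA.
  have -> : n%:R * ((eps / 4) ^+ 2 / (8 * T%:R * B ^+ 2))
     = n%:R / T%:R * ((eps / 4) ^+ 2 / (8 * B ^+ 2)).
    by field; rewrite !gt_eqF.
  rewrite ler_wpM2r ?expR_ge0// count_natr.
  rewrite (_ : #|{: grid_state T eta (net dS rad eta)}| =
    (#|{: net dS rad eta}| * (Num.truncn (T%:R / eta)).+1)%N); last first.
    by rewrite card_prod card_ord.
  set b := scale1 rad kappa * _ in b2 hT sz cS cA cg *.
  rewrite natrM (exprD b (_ + _ + _)) (exprD b (_ + _)) (exprD b 2) expr1.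
  rewrite (exprD b T) (exprD b (_ + _)) (exprD b (_ * dS)).
  have b0 : 0 <= b by apply: le_trans b2.
  do ![apply: ler_pM => //].
- by move: T_gt0 dS_gt0; clear; nia.
- by rewrite addr_ge0// ln_ge0// scale1_ge1.
- by [].
- by rewrite le_max ler01.
Qed.

End SampleComplexity.

(* The constant C of the O(.) depends only on the radius rad and on a positive
   lower bound kappa of the parameters L, Lpi, tau; the logarithm is read as
   max(1, log), hence is the stated one as soon as its argument is at least e. *)
Theorem theorem4p2 (R : realType) (rad kappa : R) (rad_gt0 : 0 < rad)
    (kappa_gt0 : 0 < kappa) :
  exists2 C : R, 0 < C &
  forall (T dS dA : nat) (M : soc R dS dA) (L tau : R) (phi : R -> \bar R)
    (P : forall t, probability (borel (noise M t)) R),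
  (0 < T)%N -> soc_wf M T -> 0 < L -> soc_regular M T rad L ->
  divergence_function phi -> 0 < tau ->
  kappa <= L -> kappa <= tau ->
  (forall (Lpi : R) (pi : markov_policy),
     0 < Lpi -> kappa <= Lpi ->
     markov_admissible M T pi -> markov_lipschitz M T Lpi pi ->
   forall eps delta : R, 0 < eps -> 0 < delta < 1 ->
   let G := growth_inv phi (16 * T%:R * tau / eps) in
   forall n : nat, (0 < n)%N ->
     C * (T%:R ^+ 3 * G ^+ 2 * dS%:R / eps ^+ 2
          * Num.max 1 (ln (T%:R * Lpi * L * tau * G / (delta * eps))))
       <= n%:R ->
   forall (d : measure_display) (Omega : measurableType d)
     (Pr : probability Omega R) (X : forall t, nat -> Omega -> noise M t),
   iid_samples T n P Pr X ->
   with_probability_ge Pr (1 - delta) (fun omega =>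
     forall s, state M 0 s ->
       (`|markov_risk T phi tau (empirical n X omega) pi s
          - markov_risk T phi tau (fun t => P t) pi s| <= eps%:E)%E))
  /\
  (forall eps delta : R, 0 < eps -> 0 < delta < 1 ->
   let G := growth_inv phi (16 * T%:R * tau / eps) in
   forall n : nat, (0 < n)%N ->
     C * (T%:R ^+ 4 * G ^+ 2 * (dS + dA)%:R / eps ^+ 2
          * Num.max 1 (ln (T%:R * L * tau * G / (delta * eps))))
       <= n%:R ->
   forall (d : measure_display) (Omega : measurableType d)
     (Pr : probability Omega R) (X : forall t, nat -> Omega -> noise M t),
   iid_samples T n P Pr X ->
   with_probability_ge Pr (1 - delta) (fun omega =>
     forall s, state M 0 s ->
       (`|optimal_risk T phi tau (empirical n X omega) s
          - optimal_risk T phi tau (fun t => P t) s| <= eps%:E)%E)).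
Proof.
exists (sample_constant rad kappa); first exact: sample_constant_gt0.
move=> T dS dA M L tau phi P T_gt0 wf L_gt0 reg Hphi tau_gt0 kL ktau; split.
  move=> Lpi pi Lpi_gt0 kLpi pi_adm pi_lip eps delta eps_gt0 hdelta G n n_gt0 hn.
  move=> d Omega Pr X iid.
  exact: (markov_sample_complexity rad_gt0 kappa_gt0 T_gt0 wf L_gt0 reg Hphi
    tau_gt0 kL ktau eps_gt0 hdelta n_gt0 iid Lpi_gt0 kLpi pi_adm pi_lip hn).
move=> eps delta eps_gt0 hdelta G n n_gt0 hn d Omega Pr X iid.
exact: (optimal_sample_complexity rad_gt0 kappa_gt0 T_gt0 wf L_gt0 reg Hphi
  tau_gt0 kL ktau eps_gt0 hdelta n_gt0 iid hn).
Qed.
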